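(* Let $(G\rightrightarrows M,\eta)$ be a Riemannian groupoid such that the coarse orbit space $M/G$ is connected, and let $x,y\in M$. Then $d_N([x],[y])$ equals the infimum of the lengths $\ell(\alpha)$ over all stacky curves $\alpha:I\to[M/G]$ connecting $[x]$ and $[y]$ (i.e. with $[x],[y]\in\alpha(I)$).
   Context: Lie groupoids: $G\rightrightarrows M$ has manifolds $M$ of objects and $G$ of arrows ($G$ possibly non-Hausdorff), surjective submersions $s,t:G\to M$ (source, target), a smooth multiplication $m$ on $G^{(2)}=\{(g,h):s(g)=t(h)\}$, units $u:M\to G$ (used to regard $M\subset G$) and inverses. $O_x\subset M$ is the orbit of $x$, $G_x=s^{-1}(x)\cap t^{-1}(x)$ the isotropy group, $M/G$ the coarse orbit space with the quotient topology, $[x]\in M/G$ the class of $x$, and $N_xO=T_xM/T_xO_x$. An arrow $g$ from $x$ to $y$ induces $N_xO\to N_yO$, $g\cdot[v]=[d_gt(w)]$ for any $w\in T_gG$ with $d_gs(w)=v$. Riemannian groupoids: a metric on the total space of a submersion is transverse to the submersion if it descends to a metric on the base making it a Riemannian submersion. A groupoid metric on $G\rightrightarrows M$ is a Riemannian metric $\eta=\eta^{(2)}$ on $G^{(2)}$, invariant under the $S_3$-action that permutes the vertices of commutative triangles (generated by $(g,h)\mapsto(h^{-1},g^{-1})$ and $(g,h)\mapsto(gh,h^{-1})$), and transverse to $m$. It induces metrics $\eta^{(1)}$ on $G$ and $\eta^{(0)}$ on $M$ for which $m$ and the two projections $G^{(2)}\to G$, and $s,t:G\to M$, are Riemannian submersions.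 A Riemannian groupoid is a Lie groupoid with a groupoid metric. $\eta^{(0)}$ induces inner products on the spaces $N_xO\cong (T_xO_x)^\perp$, preserved by the action of arrows; for $v\in T_xM$, $\|v\|_N$ is the norm of $[v]\in N_xO$. Stacky curves: $[M/G]$ denotes the orbit differentiable stack. A stacky curve $\alpha:I\to[M/G]$, $I$ a real interval, is an equivalence class of cocycles: an open cover $(U_i)$ of $I$, with $U_{ji}=U_j\cap U_i$, and smooth maps $a_{ji}:U_{ji}\to G$, $a_i=a_{ii}:U_i\to M$, with $s\circ a_{ji}=a_i$, $t\circ a_{ji}=a_j$ and $a_{kj}a_{ji}=a_{ki}$ on triple intersections. Two cocycles are equivalent if, after restriction to a common refinement of the covers, there are smooth $h_i:U_i\to G$ with $h_i(\tau)$ an arrow from $a_i(\tau)$ to $b_i(\tau)$ and $b_{ji}h_i=h_ja_{ji}$. One sets $\alpha(\tau)=[a_i(\tau)]\in M/G$ and the speed $\|\alpha'(\tau)\|=\|a_i'(\tau)\|_N$ for $\tau\in U_i$; these do not depend on choices. The length is $\ell(\alpha)=\int_I\|\alpha'(\tau)\|\,d\tau$ (the speed is a continuous function of $\tau$). Normal pseudo-distance: let $d$ be the Riemannian distance of $\eta^{(0)}$ on each component of $M$. A chain from $x$ to $y$ is a sequence $(x_0,\dots,x_{2n+1})$ in $M$ with $x_0=x$, $x_{2n+1}=y$, $x_{2i},x_{2i+1}$ in the same orbit, and $x_{2i-1},x_{2i}$ in the same component of $M$. Then $d_N([x],[y])=\inf\{\sum_{i=1}^n d(x_{2i-1},x_{2i})\}$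 over all chains from $x$ to $y$. *)

(* Defs.v *)
From HB Require Import structures.
From mathcomp Require Import all_boot all_order all_algebra generic_quotient.
From mathcomp Require Import all_classical all_reals all_analysis.

Set Implicit Arguments.
Unset Strict Implicit.
Unset Printing Implicit Defensive.

Import Order.TTheory GRing.Theory Num.Theory.
Import numFieldNormedType.Exports.

Local Open Scope classical_set_scope.
Local Open Scope ring_scope.

(** * Smooth maps between open subsets of normed spaces *)

(* For U open in a finite-dimensional V this is the usual notion of a C^k map:
   all iterated directional derivatives of order <= k exist and are
   continuous on U. *)
Fixpoint Ck (R : realType) (V W : normedModType R) (k : nat)
    (U : set V) (f : V -> W) : Prop :=
  (forall x, U x -> {for x, continuous f}) /\
  match k with
  | 0 => True
  | k'.+1 => forall v : V,
      (forall x, U x -> derivable f x v) /\ Ck k' U (fun x => 'D_v f x)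
  end.

Definition smooth (R : realType) (V W : normedModType R)
    (U : set V) (f : V -> W) : Prop := forall k, Ck k U f.

(** * Manifolds, possibly non-Hausdorff *)

(* The atlas is indexed by the points: [chart p] is a chart around p, with
   domain [dom p] and inverse [chartV p]; this index also provides a preferred
   chart at each point, which is used below to represent tangent vectors.
   Values of [chart p] outside [dom p] and of [chartV p] outside the image of
   the chart are irrelevant. *)
Record smooth_structure (R : realType) (n : nat) (T : topologicalType) := {
  dom : T -> set T ;
  chart : T -> T -> 'rV[R]_n ;
  chartV : T -> 'rV[R]_n -> T ;
  dom_open : forall p, open (dom p) ;
  dom_center : forall p, dom p p ;
  chartK : forall p q, dom p q -> chartV p (chart p q) = q ;
  chart_open : forall p, open (chart p @` dom p) ;
  chart_continuous :
    forall p q, dom p q -> {for q, continuous (chart p)} ;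
  chartV_continuous :
    forall p u, (chart p @` dom p) u -> {for u, continuous (chartV p)} ;
  transition_smooth :
    forall p q, smooth (chart p @` (dom p `&` dom q)) (chart q \o chartV p) ;
  structure_countable : @second_countable T
}.

Record manifold (R : realType) (n : nat) := Manifold {
  msort :> topologicalType ;
  mstruct : smooth_structure R n msort
}.

Definition mdom (R : realType) n (M : manifold R n) (p : M) : set M :=
  dom (mstruct M) p.
Definition mchart (R : realType) n (M : manifold R n) (p : M) : M -> 'rV[R]_n :=
  chart (mstruct M) p.
Definition mchartV (R : realType) n (M : manifold R n) (p : M) :
    'rV[R]_n -> M := chartV (mstruct M) p.
Definition mrange (R : realType) n (M : manifold R n) (p : M) :
    set 'rV[R]_n := mchart p @` mdom p.

Definition smooth_into (R : realType) (V : normedModType R) n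
    (N : manifold R n) (U : set V) (f : V -> N) : Prop :=
  (forall x, U x -> {for x, continuous f}) /\
  forall q : N, smooth (U `&` f @^-1` mdom q) (mchart q \o f).

Definition smooth_map (R : realType) m n (M : manifold R m) (N : manifold R n)
    (f : M -> N) : Prop :=
  forall p : M, smooth_into (mrange p) (f \o mchartV p).

(** * Tangent vectors and differentials *)

(* The tangent space of M at p is represented by 'rV[R]_n: a tangent vector at p
   is given by its coordinates in the preferred chart [mchart p]. *)
Definition diff_at (R : realType) m n (M : manifold R m) (N : manifold R n)
    (f : M -> N) (p : M) (v : 'rV[R]_m) : 'rV[R]_n :=
  'D_v (mchart (f p) \o f \o mchartV p) (mchart p p).

(* The tangent vector at [mchartV p u] with coordinates v in the chart
   [mchart p]. *)
Definition coord_vector (R : realType) n (M : manifold R n) (p : M)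
    (v u : 'rV[R]_n) : 'rV[R]_n :=
  'D_v (mchart (mchartV p u) \o mchartV p) u.

Definition submersion (R : realType) m n (M : manifold R m) (N : manifold R n)
    (f : M -> N) : Prop :=
  smooth_map f /\ forall p v, exists w, diff_at f p w = v.

(** * Riemannian metrics *)

Record metric (R : realType) n (M : manifold R n) := {
  inner :> M -> 'rV[R]_n -> 'rV[R]_n -> R ;
  innerC : forall p (v w : 'rV[R]_n), inner p v w = inner p w v ;
  inner_linear : forall p (a : R) (v w z : 'rV[R]_n),
    inner p (a *: v + w) z = a * inner p v z + inner p w z ;
  inner_gt0 : forall p (v : 'rV[R]_n), v != 0 -> 0 < inner p v v ;
  inner_smooth : forall (p : M) (v w : 'rV[R]_n),
    smooth (W := R^o) (mrange p)
      (fun u => inner (mchartV p u) (coord_vector p v u) (coord_vector p w u))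
}.

Definition tnorm (R : realType) n (M : manifold R n) (g : metric M) (p : M)
    (v : 'rV[R]_n) : R := Num.sqrt (g p v v).

Definition preserves_metric (R : realType) m n
    (M : manifold R m) (N : manifold R n) (gM : metric M) (gN : metric N)
    (f : M -> N) : Prop :=
  forall p v w, gN (f p) (diff_at f p v) (diff_at f p w) = gM p v w.

Definition horizontal (R : realType) m n (M : manifold R m) (N : manifold R n)
    (gM : metric M) (f : M -> N) (p : M) : set 'rV[R]_m :=
  [set w | forall u, diff_at f p u = 0 -> gM p w u = 0].

Definition riemannian_submersion (R : realType) m n
    (M : manifold R m) (N : manifold R n) (gM : metric M) (gN : metric N)
    (f : M -> N) : Prop :=
  submersion f /\
  forall p w w', horizontal gM f p w -> horizontal gM f p w' ->
    gN (f p) (diff_at f p w) (diff_at f p w') = gM p w w'.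

Definition transverse_metric (R : realType) m n
    (M : manifold R m) (N : manifold R n) (gM : metric M) (f : M -> N) : Prop :=
  exists gN : metric N, riemannian_submersion gM gN f.

(** * Lie groupoids *)

(* [mul g h] is only meaningful when [src g = tgt h]. *)
Record groupoid (Ob Ar : Type) := {
  src : Ar -> Ob ;
  tgt : Ar -> Ob ;
  unit : Ob -> Ar ;
  inv : Ar -> Ar ;
  mul : Ar -> Ar -> Ar ;
  src_unit : forall x, src (unit x) = x ;
  tgt_unit : forall x, tgt (unit x) = x ;
  src_inv : forall g, src (inv g) = tgt g ;
  tgt_inv : forall g, tgt (inv g) = src g ;
  src_mul : forall g h, src g = tgt h -> src (mul g h) = src h ;
  tgt_mul : forall g h, src g = tgt h -> tgt (mul g h) = tgt g ;
  mulA : forall g h k, src g = tgt h -> src h = tgt k ->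
    mul g (mul h k) = mul (mul g h) k ;
  mul_unitl : forall g, mul (unit (tgt g)) g = g ;
  mul_unitr : forall g, mul g (unit (src g)) = g ;
  mul_invl : forall g, mul (inv g) g = unit (src g) ;
  mul_invr : forall g, mul g (inv g) = unit (tgt g)
}.

Definition composable (Ob Ar : Type) (G : groupoid Ob Ar) : set (Ar * Ar) :=
  [set c | src G c.1 = tgt G c.2].

Definition pairs (Ob Ar : Type) (G : groupoid Ob Ar) : Type :=
  set_type (composable G).

Definition pr1 (Ob Ar : Type) (G : groupoid Ob Ar) (c : pairs G) : Ar :=
  (\val c).1.
Definition pr2 (Ob Ar : Type) (G : groupoid Ob Ar) (c : pairs G) : Ar :=
  (\val c).2.
Definition pmul (Ob Ar : Type) (G : groupoid Ob Ar) (c : pairs G) : Ar :=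
  mul G (pr1 c) (pr2 c).

Lemma pairs_composable (Ob Ar : Type) (G : groupoid Ob Ar) (c : pairs G) :
  src G (pr1 c) = tgt G (pr2 c).
Proof. exact: (set_mem (valP c)). Qed.

Definition mkpair (Ob Ar : Type) (G : groupoid Ob Ar) (g h : Ar)
    (gh : src G g = tgt G h) : pairs G :=
  exist _ (g, h) (mem_set (gh : composable G (g, h))).

Lemma flip_composable (Ob Ar : Type) (G : groupoid Ob Ar) (c : pairs G) :
  src G (inv G (pr2 c)) = tgt G (inv G (pr1 c)).
Proof. by rewrite src_inv tgt_inv (pairs_composable c). Qed.

Lemma turn_composable (Ob Ar : Type) (G : groupoid Ob Ar) (c : pairs G) :
  src G (pmul c) = tgt G (inv G (pr2 c)).
Proof. by rewrite src_mul ?tgt_inv//; exact: pairs_composable. Qed.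

(* The two generators (g, h) |-> (h^-1, g^-1) and (g, h) |-> (gh, h^-1) of the
   action of S_3 on composable pairs. *)
Definition flip (Ob Ar : Type) (G : groupoid Ob Ar) (c : pairs G) : pairs G :=
  mkpair (flip_composable c).
Definition turn (Ob Ar : Type) (G : groupoid Ob Ar) (c : pairs G) : pairs G :=
  mkpair (turn_composable c).

(* The manifold of arrows is not required to be Hausdorff.  [pairs gpd] has
   the topology induced from the product; the last fields say that
   [pairs_struct] is its structure of embedded submanifold of codimension dim0
   of the product (it exists and is unique because src and tgt are
   submersions). *)
Record lie_groupoid (R : realType) := {
  dim0 : nat ;
  dim1 : nat ;
  dim2 : nat ;
  Ob : manifold R dim0 ;
  Ar : manifold R dim1 ;
  gpd :> groupoid Ob Ar ;
  pairs_struct : smooth_structure R dim2 (set_type (composable gpd)) ;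
  Pairs := Manifold pairs_struct ;
  Ob_hausdorff : hausdorff_space Ob ;
  src_submersion : submersion (src gpd : Ar -> Ob) ;
  tgt_submersion : submersion (tgt gpd : Ar -> Ob) ;
  unit_smooth : smooth_map (unit gpd : Ob -> Ar) ;
  inv_smooth : smooth_map (inv gpd : Ar -> Ar) ;
  mul_smooth : smooth_map (pmul (G := gpd) : Pairs -> Ar) ;
  pr1_smooth : smooth_map (pr1 (G := gpd) : Pairs -> Ar) ;
  pr2_smooth : smooth_map (pr2 (G := gpd) : Pairs -> Ar) ;
  pairs_immersed : forall (c : Pairs) (w : 'rV[R]_dim2),
    diff_at (pr1 (G := gpd) : Pairs -> Ar) c w = 0 ->
    diff_at (pr2 (G := gpd) : Pairs -> Ar) c w = 0 -> w = 0 ;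
  dim_pairs : (dim2 + dim0 = dim1 + dim1)%N
}.

Definition source (R : realType) (G : lie_groupoid R) : Ar G -> Ob G := src G.
Definition target (R : realType) (G : lie_groupoid R) : Ar G -> Ob G := tgt G.
Definition multiplication (R : realType) (G : lie_groupoid R) :
  Pairs G -> Ar G := @pmul _ _ G.

(** * Groupoid metrics *)

Definition groupoid_metric (R : realType) (G : lie_groupoid R)
    (eta2 : metric (Pairs G)) : Prop :=
  [/\ preserves_metric eta2 eta2 (@flip _ _ G : Pairs G -> Pairs G),
      preserves_metric eta2 eta2 (@turn _ _ G : Pairs G -> Pairs G) &
      transverse_metric eta2 (@multiplication R G)].

(* The metrics on arrows and on objects induced by eta2.  They are determined
   by these two conditions, since the maps are surjective. *)
Definition induced_metrics (R : realType) (G : lie_groupoid R)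
    (eta2 : metric (Pairs G)) (eta1 : metric (Ar G)) (eta0 : metric (Ob G)) :
    Prop :=
  riemannian_submersion eta2 eta1 (@multiplication R G) /\
  riemannian_submersion eta1 eta0 (@source R G).

(** * Orbits and the orbit space *)

Definition same_orbit (R : realType) (G : lie_groupoid R) (x y : Ob G) : Prop :=
  exists g : Ar G, source g = x /\ target g = y.

Definition orbit_rel (R : realType) (G : lie_groupoid R) : rel (Ob G) :=
  fun x y => `[< same_orbit x y >].

Lemma orbit_rel_refl (R : realType) (G : lie_groupoid R) :
  reflexive (@orbit_rel R G).
Proof.
by move=> x; apply/asboolP; exists (unit G x); split; [exact: src_unit|
  exact: tgt_unit].
Qed.

Lemma orbit_rel_sym (R : realType) (G : lie_groupoid R) :
  symmetric (@orbit_rel R G).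
Proof.
have H (x y : Ob G) : orbit_rel x y -> orbit_rel y x.
  move=> /asboolP[g [<- <-]]; apply/asboolP; exists (inv G g).
  by split; [exact: src_inv|exact: tgt_inv].
by move=> x y; apply/idP/idP; exact: H.
Qed.

Lemma orbit_rel_trans (R : realType) (G : lie_groupoid R) :
  transitive (@orbit_rel R G).
Proof.
move=> y x z /asboolP[g [gx gy]] /asboolP[h [hy hz]].
apply/asboolP; have hg : src G h = tgt G g by exact: etrans hy (esym gy).
exists (mul G h g); split.
- by rewrite -gx; exact: src_mul.
- by rewrite -hz; exact: tgt_mul.
Qed.

Canonical orbit_equiv (R : realType) (G : lie_groupoid R) : equiv_rel (Ob G) :=
  EquivRel (@orbit_rel R G) (@orbit_rel_refl R G) (@orbit_rel_sym R G)
    (@orbit_rel_trans R G).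

Definition orbit_space (R : realType) (G : lie_groupoid R) :
  topologicalType := quotient_topology {eq_quot (orbit_equiv G)}%qT.

Definition orbit_class (R : realType) (G : lie_groupoid R) (x : Ob G) :
  orbit_space G := (\pi_({eq_quot (orbit_equiv G)}) x)%qT.

(* The tangent space at x of the orbit, i.e. of the image of the source fibre
   s^-1(x) under the target map. *)
Definition orbit_tangent (R : realType) (G : lie_groupoid R) (x : Ob G) :
    set 'rV[R]_(dim0 G) :=
  [set v | exists2 w, diff_at (@source R G) (unit G x) w = 0 &
                      diff_at (@target R G) (unit G x) w = v].

(* The component of v orthogonal to the orbit, which represents the class [v]
   in the normal space under the identification of the latter with the
   orthogonal complement of [orbit_tangent x]. *)
Definition normal_part (R : realType) (G : lie_groupoid R)
    (eta0 : metric (Ob G)) (x : Ob G) (v : 'rV[R]_(dim0 G)) :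
    'rV[R]_(dim0 G) :=
  xget 0 [set p | (forall u, orbit_tangent x u -> eta0 x p u = 0) /\
                  orbit_tangent x (v - p)].

Definition normal_norm (R : realType) (G : lie_groupoid R)
    (eta0 : metric (Ob G)) (x : Ob G) (v : 'rV[R]_(dim0 G)) : R :=
  tnorm eta0 x (normal_part eta0 x v).

(** * Curves and the Riemannian distance *)

(* Smoothness on an arbitrary set of parameters means local extendability to a
   smooth map on an open set; this covers endpoints of intervals. *)
Definition smooth_curve (R : realType) n (M : manifold R n) (A : set R)
    (c : R -> M) : Prop :=
  forall t, A t -> exists (O : set R) (c' : R -> M),
    [/\ open O, O t, smooth_into (V := R^o) O c' &
        forall s, O s -> A s -> c' s = c s].

(* Derivative within A, hence one-sided at the endpoints of an interval. *)
Definition velocity (R : realType) n (M : manifold R n) (A : set R)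
    (c : R -> M) (t : R) : 'rV[R]_n :=
  lim ((fun s => (s - t)^-1 *: (mchart (c t) (c s) - mchart (c t) (c t)))
         @ within A t^').

Definition piecewise_smooth (R : realType) n (M : manifold R n)
    (c : R -> M) : Prop :=
  exists (k : nat) (r : nat -> R),
    [/\ r 0%N = 0, r k = 1, forall i, (i < k)%N -> r i < r i.+1 &
        forall i, (i < k)%N -> smooth_curve `[r i, r i.+1] c].

(* The velocity is not meaningful at the finitely many breaking points, which
   do not contribute to the integral. *)
Definition curve_length (R : realType) n (M : manifold R n) (g : metric M)
    (c : R -> M) : \bar R :=
  (\int[lebesgue_measure]_(t in `[0%R, 1%R])
     (tnorm g (c t) (velocity `[0, 1] c t))%:E)%E.

Definition riemannian_dist (R : realType) n (M : manifold R n) (g : metric M)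
    (x y : M) : \bar R :=
  ereal_inf [set l | exists c : R -> M,
    [/\ piecewise_smooth c, c 0 = x, c 1 = y & l = curve_length g c]].

(** * The normal pseudo-distance *)

(* Only the values c 0, ..., c (2n+1) matter. *)
Definition chain (R : realType) (G : lie_groupoid R) (x y : Ob G) (n : nat)
    (c : nat -> Ob G) : Prop :=
  [/\ c 0%N = x, c (2 * n + 1)%N = y,
      forall i, (i <= n)%N -> same_orbit (c (2 * i)%N) (c (2 * i + 1)%N) &
      forall i, (1 <= i <= n)%N ->
        connected_component [set: Ob G] (c (2 * i - 1)%N) (c (2 * i)%N)].

(* d_N([x],[y]) *)
Definition normal_dist (R : realType) (G : lie_groupoid R)
    (eta0 : metric (Ob G)) (x y : Ob G) : \bar R :=
  ereal_inf [set l | exists n c, chain x y n c /\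
    l = (\sum_(1 <= i < n.+1)
           riemannian_dist eta0 (c (2 * i - 1)%N) (c (2 * i)%N))%E].

(** * Stacky curves *)

(* Intervals of any kind; one-point intervals, on which speeds make no sense,
   are excluded. *)
Definition real_interval (R : realType) (I : set R) : Prop :=
  is_interval I /\ exists a b, [/\ I a, I b & a < b].

Record open_cover (R : realType) (I : set R) := {
  index : Type ;
  piece : index -> set R ;
  piece_open : forall i, exists2 O, open O & piece i = I `&` O ;
  piece_cover : \bigcup_i piece i = I
}.

(* [arrow_of j i] is a_ji and [point_of i] is a_i; the values of these
   functions outside their intended domains are irrelevant. *)
Record cocycle (R : realType) (G : lie_groupoid R) (I : set R) := {
  cover :> open_cover I ;
  arrow_of : index cover -> index cover -> R -> Ar G ;
  point_of : index cover -> R -> Ob G ;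
  arrow_smooth : forall j i,
    smooth_curve (piece (o := cover) i `&` piece j) (arrow_of j i) ;
  point_smooth : forall i, smooth_curve (piece i) (point_of i) ;
  arrow_diag : forall i t, piece i t -> arrow_of i i t = unit G (point_of i t) ;
  arrow_source : forall j i t, piece i t -> piece j t ->
    source (arrow_of j i t) = point_of i t ;
  arrow_target : forall j i t, piece i t -> piece j t ->
    target (arrow_of j i t) = point_of j t ;
  arrow_mul : forall k j i t, piece i t -> piece j t -> piece k t ->
    mul G (arrow_of k j t) (arrow_of j i t) = arrow_of k i t
}.

Definition cocycle_equiv (R : realType) (G : lie_groupoid R) (I : set R)
    (a b : cocycle G I) : Prop :=
  exists (W : open_cover I) (ra : index W -> index a) (rb : index W -> index b)
    (h : index W -> R -> Ar G),
  [/\ forall i, piece i `<=` piece (ra i) `&` piece (rb i),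
      forall i, smooth_curve (piece i) (h i),
      forall i t, piece i t -> source (h i t) = point_of (ra i) t,
      forall i t, piece i t -> target (h i t) = point_of (rb i) t &
      forall j i t, piece i t -> piece j t ->
        mul G (arrow_of (rb j) (rb i) t) (h i t) =
        mul G (h j t) (arrow_of (ra j) (ra i) t)].

Record stacky_curve (R : realType) (G : lie_groupoid R) (I : set R) := {
  cocycles :> set (cocycle G I) ;
  cocyclesP : exists a, cocycles = [set b | cocycle_equiv a b]
}.

Definition representative (R : realType) (G : lie_groupoid R) (I : set R)
    (alpha : stacky_curve G I) : cocycle G I :=
  projT1 (cid (cocyclesP alpha)).

(* The image alpha(I) in M/G. *)
Definition stacky_image (R : realType) (G : lie_groupoid R) (I : set R)
    (alpha : stacky_curve G I) : set (orbit_space G) :=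
  [set p | exists (i : index (representative alpha)) (t : R),
     piece i t /\ orbit_class (point_of i t) = p].

Definition cocycle_speed (R : realType) (G : lie_groupoid R)
    (eta0 : metric (Ob G)) (I : set R) (a : cocycle G I) (t : R) : R :=
  match pselect (exists i : index a, piece i t) with
  | left e => let i := projT1 (cid e) in
      normal_norm eta0 (point_of i t) (velocity (piece i) (point_of i) t)
  | right _ => 0
  end.

Definition stacky_speed (R : realType) (G : lie_groupoid R)
    (eta0 : metric (Ob G)) (I : set R) (alpha : stacky_curve G I) : R -> R :=
  cocycle_speed eta0 (representative alpha).

Definition stacky_length (R : realType) (G : lie_groupoid R)
    (eta0 : metric (Ob G)) (I : set R) (alpha : stacky_curve G I) : \bar R :=
  (\int[lebesgue_measure]_(t in I) (stacky_speed eta0 alpha t)%:E)%E.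

(* Main.v *)
From HB Require Import structures.
From mathcomp Require Import all_boot all_order all_algebra.
From mathcomp Require Import all_classical all_reals all_analysis.
From mathcomp Require Import measurable_realfun.
From mathcomp Require Import zify ring lra.
Require Import Defs.

Set Implicit Arguments.
Unset Strict Implicit.
Unset Printing Implicit Defensive.

Import Order.TTheory GRing.Theory Num.Theory.
Import numFieldNormedType.Exports.

Local Open Scope classical_set_scope.
Local Open Scope ring_scope.

(** For a stacky curve and two of its parameters, the pseudo-distance of the two
    points is at most the length in between; conversely, a chain can be followed
    by a stacky curve whose length exceeds that of the chain by arbitrarily
    little.

    For the first inequality, the map sending two parameters to the
    pseudo-distance of the points satisfies the triangle inequality, so by an
    induction along the interval it suffices to bound it infinitesimally by the
    speed (quasi_metric_le_integral).  Locally the stacky curve is a curve c of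
    objects.  Given a vector w tangent to the arrows at a unit, let h be a curve
    of arrows with velocity w starting at this unit: moving from c(t0) to the
    target of h, jumping to its source, and returning to c(t) shows that the
    pseudo-distance of c(t0) and c(t) is at most
    |c' - ds w| + |dt w| times |t - t0|, to first order
    (normal_dist_infinitesimal).  The infimum over w of this cost is the norm of
    the class of c' in the normal space (normal_norm_le_split,
    normal_norm_split_attained); that it is no smaller rests on the invariance
    of the normal norm under arrows.  The normal speed of a curve of objects is
    only an infimum of costs that depend continuously on time, as the dimension
    of the orbits may jump.  The infinitesimal bound is therefore integrated for
    the running minima of the costs of a dense sequence of directions, followed
    by a passage to the limit (quasi_metric_le_integral_inf).

    The invariance (normal_norm_arrow) comes from the groupoid metric: the flip
    of composable pairs is an isometry covering the inversion of arrows, so the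
    inversion is an isometry and the target is a Riemannian submersion as well
    as the source.  A normal vector at the source of an arrow is lifted
    horizontally for the source; the lift is orthogonal to both kernels, hence
    also horizontal for the target, and both projections preserve its norm.

    For the second inequality, a chain of finite length is replaced by finitely
    many smooth segments joined by jumps along orbits (reach_chain).  Each
    segment is reparametrized so that it comes to rest at both ends, without
    change of length (segment_reparam).  The resulting curves overlap while they
    are at rest, so each jump becomes a constant arrow and the curves form a
    cocycle (stacky_curve_of_reach).  Its speed is the normal speed, which is at
    most the speed of the curves. *)

(** * Calculus of vector-valued functions of one variable *)

(** The supremum of the t such that P a t holds is attained and cannot be
    smaller than b, by the local hypothesis at the supremum. *)
Lemma interval_induction (R : realType) (P : R -> R -> Prop) (a b : R) :
  a <= b ->
  (forall s t u, a <= s -> s <= t -> t <= u -> u <= b ->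
     P s t -> P t u -> P s u) ->
  (forall x, a <= x <= b -> exists2 e, 0 < e & forall s t,
     a <= s -> t <= b -> x - e < s -> s <= x -> x <= t -> t < x + e -> P s t) ->
  P a b.
Proof.
move=> ab Ptrans Ploc.
pose S := [set t | a <= t <= b /\ P a t].
have aS : S a.
  have [|e e0 H] := Ploc a; first by rewrite lexx.
  split; first by rewrite lexx.
  by apply: H => //; rewrite ?ltrBlDr ?ltrDl.
have supS : has_sup S by split; [exists a|exists b => t [/andP[]]].
pose c := sup S.
have ac : a <= c by apply: ub_le_sup => //; case: supS.
have cb : c <= b by apply: ge_sup; [exists a|move=> t [/andP[]]].
have [|e e0 H] := Ploc c; first by rewrite ac.
have [s [/andP[as_ sb] Pas] cs] := sup_adherent e0 supS.
have sc : s <= c by apply: ub_le_sup; [case: supS|split => //; rewrite as_].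
have Pac t : c <= t -> t <= b -> t < c + e -> P a t.
  by move=> ct tb te; apply: (Ptrans a s t) => //; [exact: le_trans ct|exact: H].
have [cltb|bc] := ltP c b; last first.
  by apply: Pac => //; rewrite (le_lt_trans bc)// ltrDl.
pose t := Num.min b (c + e / 2).
have ct : c < t by rewrite lt_min cltb ltrDl divr_gt0.
have tb : t <= b by rewrite ge_min lexx.
have St : S t.
  split; first by rewrite tb (le_trans ac (ltW ct)).
  apply: Pac => //; first exact: ltW.
  rewrite gt_min; apply/orP; right.
  by rewrite ltrD2l ltr_pdivrMr// mulrDr mulr1 ltrDl.
by have := ub_le_sup (proj2 supS) St; rewrite leNgt ct.
Qed.

Lemma derivable_approx (R : realType) (V W : normedModType R) (f : V -> W) x v :
  derivable f x v -> forall eta : R, 0 < eta -> exists2 e : R, 0 < e &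
  forall h, `|h| < e -> `|f (h *: v + x) - f x - h *: 'D_v f x| <= eta * `|h|.
Proof.
move=> df eta eta0; have /cvgrPdist_le /(_ _ eta0) := df.
rewrite near_withinE => /nbhs_ballP[e /= e0 H].
exists e => // h he; have [->|h0] := eqVneq h 0.
  by rewrite !scale0r add0r subrr subr0 !normr0 mulr0.
have /H/(_ h0) : ball 0 e h by rewrite /ball/= sub0r normrN.
rewrite -/(derive f x v) => {}H.
have -> : f (h *: v + x) - f x - h *: 'D_v f x =
   - (h *: ('D_v f x - h^-1 *: (f (h *: v + x) - f x))).
  by rewrite [in RHS]scalerBr scalerA mulfV// scale1r opprB.
by rewrite normrN normrZ mulrC ler_wpM2r.
Qed.

Lemma approx_derive (R : realType) (V W : normedModType R) (f : V -> W) x v D :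
  (forall eta : R, 0 < eta -> exists2 e : R, 0 < e &
    forall h, `|h| < e -> `|f (h *: v + x) - f x - h *: D| <= eta * `|h|) ->
  is_derive x v f D.
Proof.
move=> H.
have fD : h^-1 *: ((f \o shift x) (h *: v) - f x) @[h --> 0^'] --> D.
  apply/cvgrPdist_le => eta eta0; have [e e0 He] := H _ eta0.
  near=> h; have h0 : h != 0 by near: h; exact: nbhs_dnbhs_neq.
  have -> : D - h^-1 *: ((f \o shift x) (h *: v) - f x) =
     - (h^-1 *: (f (h *: v + x) - f x - h *: D)).
    by rewrite [in RHS]scalerBr scalerA mulVf// scale1r opprB.
  rewrite normrN normrZ normfV ler_pdivrMl ?normr_gt0// mulrC.
  by apply: He; near: h; exact: dnbhs0_lt.
by split; [apply/cvg_ex; exists D|exact/cvg_lim].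
Unshelve. all: by end_near. Qed.

(** By interval induction, with c enlarged by an arbitrary eta: the inequality
    is additive over adjacent intervals, and near each point it is the
    definition of the derivative. Vector values exclude a reduction to the mean
    value theorem. *)
Lemma mean_value_bound (R : realType) (W : normedModType R) (f : R -> W)
    (L : W) (c a b : R) : a <= b ->
  (forall t, a <= t <= b -> derivable f t 1 /\ `|'D_1 f t - L| <= c) ->
  `|f b - f a - (b - a) *: L| <= c * (b - a).
Proof.
move=> ab H; apply/ler_addgt0Pr => e e0.
have [->|anb] := eqVneq a b.
  by rewrite !subrr scale0r subr0 normr0 mulr0 add0r ltW.
have ba : 0 < b - a by rewrite subr_gt0 lt_neqAle anb.
pose eta := e / (b - a).
have eta0 : 0 < eta by rewrite divr_gt0.
have -> : e = eta * (b - a) by rewrite divfK// gt_eqF.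
rewrite -mulrDl.
pose P s t := `|f t - f s - (t - s) *: L| <= (c + eta) * (t - s).
apply: (@interval_induction _ P) => //.
  move=> s t u _ _ _ _ Pst Ptu; rewrite /P.
  have -> : f u - f s - (u - s) *: L =
     (f t - f s - (t - s) *: L) + (f u - f t - (u - t) *: L).
    have -> : u - s = (t - s) + (u - t) by ring.
    rewrite scalerDl opprD [RHS]addrACA; congr (_ + _).
    by rewrite [RHS]addrC subrKA.
  have -> : u - s = (t - s) + (u - t) by ring.
  by rewrite mulrDr (le_trans (ler_normD _ _))// lerD.
move=> x xab; have [dfx Lx] := H _ xab.
have [d d0 Hd] := derivable_approx dfx eta0.
exists d => // s t _ _ xs sx xt tx.
have one r : `|r - x| < d -> `|f r - f x - (r - x) *: L| <= (c + eta) * `|r - x|.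
  move=> /Hd; rewrite [_%:A]mulr1 subrK => K.
  have -> : f r - f x - (r - x) *: L =
    (f r - f x - (r - x) *: 'D_1 f x) + (r - x) *: ('D_1 f x - L).
    by rewrite scalerBr addrA subrK.
  rewrite mulrDl [leRHS]addrC (le_trans (ler_normD _ _))// lerD//.
  by rewrite normrZ mulrC ler_wpM2r.
have tx' := one t; have sx' := one s; rewrite /P.
rewrite ger0_norm ?subr_ge0// in tx'.
rewrite ler0_norm ?subr_le0// opprB in sx'.
have -> : f t - f s - (t - s) *: L =
     (f t - f x - (t - x) *: L) - (f s - f x - (s - x) *: L).
  have -> : t - s = (t - x) - (s - x) by ring.
  rewrite scalerBl opprB [X in _ = _ + X]opprD opprK [RHS]addrACA; congr (_ + _); last first.
    by rewrite addrC.
  by rewrite opprB subrKA.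
have -> : t - s = (t - x) + (x - s) by ring.
rewrite mulrDr (le_trans (ler_normB _ _))// lerD//.
  by apply: tx'; lra.
by apply: sx'; lra.
Qed.

(** * Directional derivatives and maps of class C^k *)

Section DirectionalDerivatives.
Variables (R : realType) (V W : normedModType R).
Implicit Types (f : V -> W) (U : set V).

Lemma is_derive_line f (y v : V) (t : R) : derivable f (t *: v + y) v ->
  is_derive t 1 (fun s : R => f (s *: v + y)) ('D_v f (t *: v + y)).
Proof.
move=> df; apply: approx_derive => eta eta0.
have [e e0 H] := derivable_approx df eta0.
exists e => // h /H; by rewrite [h *: 1](mulr1 h) scalerDl addrA.
Qed.

Lemma is_derive_scale_dir f (x v : V) (a : R) : derivable f x v ->
  is_derive x (a *: v) f (a *: 'D_v f x).
Proof.
move=> df; apply: approx_derive => eta eta0.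
have c0 : 0 < eta / (`|a| + 1) by rewrite divr_gt0// ltr_pwDr.
have [e e0 H] := derivable_approx df c0.
exists (e / (`|a| + 1)); first by rewrite divr_gt0// ltr_pwDr.
move=> h he; rewrite !scalerA.
have ha : `|h * a| < e.
  rewrite normrM (le_lt_trans (y := `|h| * (`|a| + 1)))//.
    by rewrite ler_wpM2l// lerDl.
  by rewrite -ltr_pdivlMr// ltr_pwDr.
apply: le_trans (H _ ha) _.
rewrite normrM (_ : _ * _ = eta * `|h| * (`|a| / (`|a| + 1))); last by ring.
rewrite ler_piMr ?mulr_ge0 ?(ltW eta0)//.
by rewrite ler_pdivrMr ?ltr_pwDr// mul1r lerDl.
Qed.

(** The increment in the direction v + w is the one in the direction v followed
    by one in the direction w. The second starts at a moving point, so it is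
    compared with the derivative at x by the mean value inequality and the
    continuity of the derivative along w. *)
Lemma is_derive_add_dir f (x v w : V) : derivable f x v ->
  (\near x, derivable f x w) -> {for x, continuous (fun y => 'D_w f y)} ->
  is_derive x (v + w) f ('D_v f x + 'D_w f x).
Proof.
move=> dv dw cw; apply: approx_derive => eta eta0.
have eta2 : 0 < eta / 2 by rewrite divr_gt0.
have [e1 e10 H1] := derivable_approx dv eta2.
have /nbhs_ballP[e2 /= e20 H2] : \forall y \near x,
    derivable f y w /\ `|'D_w f y - 'D_w f x| <= eta / 2.
  near=> y; split; first by near: y.
  rewrite distrC; near: y; move/cvgrPdist_le : cw; exact.
pose C := `|v| + `|w| + 1.
have C0 : 0 < C by rewrite ltr_pwDr// addr_ge0.
exists (Num.min e1 (e2 / C)); first by rewrite lt_min e10 divr_gt0.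
move=> h; rewrite lt_min => /andP[he1 he2].
have inball t : 0 <= t <= 1 -> ball x e2 (t *: (h *: w) + (h *: v + x)).
  move=> /andP[t0 t1]; rewrite -ball_normE/= distrC addrA addrK.
  rewrite (le_lt_trans (ler_normD _ _))// !normrZ (ger0_norm t0).
  rewrite (le_lt_trans (y := `|h| * C))//; last by rewrite -ltr_pdivlMr.
  rewrite /C !mulrDr mulr1 addrC -addrA lerD2l (le_trans (y := `|h| * `|w|))//.
    by rewrite ler_piMl// mulr_ge0.
  by rewrite lerDl.
have dhw t : 0 <= t <= 1 ->
    derivable f (t *: (h *: w) + (h *: v + x)) (h *: w) /\
    'D_(h *: w) f (t *: (h *: w) + (h *: v + x)) =
    h *: 'D_w f (t *: (h *: w) + (h *: v + x)).
  by move=> /inball/H2[d _]; have [? ?] := is_derive_scale_dir h d.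
have := @mean_value_bound R W (fun t : R => f (t *: (h *: w) + (h *: v + x)))
   (h *: 'D_w f x) (eta / 2 * `|h|) 0 1 ler01.
rewrite scale0r add0r !scale1r subr0 mulr1 => /(_ _)-M.
have {}M : `|f (h *: w + (h *: v + x)) - f (h *: v + x) - h *: 'D_w f x|
    <= eta / 2 * `|h|.
  rewrite -[X in _ - X]scale1r; apply: M => t t01.
  have [d De] := dhw t t01; have [d' ->] := is_derive_line d.
  split=> //; rewrite De -scalerBr normrZ mulrC ler_wpM2r//.
  exact: (H2 _ (inball t t01)).2.
have -> : f (h *: (v + w) + x) - f x - h *: ('D_v f x + 'D_w f x) =
  (f (h *: w + (h *: v + x)) - f (h *: v + x) - h *: 'D_w f x) +
  (f (h *: v + x) - f x - h *: 'D_v f x).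
  rewrite [RHS]addrACA subrKA -opprD -scalerDr [in RHS]addrA -scalerDr.
  by rewrite [w + v]addrC ['D_w f x + _]addrC.
rewrite (le_trans (ler_normD _ _))// (splitr eta) mulrDl lerD//.
exact: H1.
Unshelve. all: by end_near. Qed.

End DirectionalDerivatives.

Lemma derive_lineE (R : realType) (V W : normedModType R) (f : V -> W) x v :
  'D_v f x = 'D_1 (fun h : R => f (h *: v + x)) 0.
Proof.
rewrite /derive; set g1 := fun h => h^-1 *: _; set g2 := fun h => h^-1 *: _.
suff -> : g1 = g2 by [].
by rewrite funeqE /g1 /g2 => h /=; rewrite addr0 scale0r add0r [_%:A]mulr1.
Qed.

Lemma is_derive_comp (R : realType) (U V W : normedModType R)
    (c : U -> V) (f : V -> W) (x v : U) :
  derivable c x v -> differentiable f (c x) ->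
  is_derive x v (f \o c) ('D_('D_v c x) f (c x)).
Proof.
move=> dc df; pose g (h : R) := c (h *: v + x).
have g0 : g 0 = c x by rewrite /g scale0r add0r.
have dg : differentiable g 0 by apply/derivable1_diffP; exact: (derivable1P c x v).1.
have dfg : differentiable (f \o g) 0.
  by apply: differentiable_comp => //; rewrite g0.
split; first by apply/derivable1P/derivable1_diffP; exact: dfg.
rewrite (derive_lineE (f \o c)) -[LHS]/('D_1 (f \o g) 0) deriveE// diff_comp//.
  by rewrite /= g0 -deriveE// -deriveE// -(derive_lineE c).
by rewrite g0.
Qed.

Lemma is_derive_scale (R : realType) (V W : normedModType R)
    (a : V -> R^o) (f : V -> W) x v : derivable a x v -> derivable f x v ->
  is_derive x v (fun y => a y *: f y) (a x *: 'D_v f x + 'D_v a x *: f x).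
Proof.
move=> da df.
have ca : a (h *: v + x) @[h --> (0 : R)^'] --> a x.
  have /derivable1_diffP/differentiable_continuous := (derivable1P a x v).1 da.
  rewrite /prop_for /continuous_at /= scale0r add0r; exact: cvg_within_filter.
have F : h^-1 *: (a (h *: v + x) *: f (h *: v + x) - a x *: f x) @[h --> 0^']
    --> a x *: 'D_v f x + 'D_v a x *: f x.
  rewrite (_ : (fun h => _) = (fun h =>
     a (h *: v + x) *: (h^-1 *: (f (h *: v + x) - f x)) +
     (h^-1 *: (a (h *: v + x) - a x)) *: f x)).
    by apply: cvgD; [apply: cvgZ ca _; exact: df|apply: cvgZr_tmp; exact: da].
  apply/funext => h; rewrite scalerA mulrC -scalerA -[(_ *: (_ - _ : R^o)) *: _]scalerA.
  by rewrite -scalerDr; congr (_ *: _); rewrite scalerBl scalerBr subrKA.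
by split; [apply/cvg_ex; eexists; exact: F|exact/cvg_lim].
Qed.

(** A finite basis with coordinate functions of norm at most one. It is a
    device to treat row vectors and the line of scalars in the same way. *)
Definition coordinates (R : realType) (V : normedModType R) n
    (e : 'I_n -> V) (l : 'I_n -> V -> R) : Prop :=
  [/\ forall v, v = \sum_i l i v *: e i,
      forall i a v w, l i (a *: v + w) = a * l i v + l i w &
      forall i v, `|l i v| <= `|v|].

Lemma coordinates_rV (R : realType) n :
  coordinates (fun i : 'I_n => delta_mx 0 i : 'rV[R]_n) (fun i v => v 0 i).
Proof.
split; [exact: row_sum_delta|by move=> i a v w; rewrite !mxE|move=> i v].
rewrite [leRHS]/Num.Def.normr/= mx_normrE.
exact: (le_bigmax _ (fun ij => `|v ij.1 ij.2|) (0, i)).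
Qed.

Lemma coordinates_line (R : realType) :
  coordinates (V := R^o) (fun i : 'I_1 => 1) (fun i v => v).
Proof.
by split => // v; rewrite big_ord1 [RHS]mulr1.
Qed.

(** The class of f on U is a conjunction of conditions at the points of U, so
    that restriction to subsets needs no openness. *)
Lemma Ck_pointwise (R : realType) (V W : normedModType R) k (U : set V)
    (f : V -> W) : Ck k U f <-> forall x, U x -> Ck k [set x] f.
Proof.
elim: k f => [|k IH] f /=; split.
- by move=> [H _] x Ux; split=> // y ->; exact: H.
- by move=> H; split=> // x Ux; have [+ _] := H x Ux; exact.
- move=> [H1 H2] x Ux; split; first by move=> y ->; exact: H1.
  move=> v; have [H3 /IH H4] := H2 v.
  by split; [move=> y ->; exact: H3|exact: H4].
- move=> H; split; first by move=> x Ux; have [+ _] := H x Ux; exact.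
  move=> v; split; first by move=> x Ux; have [_ /(_ v)[+ _]] := H x Ux; exact.
  by apply/IH => x Ux; have [_ /(_ v)[_ ]] := H x Ux.
Qed.

Lemma Ck_subset (R : realType) (V W : normedModType R) k (U U' : set V)
    (f : V -> W) : U' `<=` U -> Ck k U f -> Ck k U' f.
Proof.
by move=> UU /Ck_pointwise H; apply/Ck_pointwise => x /UU; exact: H.
Qed.

Lemma Ck_eq (R : realType) (V W : normedModType R) k (U : set V)
    (f g : V -> W) : open U -> (forall x, U x -> f x = g x) ->
  Ck k U f -> Ck k U g.
Proof.
move=> oU; have nearU (h1 h2 : V -> W) x : (forall x, U x -> h1 x = h2 x) ->
    U x -> \near x, h1 x = h2 x.
  by move=> h12 Ux; apply: filterS (open_nbhs_nbhs (conj oU Ux)) => y; exact: h12.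
elim: k f g => [|k IH] f g fg [H1 H2].
  split=> // x Ux; rewrite /prop_for /continuous_at -fg//.
  exact/(cvg_trans _ (H1 x Ux))/near_eq_cvg/nearU.
split.
  move=> x Ux; rewrite /prop_for /continuous_at -fg//.
  exact/(cvg_trans _ (H1 x Ux))/near_eq_cvg/nearU.
move=> v; have [H3 H4] := H2 v; split.
  by move=> x Ux; apply: near_eq_derivable (H3 x Ux); exact: nearU.
by apply: IH H4 => x Ux; apply: near_eq_derive; exact: nearU.
Qed.

Lemma CkS (R : realType) (V W : normedModType R) k (U : set V) (f : V -> W) :
  Ck k.+1 U f -> Ck k U f.
Proof.
by elim: k f => [f []|k IH f [? H]]//; split=> // v; have [? /IH] := H v.
Qed.

Lemma Ck1 (R : realType) (V W : normedModType R) k (U : set V) (f : V -> W) :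
  Ck k.+1 U f -> Ck 1 U f.
Proof. by elim: k => // k IH /CkS. Qed.

Lemma Ck_cst (R : realType) (V W : normedModType R) k (U : set V) (a : W) :
  Ck k U (fun _ : V => a).
Proof.
elim: k a => [|k IH] a; first by split=> // x _; exact: cvg_cst.
split=> [x _|v]; first exact: cvg_cst.
split=> [x _|]; first exact: derivable_cst.
rewrite (_ : (fun x => 'D_v _ x) = fun=> 0); first exact: IH.
by apply/funext => x; exact: derive_cst.
Qed.

Lemma Ck_line (R : realType) (V : normedModType R) k (U : set R^o) (v y : V) :
  Ck k U (fun s : R^o => s *: v + y).
Proof.
have D (x r : R^o) : is_derive x r (fun s : R^o => s *: v + y) (r *: v).
  apply: approx_derive => eta eta0; exists 1 => // h _.
  by rewrite scalerDl -(addrA ((h *: r) *: v)) addrK scalerA subrr normr0 mulr_ge0// ltW.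
have cl (x : R^o) : {for x, continuous (fun s : R^o => s *: v + y)}.
  apply: differentiable_continuous; apply/derivable1_diffP.
  exact: (@ex_derive _ _ _ _ _ _ _ (D x 1)).
case: k => [|k]; split=> //.
move=> r; split; first by move=> x _; exact: (@ex_derive _ _ _ _ _ _ _ (D x r)).
rewrite (_ : (fun x => 'D_r _ x) = fun=> r *: v); first exact: Ck_cst.
by apply/funext => x; exact: (@derive_val _ _ _ _ _ _ _ (D x r)).
Qed.

Lemma Ck_add (R : realType) (V W : normedModType R) k (U : set V)
    (f g : V -> W) : open U -> Ck k U f -> Ck k U g ->
  Ck k U (fun x => f x + g x).
Proof.
move=> oU; elim: k f g => [|k IH] f g [f1 f2] [g1 g2].
  by split=> // x Ux; apply: cvgD; [exact: f1|exact: g1].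
split; first by move=> x Ux; apply: cvgD; [exact: f1|exact: g1].
move=> v; have [f3 f4] := f2 v; have [g3 g4] := g2 v; split.
  by move=> x Ux; apply: derivableD; [exact: f3|exact: g3].
apply: Ck_eq (IH _ _ f4 g4) => // x Ux.
by rewrite -[RHS]/('D_v (f + g) x) deriveD//; [exact: f3|exact: g3].
Qed.

Lemma Ck_sum (R : realType) (V W : normedModType R) k (U : set V) n
    (f : 'I_n -> V -> W) : open U -> (forall i, Ck k U (f i)) ->
  Ck k U (fun x => \sum_i f i x).
Proof.
move=> oU H; elim: n f H => [|n IH] f H.
  apply: Ck_eq (Ck_cst k U 0) => // x _; by rewrite big_ord0.
apply: (@Ck_eq _ _ _ _ _ (fun x => \sum_i f (widen_ord (leqnSn n) i) x + f ord_max x)).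
- by [].
- by move=> x _; rewrite big_ord_recr.
- by apply: Ck_add => //; apply: IH.
Qed.

Lemma Ck_scale (R : realType) (V W : normedModType R) k (U : set V)
    (a : V -> R^o) (f : V -> W) : open U -> Ck k U a -> Ck k U f ->
  Ck k U (fun x => a x *: f x).
Proof.
move=> oU; elim: k a f => [|k IH] a f.
  move=> [f1 f2] [g1 g2].
  by split=> // x Ux; apply: cvgZ; [exact: f1|exact: g1].
move=> fa ga; have [f1 f2] := fa; have [g1 g2] := ga.
split; first by move=> x Ux; apply: cvgZ; [exact: f1|exact: g1].
move=> v; have [f3 f4] := f2 v; have [g3 g4] := g2 v.
have D x : U x -> is_derive x v (fun y => a y *: f y) (a x *: 'D_v f x + 'D_v a x *: f x).
  by move=> Ux; apply: is_derive_scale; [exact: f3|exact: g3].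
split; first by move=> x /D[].
apply: (@Ck_eq _ _ _ _ _ (fun x => a x *: 'D_v f x + 'D_v a x *: f x)) => //.
  by move=> x /D[].
by apply: Ck_add => //; apply: IH => //; exact: CkS.
Qed.

Lemma Ck_inv (R : realType) (V : normedModType R) k (U : set V) (f : V -> R^o) :
  open U -> (forall x, U x -> f x != 0) -> Ck k U f ->
  Ck k U (fun x => (f x)^-1 : R^o).
Proof.
move=> oU f0; have cV (x : V) : U x -> {for x, continuous f} ->
    {for x, continuous (fun x => (f x)^-1 : R^o)}.
  by move=> Ux cf; apply: cvgV => //; exact: f0.
elim: k => [|k IH] Cf; first by have [cf _] := Cf; split=> // x Ux; exact/cV/cf.
have [cf df] := Cf; split; first by move=> x Ux; exact/cV/cf.
move=> v; have [d1 d2] := df v.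
split; first by move=> x Ux; apply: derivableV; [exact: f0|exact: d1].
have CI := IH (CkS Cf).
apply: (@Ck_eq _ _ _ _ _ (fun x : V =>
   (-1 : R^o) *: ((f x)^-1 *: ((f x)^-1 *: ('D_v f x : R^o))))) => //.
  move=> x Ux; rewrite deriveV; [|exact: f0|exact: d1].
  by rewrite scaleN1r /GRing.scale/= mulrA -invfM -expr2 mulNr.
by apply: (Ck_scale oU (Ck_cst _ _ _)); do 2 apply: (Ck_scale oU CI).
Qed.

Section Coordinates.
Variables (R : realType) (V W : normedModType R) (n : nat).
Variables (e : 'I_n -> V) (l : 'I_n -> V -> R).
Hypothesis el : coordinates e l.

(** Additivity of the derivative in the direction, one basis vector at a time.
    *)
Lemma derive_basis (U : set V) (f : V -> W) (x v : V) : open U -> Ck 1 U f ->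
  U x -> 'D_v f x = \sum_i l i v *: 'D_(e i) f x.
Proof.
move=> oU [_ C1f] Ux; have [vE _ _] := el; rewrite {1}(vE v).
have nU : \forall y \near x, U y by exact: open_nbhs_nbhs.
elim: (index_enum _) => [|i s IH]; first by rewrite !big_nil derive0.
rewrite !big_cons -IH.
have [d1 [c1 _]] := C1f (l i v *: e i); have [d2 [c2 _]] := C1f (\sum_(j <- s) l j v *: e j).
have [_ ->] : is_derive x (l i v *: e i + \sum_(j <- s) l j v *: e j) f
  ('D_(l i v *: e i) f x + 'D_(\sum_(j <- s) l j v *: e j) f x).
  apply: is_derive_add_dir; [exact: d1| |exact: c2].
  by apply: filterS nU => y; exact: d2.
by congr (_ + _); have [_ ->] := is_derive_scale_dir (l i v) ((C1f (e i)).1 x Ux).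
Qed.

(** By the mean value inequality along the segment from x to x + h, the
    increment of f differs from its directional derivative at x by at most the
    oscillation of the partial derivatives times the norm of h. *)
Lemma C1_differentiable (U : set V) (f : V -> W) (x : V) : open U -> Ck 1 U f ->
  U x -> differentiable f x.
Proof.
move=> oU C1f Ux; have [vE lL l1] := el; have [_ C1f'] := C1f.
have DE y v : U y -> 'D_v f y = \sum_i l i v *: 'D_(e i) f y.
  exact: derive_basis.
have linD : linear (fun v => 'D_v f x).
  move=> a v w; rewrite !DE// scaler_sumr -big_split/=.
  by apply: eq_bigr => i _; rewrite lL scalerDl scalerA.
pose Dm := GRing.isLinear.Build _ _ _ _ _ linD.
pose D : {linear V -> W} := HB.pack (fun v => 'D_v f x) Dm.
have cD : continuous D.
  have lin0 i : l i 0 = 0.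
    by apply/eqP; rewrite -normr_le0 (le_trans (l1 _ _))// normr0.
  have linB i v w : l i (v - w) = l i v - l i w.
    by rewrite -scaleN1r addrC lL mulN1r addrC.
  move=> v; have -> : D = (fun v => \sum_i l i v *: 'D_(e i) f x) :> (V -> W).
    by apply/funext => w; exact: DE.
  apply: cvg_big => [|i _]; first exact: add_continuous.
  apply: cvgZr_tmp; apply/cvgrPdist_lt => eta eta0.
  have := nbhsx_ballx v eta eta0; apply: filterS => y.
  by rewrite -ball_normE/= -linB; exact: le_lt_trans.
have approx : f \o shift x = cst (f x) + D +o_ 0 id.
  apply/eqaddoP => _/posnumP[eta].
  pose d := eta%:num / n.+1%:R.
  have d0 : 0 < d by rewrite divr_gt0.
  have /nbhs_ballP[r /= r0 Hr] : \forall y \near x,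
      U y /\ forall i, `|'D_(e i) f y - 'D_(e i) f x| <= d.
    near=> y; split; first by near: y; exact: open_nbhs_nbhs.
    near: y; apply: filter_forall => i; have [_ [cDe _]] := C1f' (e i).
    by have /cvgrPdist_le/(_ _ d0) := cDe x Ux; apply: filterS => y; rewrite distrC.
  near=> h; rewrite /= opprD addrA.
  have hr : `|h| < r by near: h; exact: nbhs0_lt.
  have inball t : 0 <= t <= 1 -> ball x r (t *: h + x).
    move=> /andP[t0 t1]; rewrite -ball_normE/= distrC addrK normrZ ger0_norm//.
    by rewrite (le_lt_trans _ hr)// ler_piMl.
  have := @mean_value_bound R W (fun t : R => f (t *: h + x)) ('D_h f x)
      (eta%:num * `|h|) 0 1 ler01.
  rewrite scale0r add0r !scale1r subr0 mulr1 scale1r; apply => t t01.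
  have [Ut Ht] := Hr _ (inball t t01).
  have [dt ->] := is_derive_line ((C1f' h).1 _ Ut); split=> //.
  rewrite !DE// -sumrB (le_trans (ler_norm_sum _ _ _))//.
  apply: (@le_trans _ _ (\sum_(i < n) d * `|h|)).
    apply: ler_sum => i _; rewrite -scalerBr normrZ mulrC.
    by rewrite ler_pM// ?l1.
  rewrite sumr_const card_ord -mulrnAl ler_wpM2r// /d -mulr_natr.
  by rewrite mulrAC ler_pdivrMr// ler_pM2l// ler_nat.
apply/diff_locallyP.
by rewrite (diff_unique cD approx).
Unshelve. all: by end_near. Qed.

Lemma Ck_coord (V' : normedModType R) k (O : set V') (g : V' -> V) i : open O ->
  Ck k O g -> Ck k O (fun x => l i (g x) : R^o).
Proof.
have [vE lL l1] := el; move=> oO.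
have lin0 : l i 0 = 0.
  by apply/eqP; rewrite -normr_le0 (le_trans (l1 _ _))// normr0.
have linB v w : l i (v - w) = l i v - l i w.
  by rewrite -scaleN1r addrC lL mulN1r addrC.
have cl (g' : V' -> V) x : {for x, continuous g'} ->
    {for x, continuous (fun x => l i (g' x) : R^o)}.
  move=> /cvgrPdist_lt cg; apply/cvgrPdist_lt => eta /cg; apply: filterS => y.
  by rewrite -linB; exact: le_lt_trans.
have D (g' : V' -> V) x v : derivable g' x v ->
    is_derive x v (fun x => l i (g' x) : R^o) (l i ('D_v g' x)).
  move=> dg; apply: approx_derive => eta /(derivable_approx dg)[d d0 H].
  exists d => // h /H; apply: le_trans; apply: le_trans (l1 i _).
  by rewrite !linB -[h *: 'D_v g' x]addr0 lL lin0 addr0.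
elim: k g => [|k IH] g [g1 g2]; first by split=> // x Ox; exact/cl/g1.
split; first by move=> x Ox; exact/cl/g1.
move=> v; have [g3 g4] := g2 v; split; first by move=> x /g3/D[].
by apply: Ck_eq (IH _ g4) => // x /g3/D[].
Qed.

(** The derivative of a composite is the sum over the basis of the scalar
    products of the components of the derivative of c with the partial
    derivatives of f, which are composites of lower class. *)
Lemma Ck_comp (V' : normedModType R) k (U : set V) (O : set V') (f : V -> W)
    (c : V' -> V) : open U -> open O -> (forall x, O x -> U (c x)) ->
  Ck k U f -> Ck k O c -> Ck k O (f \o c).
Proof.
move=> oU oO OU; elim: k f => [|k IH] f Cf Cc.
  have [f1 _] := Cf; have [c1 _] := Cc; split=> // x Ox.
  by apply: continuous_comp; [exact: c1|exact/f1/OU].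
have [f1 f2] := Cf; have [c1 c2] := Cc.
split; first by move=> x Ox; apply: continuous_comp; [exact: c1|exact/f1/OU].
move=> v; have D x : O x -> is_derive x v (f \o c)
    (\sum_i l i ('D_v c x) *: 'D_(e i) f (c x)).
  move=> Ox; rewrite -(derive_basis _ oU (Ck1 Cf) (OU _ Ox)).
  apply: is_derive_comp; first by have [+ _] := c2 v; exact.
  exact: C1_differentiable oU (Ck1 Cf) (OU _ Ox).
split; first by move=> x /D[].
apply: (@Ck_eq _ _ _ _ _ (fun x => \sum_i l i ('D_v c x) *: 'D_(e i) f (c x))) => //.
  by move=> x /D[].
apply: Ck_sum => // i; apply: Ck_scale => //.
  by apply: Ck_coord => //; have [] := c2 v.
by apply: (IH (fun y => 'D_(e i) f y)); [have [] := f2 (e i)|exact: CkS].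
Qed.

End Coordinates.

(** * Smooth maps and differentials in charts *)

Lemma open_setI_preimage (T T' : topologicalType) (O : set T) (D : set T')
    (c : T -> T') : open O -> open D -> (forall x, O x -> {for x, continuous c}) ->
  open (O `&` c @^-1` D).
Proof.
rewrite !openE => oO oD cc x [Ox Dx]; apply: filterI; first exact: oO.
by apply: (cc x Ox); exact: oD.
Qed.

Section Charts.
Variables (R : realType) (n : nat) (M : manifold R n).
Implicit Types (p q : M) (u : 'rV[R]_n).

Lemma mdom_open p : open (mdom p). Proof. exact: dom_open. Qed.
Lemma mdom_center p : mdom p p. Proof. exact: dom_center. Qed.
Lemma mrange_open p : open (mrange p). Proof. exact: chart_open. Qed.
Lemma mrange_chart p q : mdom p q -> mrange p (mchart p q).
Proof. by move=> pq; exists q. Qed.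
Lemma mchartK p q : mdom p q -> mchartV p (mchart p q) = q.
Proof. exact: chartK. Qed.
Lemma mchartVK p u : mrange p u -> mchart p (mchartV p u) = u.
Proof. by move=> [q pq <-]; rewrite mchartK. Qed.
Lemma mchartV_dom p u : mrange p u -> mdom p (mchartV p u).
Proof. by move=> [q pq <-]; rewrite mchartK. Qed.
Lemma mchart_continuous p q : mdom p q -> {for q, continuous (mchart p)}.
Proof. exact: chart_continuous. Qed.
Lemma mchartV_continuous p u : mrange p u -> {for u, continuous (mchartV p)}.
Proof. exact: chartV_continuous. Qed.

Lemma mrange_setI p q :
  mchart p @` (mdom p `&` mdom q) = mrange p `&` mchartV p @^-1` mdom q.
Proof.
apply/seteqP; split => [u [x [px qx] <-]|u [[x px <-]]].
  by split; [exact: mrange_chart|rewrite /preimage/= mchartK].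
by rewrite /preimage/= mchartK// => qx; exists x.
Qed.

Lemma smooth_map_id : smooth_map (@id M).
Proof.
move=> p; split; first by move=> u; exact: mchartV_continuous.
by move=> q; rewrite -mrange_setI; exact: transition_smooth.
Qed.

End Charts.

Section SmoothInto.
Variables (R : realType) (n : nat) (N : manifold R n).

(** Smoothness into a manifold is a local property, because the class of a map
    is a conjunction over the points of its domain. *)
Lemma smooth_into_local (V : normedModType R) (U : set V) (f : V -> N) :
  (forall x, U x -> exists (O : set V) (f' : V -> N),
     [/\ open O, O x, smooth_into O f' & forall y, O y -> f' y = f y]) ->
  smooth_into U f.
Proof.
move=> H; split.
  move=> x /H [ O [f' [oO Ox [cf' _] ff']]].
  rewrite /prop_for /continuous_at -ff'//; apply: cvg_trans (cf' x Ox).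
  by apply: near_eq_cvg; apply: filterS (open_nbhs_nbhs (conj oO Ox)).
move=> q k; apply/Ck_pointwise => x [/H [ O [f' [oO Ox [cf' sf'] ff']]] qx].
apply: (@Ck_subset _ _ _ _ (O `&` f' @^-1` mdom q)).
  by move=> _ ->; split => //; rewrite /preimage/= ff'.
apply: Ck_eq (sf' q k); first exact: (open_setI_preimage oO (@mdom_open _ _ _ q)).
by move=> y [Oy _] /=; rewrite ff'.
Qed.

Lemma smooth_into_subset (V : normedModType R) (U U' : set V) (f : V -> N) :
  U' `<=` U -> smooth_into U f -> smooth_into U' f.
Proof.
move=> UU [cf sf]; split; first by move=> x /UU; exact: cf.
move=> q k; apply: Ck_subset (sf q k) => x [/UU ? ?]; by split.
Qed.

Lemma smooth_into_cst (V : normedModType R) (U : set V) (x : N) :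
  smooth_into U (fun _ : V => x).
Proof.
split; first by move=> y _; exact: cvg_cst.
by move=> q k; exact: Ck_cst.
Qed.

Lemma smooth_into_comp (V V' : normedModType R) m (e : 'I_m -> V) l
    (U : set V) (O : set V') (c : V -> N) (phi : V' -> V) :
  coordinates e l -> open U -> open O -> smooth_into U c -> smooth O phi ->
  (forall x, O x -> U (phi x)) -> smooth_into O (c \o phi).
Proof.
move=> el oU oO [cc sc] sphi OU.
have cphi x : O x -> {for x, continuous phi} by have [+ _] := sphi 0%N; exact.
split; first by move=> x Ox; apply: continuous_comp; [exact: cphi|exact/cc/OU].
move=> q k; apply: (Ck_comp el (U := U `&` c @^-1` mdom q) (f := mchart q \o c)).
- exact: (open_setI_preimage oU (@mdom_open _ _ _ q)).
- apply: (open_setI_preimage oO (@mdom_open _ _ _ q)) => x Ox.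
  by apply: continuous_comp; [exact: cphi|exact/cc/OU].
- by move=> x [Ox qx]; split; [exact: OU|].
- exact: sc.
- by apply: Ck_subset (sphi k) => x [].
Qed.

Lemma smooth_map_into m (M : manifold R m) (f : M -> N) (V : normedModType R)
    (O : set V) (c : V -> M) : smooth_map f -> open O -> smooth_into O c ->
  smooth_into O (f \o c).
Proof.
move=> sf oO sc; have [cc Cc] := sc; apply: smooth_into_local => x Ox.
pose O' := O `&` c @^-1` mdom (c x).
have oO' : open O' by exact: (open_setI_preimage oO (@mdom_open _ _ _ _)).
exists O', ((f \o mchartV (c x)) \o (mchart (c x) \o c)); split => //.
- by split=> //; exact: mdom_center.
- apply: (smooth_into_comp (@coordinates_rV R m) (@mrange_open _ _ _ (c x)) oO').
  - exact: sf.
  - exact: Cc.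
  - by move=> y [_ cy]; exact: mrange_chart.
- by move=> y [_ cy] /=; rewrite mchartK.
Qed.

Lemma smooth_map_continuous m (M : manifold R m) (f : M -> N) :
  smooth_map f -> continuous f.
Proof.
move=> sf p; have [cf _] := sf p.
have F : {for p, continuous ((f \o mchartV p) \o mchart p)}.
  apply: continuous_comp; first exact/mchart_continuous/mdom_center.
  exact/cf/mrange_chart/mdom_center.
rewrite /continuous_at -{2}(mchartK (mdom_center p)); apply: cvg_trans F.
apply: near_eq_cvg; have := open_nbhs_nbhs (conj (@mdom_open _ _ _ p) (mdom_center p)).
by apply: filterS => q pq /=; rewrite mchartK.
Qed.

End SmoothInto.

Lemma smooth_map_comp (R : realType) k m n (K : manifold R k) (M : manifold R m)
    (N : manifold R n) (f : K -> M) (g : M -> N) :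
  smooth_map f -> smooth_map g -> smooth_map (g \o f).
Proof.
move=> sf sg p; apply: (smooth_map_into sg); [exact: mrange_open|exact: sf].
Qed.

(** The expression of f in the charts indexed by p and q, which need not be the
    preferred charts at a point and at its image. *)
Definition local_map (R : realType) m n (M : manifold R m) (N : manifold R n)
    (f : M -> N) (p : M) (q : N) : 'rV[R]_m -> 'rV[R]_n :=
  mchart q \o f \o mchartV p.

Section Differentials.
Variables (R : realType).

Definition local_map_dom m n (M : manifold R m) (N : manifold R n)
    (f : M -> N) (p : M) (q : N) : set 'rV[R]_m :=
  mrange p `&` (f \o mchartV p) @^-1` mdom q.

Lemma local_map_dom_open m n (M : manifold R m) (N : manifold R n)
    (f : M -> N) p q : smooth_map f -> open (local_map_dom f p q).
Proof.
move=> sf; apply: open_setI_preimage; [exact: mrange_open|exact: mdom_open|].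
by have [cf _] := sf p.
Qed.

Lemma local_map_smooth m n (M : manifold R m) (N : manifold R n)
    (f : M -> N) p q : smooth_map f ->
  smooth (local_map_dom f p q) (local_map f p q).
Proof. by move=> sf; have [_ Cf] := sf p; exact: Cf. Qed.

Lemma local_map_differentiable m n (M : manifold R m) (N : manifold R n)
    (f : M -> N) p q u : smooth_map f -> local_map_dom f p q u ->
  differentiable (local_map f p q) u.
Proof.
move=> sf; apply: (C1_differentiable (@coordinates_rV R m)).
  exact: local_map_dom_open.
exact: local_map_smooth.
Qed.

Lemma local_map_dom_chart m n (M : manifold R m) (N : manifold R n)
    (f : M -> N) (p x : M) (q : N) : mdom p x -> mdom q (f x) ->
  local_map_dom f p q (mchart p x).
Proof.
by move=> px qx; split; [exact: mrange_chart|rewrite /preimage/= mchartK].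
Qed.

(** The chain rule for arbitrary charts: the composite of the local expressions
    of f and g is that of their composite near the point. All transformation
    rules for tangent vectors below are instances, with identity maps for
    changes of charts. *)
Lemma derive_local_map_comp k m n (K : manifold R k) (M : manifold R m)
    (N : manifold R n) (f : K -> M) (g : M -> N) p q r x w :
  smooth_map f -> smooth_map g -> mdom p x -> mdom q (f x) -> mdom r (g (f x)) ->
  'D_w (local_map (g \o f) p r) (mchart p x) =
  'D_('D_w (local_map f p q) (mchart p x)) (local_map g q r) (mchart q (f x)).
Proof.
move=> sf sg px qx rx; pose u := mchart p x.
have domu : local_map_dom f p q u by exact: local_map_dom_chart.
rewrite (near_eq_derive _ (g := local_map g q r \o local_map f p q)); last first.
  have := open_nbhs_nbhs (conj (local_map_dom_open (p := p) (q := q) sf) domu).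
  by apply: filterS => y [yp yq]; rewrite /local_map /= mchartK.
have df := local_map_differentiable sf domu.
have fu : local_map f p q u = mchart q (f x) by rewrite /local_map /u /= mchartK.
have dg : differentiable (local_map g q r) (local_map f p q u).
  by rewrite fu; apply: local_map_differentiable; last exact: local_map_dom_chart.
have [_ ->] := is_derive_comp (@diff_derivable _ _ _ _ _ w df) dg.
by rewrite fu.
Qed.

Lemma diff_atE m n (M : manifold R m) (N : manifold R n) (f : M -> N) p v :
  diff_at f p v = 'D_v (local_map f p (f p)) (mchart p p).
Proof. by []. Qed.

Lemma coord_vectorE m (M : manifold R m) (p x : M) v : mdom p x ->
  coord_vector p v (mchart p x) = 'D_v (local_map id p x) (mchart p x).
Proof. by move=> px; rewrite /coord_vector mchartK. Qed.

Lemma diff_at_linear m n (M : manifold R m) (N : manifold R n) (f : M -> N) p :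
  smooth_map f -> linear (diff_at f p).
Proof.
move=> sf a v w; rewrite !diff_atE.
have df : differentiable (local_map f p (f p)) (mchart p p).
  by apply: local_map_differentiable => //; apply: local_map_dom_chart;
    exact: mdom_center.
by rewrite !deriveE// linearP.
Qed.

Lemma coord_vector_linear m (M : manifold R m) (p : M) u : mrange p u ->
  linear (fun v => coord_vector p v u).
Proof.
move=> [x px <-] a v w; rewrite !coord_vectorE//.
have df : differentiable (local_map id p x) (mchart p x).
  apply: local_map_differentiable; first exact: smooth_map_id.
  by apply: local_map_dom_chart => //; exact: mdom_center.
by rewrite !deriveE// linearP.
Qed.

Lemma diff_at_comp k m n (K : manifold R k) (M : manifold R m)
    (N : manifold R n) (f : K -> M) (g : M -> N) p v :
  smooth_map f -> smooth_map g ->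
  diff_at (g \o f) p v = diff_at g (f p) (diff_at f p v).
Proof.
by move=> sf sg; apply: derive_local_map_comp => //; exact: mdom_center.
Qed.

Lemma derive_local_map_id m (M : manifold R m) (p x : M) v : mdom p x ->
  'D_v (local_map id p p) (mchart p x) = v.
Proof.
move=> px; rewrite (near_eq_derive _ (g := id)) ?derive_id//.
have := open_nbhs_nbhs (conj (@mrange_open _ _ _ p) (mrange_chart px)).
by apply: filterS => y yp; rewrite /local_map /= mchartVK.
Qed.

Lemma diff_at_id m (M : manifold R m) (p : M) v : diff_at id p v = v.
Proof. exact/derive_local_map_id/mdom_center. Qed.

Lemma diff_at_coord_vector m n (M : manifold R m) (N : manifold R n)
    (f : M -> N) (p x : M) (q : N) w : smooth_map f ->
  mdom p x -> mdom q (f x) ->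
  diff_at f x (coord_vector p w (mchart p x)) =
  coord_vector q ('D_w (local_map f p q) (mchart p x)) (mchart q (f x)).
Proof.
move=> sf px qx; rewrite !coord_vectorE// diff_atE.
have mi := smooth_map_id; have mc := mdom_center.
by rewrite -(derive_local_map_comp (f := id))// -(derive_local_map_comp (g := id)).
Qed.

Lemma coord_vector_onto m (M : manifold R m) (p x : M) v : mdom p x ->
  exists w, coord_vector p w (mchart p x) = v.
Proof.
move=> px; exists ('D_v (local_map id x p) (mchart x x)).
have mi := smooth_map_id; have mc := mdom_center.
rewrite coord_vectorE// -(derive_local_map_comp (f := id) (g := id))//.
exact: derive_local_map_id.
Qed.

End Differentials.

(** * Norms of tangent vectors *)

Lemma sqr_le_sqrD (R : realType) (a b e : R) : 0 <= b -> 0 <= e ->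
  a ^+ 2 - b ^+ 2 <= e ^+ 2 -> a ^+ 2 <= (b + e) ^+ 2.
Proof.
move=> b0 e0; have := mulr_ge0 b0 e0; rewrite sqrrD; lra.
Qed.

Section InnerProduct.
Variables (R : realType) (n : nat) (M : manifold R n) (g : metric M) (p : M).
Implicit Types v w z : 'rV[R]_n.

Lemma innerDl v w z : g p (v + w) z = g p v z + g p w z.
Proof. by rewrite -{1}[v]scale1r inner_linear mul1r. Qed.

Lemma inner0l z : g p 0 z = 0.
Proof. by have := innerDl 0 0 z; rewrite addr0; lra. Qed.

Lemma innerZl a v z : g p (a *: v) z = a * g p v z.
Proof. by rewrite -{1}[a *: v]addr0 inner_linear inner0l addr0. Qed.

Lemma innerDr v w z : g p z (v + w) = g p z v + g p z w.
Proof. by rewrite innerC innerDl !(innerC _ _ z). Qed.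

Lemma innerZr a v z : g p z (a *: v) = a * g p z v.
Proof. by rewrite innerC innerZl (innerC _ _ z). Qed.

Lemma inner0r z : g p z 0 = 0. Proof. by rewrite innerC inner0l. Qed.

Lemma innerNl v z : g p (- v) z = - g p v z.
Proof. by rewrite -scaleN1r innerZl mulN1r. Qed.

Lemma innerNr v z : g p z (- v) = - g p z v.
Proof. by rewrite innerC innerNl innerC. Qed.

Lemma inner_suml (I : finType) (v : I -> 'rV[R]_n) z :
  g p (\sum_i v i) z = \sum_i g p (v i) z.
Proof. exact: (big_morph (fun x => g p x z) (fun x y => innerDl x y z) (inner0l z)). Qed.

Lemma inner_sumr (I : finType) (v : I -> 'rV[R]_n) z :
  g p z (\sum_i v i) = \sum_i g p z (v i).
Proof. by rewrite innerC inner_suml; under eq_bigr do rewrite innerC. Qed.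

Lemma inner_ge0 v : 0 <= g p v v.
Proof. by have [->|/inner_gt0/ltW//] := eqVneq v 0; rewrite inner0l. Qed.

Lemma inner_eq0 v : g p v v = 0 -> v = 0.
Proof. by move=> g0; apply/eqP/negPn/negP => /(inner_gt0 g p); rewrite g0 ltxx. Qed.

Lemma tnorm_ge0 v : 0 <= tnorm g p v. Proof. exact: sqrtr_ge0. Qed.

Lemma tnorm_sqr v : tnorm g p v ^+ 2 = g p v v.
Proof. by rewrite sqr_sqrtr// inner_ge0. Qed.

Lemma tnorm0 : tnorm g p 0 = 0. Proof. by rewrite /tnorm inner0l sqrtr0. Qed.

Lemma tnormZ a v : tnorm g p (a *: v) = `|a| * tnorm g p v.
Proof.
by rewrite /tnorm innerZl innerZr mulrA -expr2 sqrtrM ?sqr_ge0// sqrtr_sqr.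
Qed.

Lemma tnormN v : tnorm g p (- v) = tnorm g p v.
Proof. by rewrite -scaleN1r tnormZ normrN normr1 mul1r. Qed.

(** The Cauchy-Schwarz inequality, from the nonnegativity of the square of a
    linear combination of the two vectors. *)
Lemma inner_le_tnorm v w : g p v w <= tnorm g p v * tnorm g p w.
Proof.
have [->|w0] := eqVneq w 0; first by rewrite inner0r tnorm0 mulr0.
have gw : 0 < g p w w by exact: inner_gt0.
apply: le_trans (ler_norm _) _.
rewrite -[X in _ <= X]ger0_norm ?mulr_ge0 ?tnorm_ge0// -ler_sqr ?nnegrE//.
rewrite !real_normK ?num_real// exprMn !tnorm_sqr -subr_ge0.
have := inner_ge0 (g p w w *: v - g p v w *: w).
rewrite !(innerDl, innerDr, innerZl, innerZr, innerNl, innerNr) (innerC _ _ w v).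
set a := g p v v; set b := g p v w; set c := g p w w.
move=> H; rewrite -/c in gw; rewrite -(pmulr_rge0 _ gw); apply: le_trans H _.
by rewrite le_eqVlt; apply/orP; left; apply/eqP; ring.
Qed.

Lemma ler_tnormD v w : tnorm g p (v + w) <= tnorm g p v + tnorm g p w.
Proof.
rewrite -ler_sqr ?nnegrE ?addr_ge0 ?tnorm_ge0// sqrrD !tnorm_sqr.
rewrite innerDl !innerDr (innerC _ _ w v).
have := inner_le_tnorm v w; lra.
Qed.

Lemma tnorm_sum (I : finType) (a : I -> R) (v : I -> 'rV[R]_n) :
  tnorm g p (\sum_i a i *: v i) <= \sum_i `|a i| * tnorm g p (v i).
Proof.
elim/big_ind2: _ => [|x1 x2 y1 y2 H1 H2|i _]; first by rewrite tnorm0.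
  by rewrite (le_trans (ler_tnormD _ _))// lerD.
by rewrite tnormZ.
Qed.

End InnerProduct.

Section CoordinateNorm.
Variables (R : realType) (n : nat) (M : manifold R n) (g : metric M).
Implicit Types (p : M) (u v : 'rV[R]_n).

(** The norm at the point of coordinates u of the vector of coordinates v in
    the chart at p: it lives in a fixed vector space when the point moves in
    the chart. *)
Definition coord_norm (p : M) (u v : 'rV[R]_n) : R :=
  tnorm g (mchartV p u) (coord_vector p v u).

Let gram (p : M) (i j : 'I_n) (u : 'rV[R]_n) : R :=
  g (mchartV p u) (coord_vector p (delta_mx 0 i) u) (coord_vector p (delta_mx 0 j) u).

Let gram_continuous p i j u : mrange p u -> {for u, continuous (gram p i j)}.
Proof. by move=> pu; have [+ _] := inner_smooth g p (delta_mx 0 i) (delta_mx 0 j) 0%N; exact. Qed.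

Let coord_vector_lin p u : mrange p u ->
  {f : {linear 'rV[R]_n -> 'rV[R]_n} | forall v, f v = coord_vector p v u}.
Proof.
move=> pu; pose fm := GRing.isLinear.Build _ _ _ _ _ (coord_vector_linear pu).
by exists (HB.pack_for {linear 'rV[R]_n -> 'rV[R]_n} (fun v => coord_vector p v u) fm).
Qed.

Lemma coord_norm_sqr p u v : mrange p u ->
  coord_norm p u v ^+ 2 = \sum_i \sum_j (v 0 i * v 0 j) * gram p i j u.
Proof.
move=> /coord_vector_lin[f fE]; rewrite tnorm_sqr -fE {1 2}(row_sum_delta v).
rewrite linear_sum inner_suml; apply: eq_bigr => i _.
rewrite linearZ/= innerZl inner_sumr mulr_sumr; apply: eq_bigr => j _.
by rewrite linearZ/= innerZr mulrA /gram !fE.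
Qed.

Lemma coord_norm_ge0 p u v : 0 <= coord_norm p u v.
Proof. exact: tnorm_ge0. Qed.

Lemma ler_coord_normD p u v w : mrange p u ->
  coord_norm p u (v + w) <= coord_norm p u v + coord_norm p u w.
Proof.
move=> /coord_vector_lin[f fE]; rewrite /coord_norm -!fE linearD.
exact: ler_tnormD.
Qed.

Lemma coord_normZ p u a v : mrange p u ->
  coord_norm p u (a *: v) = `|a| * coord_norm p u v.
Proof.
by move=> /coord_vector_lin[f fE]; rewrite /coord_norm -!fE linearZ/= tnormZ.
Qed.

Lemma coord_norm_bounded p u : mrange p u ->
  exists2 C, 0 < C & forall v, coord_norm p u v <= C * `|v|.
Proof.
move=> pu; exists (1 + \sum_i coord_norm p u (delta_mx 0 i)).
  by rewrite ltr_pwDl// sumr_ge0// => i _; exact: coord_norm_ge0.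
move=> v; have [f fE] := coord_vector_lin pu.
rewrite {1}(row_sum_delta v) {1}/coord_norm -fE linear_sum.
under eq_bigr do rewrite linearZ/= fE.
apply: le_trans (tnorm_sum _ _ _ _) _.
rewrite mulrDl mul1r mulr_suml -[leLHS]add0r lerD//; apply: ler_sum => i _.
rewrite mulrC ler_wpM2l ?tnorm_ge0//; by have [_ _ ->] := coordinates_rV R n.
Qed.

Lemma coord_norm_cvg (T : Type) (F : set_system T) (FF : Filter F)
    (a b : T -> 'rV[R]_n) p u v : mrange p u -> a @ F --> u -> b @ F --> v ->
  coord_norm p (a t) (b t) @[t --> F] --> coord_norm p u v.
Proof.
move=> pu au bv.
have key : coord_norm p (a t) (b t) ^+ 2 @[t --> F] --> coord_norm p u v ^+ 2.
  rewrite (coord_norm_sqr v pu).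
  apply: (@cvg_trans _ ((\sum_i \sum_j (b t 0 i * b t 0 j) * gram p i j (a t)) @[t --> F])).
    apply: near_eq_cvg.
    have : F (a @^-1` mrange p) by apply: au; apply: open_nbhs_nbhs; split=> //; exact: mrange_open.
    by apply: filterS => t at_; rewrite (coord_norm_sqr _ at_).
  have bi i : b t 0 i @[t --> F] --> v 0 i.
    exact: (cvg_comp _ _ bv (@coord_continuous R 1 n 0 i v)).
  apply: cvg_big => [|i _]; first exact: add_continuous.
  apply: cvg_big => [|j _]; first exact: add_continuous.
  apply: cvgM; first exact: cvgM.
  exact: (cvg_comp _ _ au (@gram_continuous p i j u pu)).
have := cvg_comp _ _ key (@sqrt_continuous R (coord_norm p u v ^+ 2)).
rewrite sqrtr_sqr ger0_norm ?coord_norm_ge0//; apply: cvg_trans.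
apply: near_eq_cvg; near=> t => /=.
by rewrite sqrtr_sqr ger0_norm ?coord_norm_ge0.
Unshelve. all: by end_near. Qed.

(** The difference of squares is a quadratic form in v with coefficients the
    variations of the entries of the Gram matrix, which are small by
    continuity. *)
Lemma coord_norm_near p u eps : mrange p u -> 0 < eps ->
  \forall y \near u, mrange p y /\
    forall v, coord_norm p y v <= coord_norm p u v + eps * `|v|.
Proof.
move=> pu eps0; pose d := eps ^+ 2 / (n.+1%:R * n.+1%:R).
have d0 : 0 < d by rewrite divr_gt0// ?exprn_gt0 ?mulr_gt0.
near=> y.
have py : mrange p y by near: y; apply: open_nbhs_nbhs; split=> //; exact: mrange_open.
split=> // v.
rewrite -ler_sqr ?nnegrE ?addr_ge0 ?mulr_ge0 ?coord_norm_ge0 ?(ltW eps0)//.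
have ev : 0 <= eps * `|v| by rewrite mulr_ge0// ltW.
apply: (sqr_le_sqrD (coord_norm_ge0 p u v) ev).
have gy i j : `|gram p i j y - gram p i j u| <= d.
  move: i j; near: y; apply: filter_forall => i; apply: filter_forall => j.
  have /cvgrPdist_le/(_ _ d0) := @gram_continuous p i j u pu.
  by apply: filterS => y; rewrite distrC.
rewrite (coord_norm_sqr v py) (coord_norm_sqr v pu) -sumrB.
have vi i : `|v 0 i| <= `|v| by have [_ _ ->] := coordinates_rV R n.
apply: le_trans (_ : \sum_(i < n) \sum_(j < n) d * `|v| ^+ 2 <= _).
  apply: ler_sum => i _; rewrite -sumrB; apply: ler_sum => j _.
  rewrite -mulrBr (le_trans (ler_norm _))// !normrM mulrC expr2.
  by rewrite ler_pM// ler_pM.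
rewrite sumr_const sumr_const !card_ord -mulrnA -mulr_natl exprMn mulrA.
rewrite ler_wpM2r ?sqr_ge0// /d mulrCA ger_pMr ?exprn_gt0//.
rewrite ler_pdivrMr ?mulr_gt0// mul1r -natrM ler_nat.
by rewrite leq_mul.
Unshelve. all: by end_near. Qed.

End CoordinateNorm.

(** * Velocities of curves *)

(** The two-sided velocity, in the preferred chart at the current point, of a
    curve defined around t. Relative velocities of curves on intervals are
    reduced to it by local extension. *)
Definition vel (R : realType) n (M : manifold R n) (c : R -> M) (t : R) :
  'rV[R]_n := 'D_1 (mchart (c t) \o c : R^o -> 'rV[R]_n) t.

Section CurveVelocity.
Variables (R : realType) (n : nat) (M : manifold R n).
Implicit Types (c : R -> M) (O : set R) (p : M) (t : R).

Lemma curve_C1 c O p : smooth_into (V := R^o) O c ->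
  Ck (V := R^o) 1 (O `&` c @^-1` mdom p) (mchart p \o c).
Proof. by move=> [_ H]; exact: (H p 1%N). Qed.

Lemma curve_derivable c O p t : smooth_into (V := R^o) O c -> O t ->
  mdom p (c t) -> derivable (mchart p \o c : R^o -> 'rV[R]_n) t 1.
Proof.
by move=> sc Ot pt; have [_ /(_ 1)[+ _]] := curve_C1 p sc; apply; split.
Qed.

Lemma curve_derive_continuous c O p t : smooth_into (V := R^o) O c -> O t ->
  mdom p (c t) ->
  {for t, continuous (fun s => 'D_1 (mchart p \o c : R^o -> 'rV[R]_n) s)}.
Proof.
by move=> sc Ot pt; have [_ /(_ 1)[_ [+ _]]] := curve_C1 p sc; apply; split.
Qed.

Lemma curve_near_dom c O p t : open O -> smooth_into (V := R^o) O c -> O t ->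
  mdom p (c t) -> \forall s \near t, O s /\ mdom p (c s).
Proof.
move=> oO [cc _] Ot pt; apply: filterI; first exact: open_nbhs_nbhs.
by apply: (cc t Ot); apply: open_nbhs_nbhs; split => //; exact: mdom_open.
Qed.

Lemma chart_curve_continuous c O p t : smooth_into (V := R^o) O c -> O t ->
  mdom p (c t) -> {for t, continuous (mchart p \o c)}.
Proof.
move=> [cc _] Ot pt; apply: continuous_comp; first exact: cc.
exact: mchart_continuous.
Qed.

Lemma derive_curve_comp c O t k (N : manifold R k) (f : M -> N) p (q : N) :
  open O -> smooth_into (V := R^o) O c -> O t -> smooth_map f ->
  mdom p (c t) -> mdom q (f (c t)) ->
  'D_1 (mchart q \o (f \o c) : R^o -> 'rV[R]_k) t =
  'D_('D_1 (mchart p \o c : R^o -> 'rV[R]_n) t) (local_map f p q) (mchart p (c t)).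
Proof.
move=> oO sc Ot sf pt qt.
rewrite (near_eq_derive _ (g := local_map f p q \o (mchart p \o c))); last first.
  apply: filterS (curve_near_dom oO sc Ot pt) => s [Os ps].
  by rewrite /local_map /= mchartK.
have dc := curve_derivable sc Ot pt.
have df : differentiable (local_map f p q) ((mchart p \o c) t).
  by apply: local_map_differentiable => //; exact: local_map_dom_chart.
by have [_ ->] := is_derive_comp dc df.
Qed.

Lemma vel_coord c O p t : open O -> smooth_into (V := R^o) O c -> O t ->
  mdom p (c t) ->
  vel c t = coord_vector p ('D_1 (mchart p \o c : R^o -> 'rV[R]_n) t) (mchart p (c t)).
Proof.
move=> oO sc Ot pt; rewrite coord_vectorE//.
by rewrite -(derive_curve_comp oO sc Ot (@smooth_map_id _ _ M))//; exact: mdom_center.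
Qed.

Lemma vel_comp c O t k (N : manifold R k) (f : M -> N) : open O ->
  smooth_into (V := R^o) O c -> O t -> smooth_map f ->
  vel (f \o c) t = diff_at f (c t) (vel c t).
Proof.
move=> oO sc Ot sf; rewrite /vel (derive_curve_comp oO sc Ot sf (p := c t))//;
  exact: mdom_center.
Qed.

Lemma vel_near_eq c c' t : (\forall s \near t, c s = c' s) -> vel c t = vel c' t.
Proof.
move=> cc'; rewrite /vel (nbhs_singleton cc'); apply: near_eq_derive.
by apply: filterS cc' => s /= ->.
Qed.

Lemma vel_cst (x : M) t : vel (fun=> x) t = 0.
Proof. by rewrite /vel; exact: derive_cst. Qed.

Lemma smooth_into_chart_line p (u w : 'rV[R]_n) (O : set R^o) : open O ->
  (forall s, O s -> mrange p (s *: w + u)) ->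
  smooth_into O (fun s : R^o => mchartV p (s *: w + u)).
Proof.
move=> oO H; apply: (smooth_into_comp (@coordinates_rV R n)
  (@mrange_open _ _ _ p) oO (c := mchartV p) (phi := fun s : R^o => s *: w + u)).
- exact: (@smooth_map_id _ _ M).
- by move=> k; exact: Ck_line.
- exact: H.
Qed.

Lemma vel_chart_line p (u w : 'rV[R]_n) t : mrange p (t *: w + u) ->
  vel (fun s => mchartV p (s *: w + u)) t = coord_vector p w (t *: w + u).
Proof.
move=> pt; pose O : set R^o := (fun s : R^o => s *: w + u) @^-1` mrange p.
have lc : continuous (fun s : R^o => s *: w + u).
  by move=> s; have [+ _] := Ck_line 0 setT w u; apply.
have oO : open O by apply: open_comp => [s _|]; [exact: lc|exact: mrange_open].
have sc : smooth_into O (fun s : R^o => mchartV p (s *: w + u)).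
  exact: smooth_into_chart_line.
have E : mchart p (mchartV p (t *: w + u)) = t *: w + u by exact: mchartVK.
have pt' : mdom p (mchartV p (t *: w + u)) by exact: mchartV_dom.
have Ot : O t by exact: pt.
rewrite (@vel_coord (fun s => mchartV p (s *: w + u)) O p t oO sc Ot pt') E.
have -> // : 'D_1 (mchart p \o (fun s => mchartV p (s *: w + u)) :
  R^o -> 'rV[R]_n) t = w.
rewrite (near_eq_derive _ (g := fun s : R^o => s *: w + u)); last first.
  apply: filterS (open_nbhs_nbhs (conj oO pt)) => s Os; exact: mchartVK.
have dw : derivable (@id 'rV[R]_n) (t *: w + u) w by exact: derivable_id.
by have [_ ->] := is_derive_line dw; rewrite derive_id.
Qed.

Lemma vel_reparam c O (phi : R^o -> R^o) t : open O ->
  smooth_into (V := R^o) O c -> O (phi t) -> derivable phi t 1 ->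
  vel (c \o phi) t = 'D_1 phi t *: vel c (phi t).
Proof.
move=> oO sc Ot dphi; rewrite /vel.
have dc : derivable (mchart (c (phi t)) \o c : R^o -> 'rV[R]_n) (phi t) 1.
  by apply: curve_derivable sc Ot _; exact: mdom_center.
have dfc : differentiable (mchart (c (phi t)) \o c : R^o -> 'rV[R]_n) (phi t).
  exact/derivable1_diffP.
have [_ E] := is_derive_comp dphi dfc.
have [_ E'] := is_derive_scale_dir ('D_1 phi t) dc.
by rewrite -E' [_ *: 1](mulr1 ('D_1 phi t)) -E.
Qed.

(** The difference quotients within A of the curve agree with those of its
    extension, and t being a limit point of A makes the filter within A proper,
    so that limits are unique. *)
Lemma velocity_vel (A : set R) c c' O t : open O -> O t ->
  smooth_into (V := R^o) O c' -> (forall s, O s -> A s -> c' s = c s) ->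
  A t -> limit_point A t -> velocity A c t = vel c' t.
Proof.
move=> oO Ot sc' cc' At lt; have ctt := cc' _ Ot At.
have dc : derivable (mchart (c t) \o c' : R^o -> 'rV[R]_n) t 1.
  by apply: curve_derivable sc' Ot _; rewrite ctt; exact: mdom_center.
have PF : ProperFilter (within A t^').
  apply: Build_ProperFilter => H.
  have {}H : nbhs t [set s | s != t -> A s -> False] by exact: H.
  by have [y [yt Ay]] := lt _ H; apply.
rewrite /velocity /vel ctt; apply/cvg_lim => //; apply/cvgrPdist_le => eta eta0.
have [e e0 He] := derivable_approx dc eta0.
rewrite near_withinE near_withinE.
have nO := open_nbhs_nbhs (conj oO Ot).
have nb := nbhsx_ballx t e e0.
near=> s => st As.
have Os : O s by near: s.
have se : `|s - t| < e.
  by rewrite distrC; near: s; move: nb; rewrite -ball_normE.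
have := He _ se; rewrite [_ *: 1](mulr1 (s - t)) subrK /= (cc' s)// ctt => H.
have st0 : s - t != 0 by rewrite subr_eq0.
set D := 'D_1 _ t in H *; rewrite distrC.
have -> : (s - t)^-1 *: (mchart (c t) (c s) - mchart (c t) (c t)) - D =
    (s - t)^-1 *: (mchart (c t) (c s) - mchart (c t) (c t) - (s - t) *: D).
  by rewrite [RHS]scalerBr scalerA mulVf// scale1r.
rewrite normrZ normfV.
by rewrite ler_pdivrMl ?normr_gt0// mulrC.
Unshelve. all: by end_near. Qed.

Lemma speed_coord (g : metric M) c O p t : open O -> smooth_into (V := R^o) O c ->
  O t -> mdom p (c t) ->
  tnorm g (c t) (vel c t) =
  coord_norm g p (mchart p (c t)) ('D_1 (mchart p \o c : R^o -> 'rV[R]_n) t).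
Proof.
by move=> oO sc Ot pt; rewrite (vel_coord oO sc Ot pt) /coord_norm mchartK.
Qed.

(** In a fixed chart the speed is a continuous function of the coordinates of
    the point and of the velocity. *)
Lemma speed_continuous (g : metric M) c O t : open O ->
  smooth_into (V := R^o) O c -> O t ->
  {for t, continuous (fun s => tnorm g (c s) (vel c s))}.
Proof.
move=> oO sc Ot; pose p := c t; have pt : mdom p (c t) by exact: mdom_center.
rewrite /prop_for /continuous_at (speed_coord g oO sc Ot pt).
apply: (@cvg_trans _ (coord_norm g p (mchart p (c s))
    ('D_1 (mchart p \o c : R^o -> 'rV[R]_n) s) @[s --> t])).
  apply: near_eq_cvg; apply: filterS (curve_near_dom oO sc Ot pt) => s [Os ps].
  by rewrite (speed_coord g oO sc Os ps).
apply: (@coord_norm_cvg R n M g R (nbhs t) _ (mchart p \o c)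
  (fun s => 'D_1 (mchart p \o c : R^o -> 'rV[R]_n) s)).
- exact: mrange_chart.
- exact: (chart_curve_continuous sc Ot pt).
- exact: (curve_derive_continuous sc Ot pt).
Qed.

End CurveVelocity.

(** * Groupoid identities and linear algebra of tangent spaces *)

Section GroupoidAlgebra.
Variables (Ob Ar : Type) (G : groupoid Ob Ar).

Lemma inv_unique g h : src G g = tgt G h -> mul G g h = unit G (src G h) ->
  g = inv G h.
Proof.
move=> gh e; rewrite -[LHS](mul_unitr G) gh -(mul_invr G) (@mulA _ _ G) ?tgt_inv// e.
by rewrite -(tgt_inv G) mul_unitl.
Qed.

Lemma inv_inv g : inv G (inv G g) = g.
Proof.
by apply/esym/inv_unique; rewrite ?tgt_inv// src_inv mul_invr.
Qed.

Lemma inv_mul g h : src G g = tgt G h ->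
  mul G (inv G h) (inv G g) = inv G (mul G g h).
Proof.
move=> gh; apply: inv_unique; first by rewrite src_mul ?src_inv ?tgt_inv ?tgt_mul.
rewrite src_mul// -(@mulA _ _ G) ?src_inv ?tgt_inv ?tgt_mul//.
rewrite [X in mul G _ X](@mulA _ _ G) ?src_inv// mul_invl gh mul_unitl.
by rewrite mul_invl.
Qed.

Lemma flipK (c : pairs G) : flip (flip c) = c.
Proof.
by apply: val_inj; rewrite /= /pr1 /pr2 /= !inv_inv -surjective_pairing.
Qed.

Lemma pmul_flip (c : pairs G) : pmul (flip c) = inv G (pmul c).
Proof. exact/inv_mul/pairs_composable. Qed.

End GroupoidAlgebra.

Section LinearAlgebra.
Variable R : realType.

Lemma linear_is_mulmx m n (f : 'rV[R]_m -> 'rV[R]_n) : linear f ->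
  exists A : 'M[R]_(m, n), forall v, f v = v *m A.
Proof.
move=> lf; pose fm := GRing.isLinear.Build _ _ _ _ _ lf.
pose F := HB.pack_for {linear 'rV[R]_m -> 'rV[R]_n} f fm.
by exists (lin1_mx F) => v; rewrite mul_rV_lin1.
Qed.

(** The Gram matrix of a row basis of B is invertible because the inner product
    is definite, which gives the usual formula for the projection onto the row
    space. *)
Lemma orthogonal_decomposition n (M : manifold R n) (g : metric M) (x : M) k
    (B : 'M[R]_(k, n)) (v : 'rV[R]_n) :
  exists p, (forall z : 'rV[R]_k, g x p (z *m B) = 0) /\
            exists z, v - p = z *m B.
Proof.
pose Q := \matrix_(i < n, j < n) g x (delta_mx 0 i) (delta_mx 0 j).
have gQ (a b : 'rV[R]_n) : g x a b = (a *m Q *m b^T) 0 0.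
  rewrite {1}(row_sum_delta a) {1}(row_sum_delta b) inner_suml !mxE.
  rewrite [LHS](eq_bigr (fun i => \sum_j a 0 i * b 0 j * Q i j)).
    rewrite exchange_big; apply: eq_bigr => j _; rewrite !mxE mulr_suml.
    by apply: eq_bigr => i _; rewrite mulrAC.
  move=> i _; rewrite inner_sumr; apply: eq_bigr => j _.
  by rewrite innerZl innerZr mulrA mxE.
have [S [fS eS]] : exists S : 'M[R]_(\rank B, n), row_free S /\ (S :=: B)%MS.
  by exists (row_base B); split; [exact: row_base_free|exact: eq_row_base].
have uS : S *m Q *m S^T \in unitmx.
  rewrite -row_free_unit -kermx_eq0; apply/eqP/row_matrixP => i; rewrite row0.
  set z := row i _; have : z *m (S *m Q *m S^T) = 0.
    by apply/sub_kermxP; exact: row_sub.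
  move=> /(congr1 (fun w => (w *m z^T) 0 0)).
  rewrite mul0mx [RHS]mxE !mulmxA -mulmxA -trmx_mul -gQ => /inner_eq0 zS.
  by apply: (row_free_inj fS); rewrite mul0mx.
pose z := v *m Q *m S^T *m invmx (S *m Q *m S^T).
exists (v - z *m S); split; last first.
  have /submxP[D DE] : (z *m S <= B)%MS.
    by rewrite (submx_trans (submxMl _ _))// eS.
  by exists D; rewrite opprB addrC subrK.
move=> y; have /submxP[D ->] : (y *m B <= S)%MS by rewrite eS submxMl.
rewrite gQ trmx_mul mulmxA mulmxBl mulmxBl.
have -> : z *m S *m Q *m S^T = v *m Q *m S^T.
  by rewrite -!(mulmxA z) /z mulmxKV.
by rewrite subrr mul0mx mxE.
Qed.

End LinearAlgebra.

Section Submersions.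
Variables (R : realType) (m n : nat) (M : manifold R m) (N : manifold R n).
Variables (gM : metric M) (gN : metric N) (f : M -> N).
Hypothesis fRS : riemannian_submersion gM gN f.

(** Any preimage of v is corrected by its orthogonal projection onto the kernel
    of the differential. *)
Lemma horizontal_lift p v : exists2 w, horizontal gM f p w & diff_at f p w = v.
Proof.
have [[sf onto] _] := fRS; have [w0 <-] := onto p v.
have [A AE] := linear_is_mulmx (diff_at_linear p sf).
have [w [wo [z wz]]] := orthogonal_decomposition gM p (kermx A) w0.
exists w.
  move=> u; rewrite AE => /sub_kermxP/submxP[D ->]; exact: wo.
have -> : w = w0 - z *m kermx A by rewrite -wz opprB addrC subrK.
by rewrite !AE mulmxBl -mulmxA mulmx_ker mulmx0 subr0.
Qed.

(** A horizontal vector only sees the projection of the other one. *)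
Lemma inner_horizontal p w k : horizontal gM f p w ->
  gM p w k = gN (f p) (diff_at f p w) (diff_at f p k).
Proof.
move=> hw; have [[sf _] isom] := fRS; have lf := diff_at_linear p sf.
have [k' hk' kk'] := horizontal_lift p (diff_at f p k).
have z : diff_at f p (k - k') = 0.
  by rewrite -scaleN1r addrC lf kk' scaleN1r addrC subrr.
rewrite -kk' isom// -[k](subrK k') innerDr.
by rewrite (hw _ z) add0r.
Qed.

End Submersions.

Lemma linear0_eq (R : realType) m n (f : 'rV[R]_m -> 'rV[R]_n) :
  linear f -> f 0 = 0.
Proof. by move=> /linear_is_mulmx[A ->]; rewrite mul0mx. Qed.

Lemma linearB_eq (R : realType) m n (f : 'rV[R]_m -> 'rV[R]_n) v w :
  linear f -> f (v - w) = f v - f w.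
Proof. by move=> /linear_is_mulmx[A AE]; rewrite !AE mulmxBl. Qed.

Section LieGroupoid.
Variables (R : realType) (G : lie_groupoid R).

Notation P1 := (@pr1 _ _ G : Pairs G -> Ar G).
Notation P2 := (@pr2 _ _ G : Pairs G -> Ar G).
Notation sr := (@source R G).
Notation tg := (@target R G).

Lemma source_smooth : smooth_map sr. Proof. by have [] := src_submersion G. Qed.
Lemma target_smooth : smooth_map tg. Proof. by have [] := tgt_submersion G. Qed.
Let P1_smooth : smooth_map P1. Proof. exact: pr1_smooth. Qed.
Let P2_smooth : smooth_map P2. Proof. exact: pr2_smooth. Qed.
Let source_P1 : sr \o P1 = tg \o P2.
Proof. by apply/funext => c; exact: pairs_composable. Qed.
(** The tangent map of the pair of projections is injective, and its image lies
    in the fibre product of the two tangent maps, which has the same dimension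
    because the source is a submersion. *)
Lemma tangent_pair (c : Pairs G) k l :
  diff_at sr (P1 c) k = diff_at tg (P2 c) l ->
  exists W, diff_at P1 c W = k /\ diff_at P2 c W = l.
Proof.
have [A AE] := linear_is_mulmx (diff_at_linear c P1_smooth).
have [B BE] := linear_is_mulmx (diff_at_linear c P2_smooth).
have [S SE] := linear_is_mulmx (diff_at_linear (P1 c) source_smooth).
have [T TE] := linear_is_mulmx (diff_at_linear (P2 c) target_smooth).
rewrite SE TE => kl.
pose Phi := row_mx A B; pose Psi := col_mx S (- T).
have rPhi : row_free Phi.
  rewrite -kermx_eq0; apply/eqP/row_matrixP => i; rewrite row0.
  set z := row i _; have : z *m Phi = 0 by apply/sub_kermxP; exact: row_sub.
  rewrite mul_mx_row -row_mx0 => /eq_row_mx[zA zB].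
  by apply: (pairs_immersed (c := c)); [rewrite -zA -AE|rewrite -zB -BE].
have PP : Phi *m Psi = 0.
  rewrite mul_row_col mulmxN; apply/eqP; rewrite subr_eq0; apply/eqP.
  apply/row_matrixP => i; rewrite !rowE !mulmxA -AE -BE -SE -TE.
  by rewrite -!diff_at_comp//; [rewrite source_P1|exact: target_smooth|exact: source_smooth].
have rS : \rank S = dim0 G.
  apply/eqP; rewrite -[_ == _]/(row_full S); apply/row_fullP.
  have [_ onto] := src_submersion G.
  have {}onto (v : 'rV[R]_(dim0 G)) : exists w, w *m S = v by have [w] := onto (P1 c) v; exists w; rewrite -SE.
  exists (\matrix_i sval (cid (onto (delta_mx 0 i)))).
  apply/row_matrixP => i; rewrite row_mul rowK; case: cid => /= w ->.
  by rewrite rowE mulmx1.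
have rPsi : \rank Psi = dim0 G.
  apply/eqP; rewrite eqn_leq rank_leq_col -{1}rS mxrankS//.
  by rewrite -addsmxE addsmxSl.
have sub : (Phi <= kermx Psi)%MS by apply/sub_kermxP.
have /eqmxP eqm : (Phi == kermx Psi)%MS.
  rewrite -(mxrank_leqif_eq sub); rewrite mxrank_ker rPsi (eqP rPhi).
  by rewrite -(dim_pairs G) addnK.
have /submxP[W] : (row_mx k l <= Phi)%MS.
  rewrite eqm; apply/sub_kermxP.
  by rewrite mul_row_col mulmxN kl subrr.
by rewrite mul_mx_row => /eq_row_mx[kA lB]; exists W; rewrite AE BE.
Qed.

End LieGroupoid.

(** * Inversion is an isometry and the target a Riemannian submersion *)

Lemma mulmx_bounded (R : realType) m n (B : 'M[R]_(m, n)) :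
  exists2 C, 0 < C & forall x : 'rV[R]_m, `|x *m B| <= C * `|x|.
Proof.
exists (1 + \sum_i `|(delta_mx 0 i : 'rV_m) *m B|); first by rewrite ltr_pwDl// sumr_ge0.
move=> x; rewrite {1}(row_sum_delta x) mulmx_suml.
rewrite (le_trans (ler_norm_sum _ _ _))// mulrDl mul1r mulr_suml.
rewrite -[leLHS]add0r lerD//; apply: ler_sum => i _.
rewrite -scalemxAl normrZ mulrC ler_wpM2l//.
by have [_ _ ->] := coordinates_rV R m.
Qed.

Lemma differentiable_approx (R : realType) (V W : normedModType R) (f : V -> W) x :
  differentiable f x -> forall eta : R, 0 < eta -> exists2 e : R, 0 < e &
  forall z, `|z| < e -> `|f (z + x) - f x - 'D_z f x| <= eta * `|z|.
Proof.
move=> df eta eta0; have /diff_locallyP[_ /eqaddoP/(_ eta eta0)] := df.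
move=> /nbhs_ballP[e /= e0 H]; exists e => // z ze.
have := H z; rewrite -ball_normE/= sub0r normrN => /(_ ze).
by rewrite /= opprD addrA deriveE.
Qed.

(** A continuous map is derivable as soon as its composites with an immersion
    are, provided the derivative of the composites is tangent to the image of
    the immersion: the latter is bounded below to first order at the point. *)
Lemma is_derive_through_immersion (R : realType) a b d (F : 'rV[R]_a -> 'rV[R]_b)
    (I1 I2 : 'rV[R]_b -> 'rV[R]_d) u v w :
  {for u, continuous F} ->
  differentiable I1 (F u) -> differentiable I2 (F u) ->
  (forall z, 'D_z I1 (F u) = 0 -> 'D_z I2 (F u) = 0 -> z = 0) ->
  derivable (I1 \o F) u v -> derivable (I2 \o F) u v ->
  'D_v (I1 \o F) u = 'D_w I1 (F u) -> 'D_v (I2 \o F) u = 'D_w I2 (F u) ->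
  is_derive u v F w.
Proof.
move=> cF d1 d2 inj f1 f2 e1 e2.
have lin (I : 'rV[R]_b -> 'rV[R]_d) : differentiable I (F u) ->
    linear (fun z => 'D_z I (F u)).
  by move=> dI k x y; rewrite !deriveE// linearP.
have [A1 A1E] := linear_is_mulmx (lin _ d1).
have [A2 A2E] := linear_is_mulmx (lin _ d2).
have [kap kap0 lower] : exists2 k, 0 < k & forall z,
    `|z| <= k * (`|'D_z I1 (F u)| + `|'D_z I2 (F u)|).
  have /row_freeP[B] : row_free (row_mx A1 A2).
    rewrite -kermx_eq0; apply/eqP/row_matrixP => i; rewrite row0.
    set z := row i _; have : z *m row_mx A1 A2 = 0 by apply/sub_kermxP; exact: row_sub.
    rewrite mul_mx_row -row_mx0 => /eq_row_mx[z1 z2].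
    by apply: inj; [rewrite A1E|rewrite A2E].
  rewrite -[B]vsubmxK mul_row_col => BE.
  have [C1 C10 H1] := mulmx_bounded (usubmx B).
  have [C2 C20 H2] := mulmx_bounded (dsubmx B).
  exists (C1 + C2); first by rewrite addr_gt0.
  move=> z; rewrite A1E A2E -[z in leLHS]mulmx1 -BE mulmxDr !mulmxA.
  rewrite (le_trans (ler_normD _ _))// mulrDr; apply: lerD.
    by rewrite (le_trans (H1 _))// ler_wpM2r// lerDl ltW.
  by rewrite (le_trans (H2 _))// ler_wpM2r// lerDr ltW.
apply: approx_derive => eta eta0.
(* The first term allows the unknown increment of F to be absorbed into the
   left-hand side, the second makes the remaining error at most eta. *)
pose et := Num.min (1 / (4 * kap)) (eta / (4 * kap * (1 + `|w|))).
have w1 : 0 < 1 + `|w| by rewrite ltr_pwDl.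
have et0 : 0 < et by rewrite lt_min !divr_gt0// !mulr_gt0.
have [r1 r10 Hr1] := derivable_approx f1 et0.
have [r2 r20 Hr2] := derivable_approx f2 et0.
have [s1 s10 Hs1] := differentiable_approx d1 et0.
have [s2 s20 Hs2] := differentiable_approx d2 et0.
have : {for 0, continuous (fun h : R => F (h *: v + u))}.
  apply: (@continuous_comp _ _ _ (fun h : R => h *: v + u) F).
    have [cl _] := Ck_line 0 [set: R^o] v u; exact: cl.
  by rewrite scale0r add0r.
move=> /cvgrPdist_lt/(_ (Num.min s1 s2)); rewrite lt_min s10 s20 => /(_ isT).
move=> /nbhs_ballP[r3 /= r30 Hr3].
exists (Num.min r3 (Num.min r1 r2)); first by rewrite !lt_min r10 r20 r30.
move=> h; rewrite !lt_min => /and3P[h3 h1 h2].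
pose y := F (h *: v + u) - F u.
have [ys1 ys2] : `|y| < s1 /\ `|y| < s2.
  have := Hr3 h; rewrite -ball_normE/= sub0r normrN scale0r add0r distrC.
  by rewrite -/y lt_min => /(_ h3) /andP.
have yF : y + F u = F (h *: v + u) by rewrite subrK.
have bound (I : 'rV[R]_b -> 'rV[R]_d) : differentiable I (F u) ->
    'D_v (I \o F) u = 'D_w I (F u) ->
    `|I (F (h *: v + u)) - I (F u) - h *: 'D_v (I \o F) u| <= et * `|h| ->
    `|I (y + F u) - I (F u) - 'D_y I (F u)| <= et * `|y| ->
    `|'D_(y - h *: w) I (F u)| <= et * (`|h| + `|y|).
  move=> dI eI; rewrite eI yF => b1 b2.
  have -> : 'D_(y - h *: w) I (F u) =
     (I (F (h *: v + u)) - I (F u) - h *: 'D_w I (F u)) -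
     (I (F (h *: v + u)) - I (F u) - 'D_y I (F u)).
    have [A AE] := linear_is_mulmx (lin _ dI).
    by rewrite opprB [RHS]addrC subrKA !AE mulmxBl -scalemxAl.
  by rewrite (le_trans (ler_normB _ _))// mulrDr lerD.
have B1 := bound _ d1 e1 (Hr1 _ h1) (Hs1 _ ys1).
have B2 := bound _ d2 e2 (Hr2 _ h2) (Hs2 _ ys2).
have L := lower (y - h *: w).
rewrite -/y; set X := `|y - h *: w| in L *.
have yX : `|y| <= X + `|h| * `|w|.
  by rewrite -normrZ -{1}[y](subrK (h *: w)) ler_normD.
have {L}L : X <= kap * (2 * (et * (`|h| + `|y|))).
  apply: le_trans L _; rewrite ler_pM2l//; lra.
have k1 : 4 * kap * et <= 1.
  by rewrite mulrC -ler_pdivlMr ?mulr_gt0// /et ge_min lexx.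
have k2 : 4 * kap * (1 + `|w|) * et <= eta.
  by rewrite mulrC -ler_pdivlMr ?mulr_gt0// /et ge_min lexx orbT.
have h0 : 0 <= `|h| by [].
have kk := mulr_ge0 (ltW kap0) (ltW et0).
have Y1 : kap * et * `|y| <= kap * et * (X + `|h| * `|w|) by rewrite ler_wpM2l.
have X0 : 0 <= X by exact: normr_ge0.
have Z1 : 4 * kap * et * X <= 1 * X by rewrite ler_wpM2r.
have Z2 : 4 * kap * (1 + `|w|) * et * `|h| <= eta * `|h| by rewrite ler_wpM2r.
lra.
Qed.

(** The chain rule for an inner map that is only known to be derivable in one
    direction; it serves for the flip of composable pairs. *)
Lemma diff_at_comp_is_derive (R : realType) k m n (K : manifold R k)
    (M : manifold R m) (N : manifold R n) (f : K -> M) (g : M -> N) p v w :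
  (\forall y \near mchart p p, mdom (f p) (f (mchartV p y))) -> smooth_map g ->
  is_derive (mchart p p) v (local_map f p (f p)) w ->
  diff_at (g \o f) p v = diff_at g (f p) w.
Proof.
move=> nf sg [df Dw].
have Fu : local_map f p (f p) (mchart p p) = mchart (f p) (f p).
  by rewrite /local_map /= mchartK//; exact: mdom_center.
have dg : differentiable (local_map g (f p) (g (f p)))
    (local_map f p (f p) (mchart p p)).
  rewrite Fu; apply: local_map_differentiable => //.
  by apply: local_map_dom_chart; exact: mdom_center.
have [_ ] := is_derive_comp df dg; rewrite Dw Fu => H.
rewrite [RHS]diff_atE -H diff_atE; apply: near_eq_derive.
by apply: filterS nf => y yf; rewrite /local_map /= mchartK.
Qed.

Section GroupoidMetric.
Variables (R : realType) (G : lie_groupoid R).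
Variables (eta2 : metric (Pairs G)) (eta1 : metric (Ar G)) (eta0 : metric (Ob G)).
Hypothesis (Heta : groupoid_metric eta2) (Hind : induced_metrics eta2 eta1 eta0).

Notation P1 := (@pr1 _ _ G : Pairs G -> Ar G).
Notation P2 := (@pr2 _ _ G : Pairs G -> Ar G).
Notation mu := (@multiplication R G).
Notation sr := (@source R G).
Notation tg := (@target R G).
Notation iv := (@inv _ _ G : Ar G -> Ar G).
Notation fl := (@flip _ _ G : Pairs G -> Pairs G).

Let srS : smooth_map sr. Proof. exact: source_smooth. Qed.
Let tgS : smooth_map tg. Proof. exact: target_smooth. Qed.
Let P1S : smooth_map P1. Proof. exact: pr1_smooth. Qed.
Let P2S : smooth_map P2. Proof. exact: pr2_smooth. Qed.
Let muS : smooth_map mu. Proof. exact: mul_smooth. Qed.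
Let ivS : smooth_map iv. Proof. exact: inv_smooth. Qed.

Let source_P1 : sr \o P1 = tg \o P2.
Proof. by apply/funext => c; exact: pairs_composable. Qed.
Let source_mu : sr \o mu = sr \o P2.
Proof. by apply/funext => c; apply: src_mul; exact: pairs_composable. Qed.
Let target_mu : tg \o mu = tg \o P1.
Proof. by apply/funext => c; apply: tgt_mul; exact: pairs_composable. Qed.
Let source_iv : sr \o iv = tg.
Proof. by apply/funext => g; exact: src_inv. Qed.
Let target_iv : tg \o iv = sr.
Proof. by apply/funext => g; exact: tgt_inv. Qed.
Let iv_iv : iv \o iv = id.
Proof. by apply/funext => g; exact: inv_inv. Qed.
Let P1_fl c : P1 (fl c) = iv (P2 c). Proof. by []. Qed.
Let P2_fl c : P2 (fl c) = iv (P1 c). Proof. by []. Qed.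
Let mu_fl : mu \o fl = iv \o mu.
Proof. by apply/funext => g; exact: pmul_flip. Qed.

Lemma diff_source_inv a k : diff_at sr (iv a) (diff_at iv a k) = diff_at tg a k.
Proof. by rewrite -(diff_at_comp a k ivS srS) source_iv. Qed.

Lemma diff_target_inv a k : diff_at tg (iv a) (diff_at iv a k) = diff_at sr a k.
Proof. by rewrite -(diff_at_comp a k ivS tgS) target_iv. Qed.

Lemma diff_invK a k : diff_at iv (iv a) (diff_at iv a k) = k.
Proof. by rewrite -(diff_at_comp a k ivS ivS) iv_iv diff_at_id. Qed.

Let nbhs_mdom n (M : manifold R n) (x : M) : nbhs x (mdom x).
Proof. by apply: open_nbhs_nbhs; split; [exact: mdom_open|exact: mdom_center]. Qed.

(** Composable pairs carry the topology induced from the product, so continuity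
    may be checked on the two components. *)
Lemma flip_continuous : continuous fl.
Proof.
apply: (@continuous_comp_initial _ _ _ (@set_val _ (composable G))) => c.
apply: (@cvg_pair _ _ _ _ (nbhs (iv (P2 c))) (nbhs (iv (P1 c))) _ _ _
    (iv \o P2) (iv \o P1)).
- exact: (nbhs_filter (c : Pairs G)).
- exact: (smooth_map_continuous (smooth_map_comp P2S ivS)).
- exact: (smooth_map_continuous (smooth_map_comp P1S ivS)).
Qed.

Let flip_near c : \forall y \near mchart c c, mdom (fl c) (fl (mchartV c y)).
Proof.
have cfl : {for mchart c c, continuous (fl \o mchartV c)}.
  apply: continuous_comp; last exact: flip_continuous.
  by apply: mchartV_continuous; apply: mrange_chart; exact: mdom_center.
apply: cfl; rewrite /= mchartK; first exact: (@nbhs_mdom _ (Pairs G) (fl c)).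
exact: mdom_center.
Qed.

(** The projections of the flip are composites of smooth maps. As they form an
    immersion, the flip itself has directional derivatives, with the expected
    projections. *)
Lemma flip_derive (c : Pairs G) v : exists w,
  [/\ is_derive (mchart c c) v (local_map fl c (fl c)) w,
      diff_at P1 (fl c) w = diff_at iv (P2 c) (diff_at P2 c v) &
      diff_at P2 (fl c) w = diff_at iv (P1 c) (diff_at P1 c v)].
Proof.
have [|w [w1 w2]] := @tangent_pair R G (fl c)
    (diff_at iv (P2 c) (diff_at P2 c v)) (diff_at iv (P1 c) (diff_at P1 c v)).
  rewrite P1_fl P2_fl diff_source_inv diff_target_inv.
  by rewrite -(diff_at_comp c v P2S tgS) -(diff_at_comp c v P1S srS) source_P1.
exists w; split; [|exact: w1|exact: w2].
pose u := mchart c c; pose F := local_map fl c (fl c).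
have cc : mdom c c by exact: mdom_center.
have Fu : F u = mchart (fl c) (fl c) by rewrite /F /u /local_map /= mchartK.
have cfl : {for u, continuous (fl \o mchartV c)}.
  apply: continuous_comp; last exact: flip_continuous.
  by apply: mchartV_continuous; exact: mrange_chart.
have near_fl := flip_near c.
have dP (P : Pairs G -> Ar G) : smooth_map P ->
    differentiable (local_map P (fl c) (P (fl c))) (F u).
  move=> sP; rewrite Fu; apply: (local_map_differentiable sP).
  by apply: local_map_dom_chart; exact: mdom_center.
have dQ (Q : Pairs G -> Ar G) : smooth_map Q ->
    derivable (local_map Q c (Q c)) u v.
  move=> sQ; apply: diff_derivable; apply: (local_map_differentiable sQ).
  by apply: local_map_dom_chart; exact: mdom_center.
have eq_near (P Q : Pairs G -> Ar G) : P \o fl = Q -> \forall y \near u,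
    local_map Q c (Q c) y = (local_map P (fl c) (P (fl c)) \o F) y.
  move=> <-; apply: filterS near_fl => y yfl.
  by rewrite /F /local_map /= mchartK.
have Q1S : smooth_map (iv \o P2) by exact: (smooth_map_comp P2S ivS).
have Q2S : smooth_map (iv \o P1) by exact: (smooth_map_comp P1S ivS).
have E1 := eq_near P1 (iv \o P2) erefl.
have E2 := eq_near P2 (iv \o P1) erefl.
apply: (is_derive_through_immersion (I1 := local_map P1 (fl c) (P1 (fl c)))
  (I2 := local_map P2 (fl c) (P2 (fl c)))).
- apply: (@continuous_comp _ (Pairs G) _ (fl \o mchartV c) (mchart (fl c))).
    exact: cfl.
  by rewrite /= mchartK//; apply: mchart_continuous; exact: mdom_center.
- exact: dP.
- exact: dP.
- by rewrite -/F Fu => z; exact: pairs_immersed.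
- exact: near_eq_derivable E1 (dQ _ Q1S).
- exact: near_eq_derivable E2 (dQ _ Q2S).
- rewrite -(near_eq_derive _ E1) -/F Fu -[RHS]/(diff_at P1 (fl c) w) w1.
  exact: (diff_at_comp c v P2S ivS).
- rewrite -(near_eq_derive _ E2) -/F Fu -[RHS]/(diff_at P2 (fl c) w) w2.
  exact: (diff_at_comp c v P1S ivS).
Qed.

Lemma diff_pr1_flip c v :
  diff_at P1 (fl c) (diff_at fl c v) = diff_at iv (P2 c) (diff_at P2 c v).
Proof. by have [w [[_ ] + + _]] := flip_derive c v => <-. Qed.

Lemma diff_pr2_flip c v :
  diff_at P2 (fl c) (diff_at fl c v) = diff_at iv (P1 c) (diff_at P1 c v).
Proof. by have [w [[_ ] + _ +]] := flip_derive c v => <-. Qed.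

Lemma diff_flipK c v : diff_at fl (fl c) (diff_at fl c v) = v.
Proof.
set z := LHS.
have z1 : diff_at P1 c z = diff_at P1 c v.
  rewrite -[in LHS](flipK c) diff_pr1_flip diff_pr2_flip P2_fl.
  exact: (diff_invK (P1 c)).
have z2 : diff_at P2 c z = diff_at P2 c v.
  rewrite -[in LHS](flipK c) diff_pr2_flip diff_pr1_flip P1_fl.
  exact: (diff_invK (P2 c)).
apply/eqP; rewrite -subr_eq0; apply/eqP; apply: (pairs_immersed (c := c)).
  by rewrite (linearB_eq _ _ (diff_at_linear c P1S)) z1 subrr.
by rewrite (linearB_eq _ _ (diff_at_linear c P2S)) z2 subrr.
Qed.

Lemma diff_mul_flip c v :
  diff_at mu (fl c) (diff_at fl c v) = diff_at iv (mu c) (diff_at mu c v).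
Proof.
rewrite -(diff_at_comp c v muS ivS) -mu_fl.
have [w [D _ _]] := flip_derive c v; have [_ Dw] := D.
rewrite (diff_at_comp_is_derive (flip_near c) muS D).
by rewrite -Dw.
Qed.

(** Every arrow is a product, horizontal lifts for the multiplication are
    carried to horizontal lifts by the flip, which is isometric, and the flip
    covers the inversion of arrows. *)
Lemma inv_isometry a k l :
  eta1 (iv a) (diff_at iv a k) (diff_at iv a l) = eta1 a k l.
Proof.
have [flI _ _] := Heta; have [muRS _] := Hind; have [_ iso] := muRS.
(* The arrow a as the product of itself and a unit. *)
pose c : Pairs G := mkpair (esym (tgt_unit G (src G a))).
have mc : mu c = a by exact: mul_unitr.
have [w hw <-] := horizontal_lift muRS c k.
have [w' hw' <-] := horizontal_lift muRS c l.
have hfl z : horizontal eta2 mu c z -> horizontal eta2 mu (fl c) (diff_at fl c z).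
  move=> hz u mu0; rewrite -[u](diff_flipK (fl c)) flipK.
  rewrite flI; apply: hz.
  have := diff_mul_flip (fl c) u; rewrite flipK mu0 => ->.
  exact/linear0_eq/diff_at_linear/ivS.
have H := iso _ _ _ (hfl _ hw) (hfl _ hw').
rewrite flI -(iso _ _ _ hw hw') in H.
rewrite (diff_mul_flip c w) (diff_mul_flip c w') in H.
have mfl : mu (fl c) = iv a by rewrite -mc; exact: pmul_flip.
rewrite mfl mc in H; exact: H.
Qed.

(** The target is the source composed with the inversion, which is an isometry.
    *)
Lemma target_riemannian_submersion : riemannian_submersion eta1 eta0 tg.
Proof.
have [_ [_ iso]] := Hind; split; first exact: tgt_submersion.
move=> a w w' hw hw'.
have hiv z : horizontal eta1 tg a z -> horizontal eta1 sr (iv a) (diff_at iv a z).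
  move=> hz u su; rewrite -[u](diff_invK (iv a)) [iv (iv a)]inv_inv inv_isometry.
  apply: hz; have := diff_target_inv (iv a) u.
  by rewrite [iv (iv a)]inv_inv su.
have := iso _ _ _ (hiv _ hw) (hiv _ hw').
by rewrite !diff_source_inv inv_isometry [sr (iv a)]src_inv.
Qed.

(** Right translation by the inverse of an arrow identifies the source fibre
    through this arrow with the source fibre through the unit at its target.
    The translation is differentiated through the multiplication on tangent
    pairs with second component zero. *)
Lemma orbit_tangent_target a v :
  orbit_tangent (tg a) v <->
  exists2 k, diff_at sr a k = 0 & diff_at tg a k = v.
Proof.
split=> -[k k0 kv].
  pose c : Pairs G := mkpair (src_unit G (tgt G a)).
  have mc : mu c = a by exact: mul_unitl.
  have [|W [W1 W2]] := @tangent_pair R G c k 0.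
    rewrite [LHS]k0; apply/esym/linear0_eq; exact: (diff_at_linear _ tgS).
  exists (diff_at mu c W).
    rewrite -[in LHS]mc -(diff_at_comp c W muS srS) source_mu.
    rewrite (diff_at_comp c W P2S srS) W2; exact/linear0_eq/diff_at_linear/srS.
  rewrite -[in LHS]mc -(diff_at_comp c W muS tgS) target_mu.
  by rewrite (diff_at_comp c W P1S tgS) W1.
pose c : Pairs G := mkpair (esym (tgt_inv G a)).
have mc : mu c = unit G (tg a) by exact: mul_invr.
have [|W [W1 W2]] := @tangent_pair R G c k 0.
  rewrite [LHS]k0; apply/esym/linear0_eq; exact: (diff_at_linear _ tgS).
exists (diff_at mu c W); rewrite -mc.
  rewrite -(diff_at_comp c W muS srS) source_mu.
  rewrite (diff_at_comp c W P2S srS) W2; exact/linear0_eq/diff_at_linear/srS.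
rewrite -(diff_at_comp c W muS tgS) target_mu.
by rewrite (diff_at_comp c W P1S tgS) W1.
Qed.

Lemma orbit_tangent_source a v :
  orbit_tangent (sr a) v <->
  exists2 k, diff_at tg a k = 0 & diff_at sr a k = v.
Proof.
have -> : sr a = tg (iv a) by rewrite [RHS]tgt_inv.
rewrite orbit_tangent_target; split=> -[k k0 kv].
  have e1 := diff_target_inv (iv a) k; have e2 := diff_source_inv (iv a) k.
  rewrite [iv (iv a)]inv_inv in e1 e2.
  by exists (diff_at iv (iv a) k); [rewrite e1|rewrite e2].
by exists (diff_at iv a k); [rewrite diff_source_inv|rewrite diff_target_inv].
Qed.

End GroupoidMetric.

(** * The norm of normal vectors *)

Section NormalNorm.
Variables (R : realType) (G : lie_groupoid R).
Variables (eta2 : metric (Pairs G)) (eta1 : metric (Ar G)) (eta0 : metric (Ob G)).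
Hypothesis (Heta : groupoid_metric eta2) (Hind : induced_metrics eta2 eta1 eta0).
Implicit Types (x : Ob G) (a : Ar G) (u v : 'rV[R]_(dim0 G)).

Notation sr := (@source R G).
Notation tg := (@target R G).

Let srS : smooth_map sr. Proof. exact: source_smooth. Qed.
Let tgS : smooth_map tg. Proof. exact: target_smooth. Qed.

Lemma normal_part_spec x v :
  (forall u, orbit_tangent x u -> eta0 x (normal_part eta0 x v) u = 0) /\
  orbit_tangent x (v - normal_part eta0 x v).
Proof.
have [S SE] := linear_is_mulmx (diff_at_linear (unit G x) srS).
have [T TE] := linear_is_mulmx (diff_at_linear (unit G x) tgS).
have [p [p1 [z pz]]] := orthogonal_decomposition eta0 x (kermx S *m T) v.
rewrite /normal_part; case: xgetP => [q _ [q1 q2]//|/(_ p)[]]; split.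
  move=> u [w]; rewrite SE => /sub_kermxP/submxP[D ->]; rewrite TE => <-.
  by rewrite -mulmxA; exact: p1.
exists (z *m kermx S); first by rewrite SE -mulmxA mulmx_ker mulmx0.
by rewrite TE pz -mulmxA.
Qed.

Lemma orbit_tangent_linear x (a : R) u v : orbit_tangent x u -> orbit_tangent x v ->
  orbit_tangent x (a *: u + v).
Proof.
move=> [k k0 <-] [l l0 <-]; exists (a *: k + l).
  by rewrite (diff_at_linear _ srS) k0 l0 scaler0 addr0.
by rewrite (diff_at_linear _ tgS).
Qed.

Lemma normal_part_unique x v p :
  (forall u, orbit_tangent x u -> eta0 x p u = 0) ->
  orbit_tangent x (v - p) -> normal_part eta0 x v = p.
Proof.
move=> p1 p2; have [q1 q2] := normal_part_spec x v.
set q := normal_part eta0 x v in q1 q2 *.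
have t : orbit_tangent x (q - p).
  have -> : q - p = (-1) *: (v - q) + (v - p).
    by rewrite scaleN1r opprB subrKA.
  exact: orbit_tangent_linear.
apply/eqP; rewrite -subr_eq0; apply/eqP/(inner_eq0 (g := eta0) (p := x)).
by rewrite innerDl innerNl (q1 _ t) (p1 _ t) subr0.
Qed.

Lemma normal_norm_le x v : normal_norm eta0 x v <= tnorm eta0 x v.
Proof.
have [q1 q2] := normal_part_spec x v; rewrite /normal_norm.
set q := normal_part eta0 x v in q1 q2 *.
rewrite -ler_sqr ?nnegrE ?tnorm_ge0// !tnorm_sqr.
have [d td vE] : exists2 d, orbit_tangent x d & v = d + q.
  by exists (v - q) => //; rewrite subrK.
rewrite [in leRHS]vE innerDl !innerDr (innerC _ _ d q) (q1 _ td).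
by rewrite addr0 add0r lerDr inner_ge0.
Qed.

Lemma normal_norm_ge0 x v : 0 <= normal_norm eta0 x v.
Proof. exact: tnorm_ge0. Qed.

Lemma ler_normal_normD x v w :
  normal_norm eta0 x (v + w) <= normal_norm eta0 x v + normal_norm eta0 x w.
Proof.
have [v1 v2] := normal_part_spec x v; have [w1 w2] := normal_part_spec x w.
apply: le_trans (ler_tnormD _ _ _ _); rewrite /normal_norm le_eqVlt.
apply/orP; left; apply/eqP; congr tnorm; apply: normal_part_unique.
  by move=> u tu; rewrite innerDl v1// w1// addr0.
have := orbit_tangent_linear 1 v2 w2.
by rewrite scale1r addrACA -opprD.
Qed.

(** The lift of a vector normal to the orbit that is horizontal for the source
    is orthogonal to both kernels, hence also horizontal for the target. *)
Lemma normal_norm_arrow a w :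
  normal_norm eta0 (sr a) (diff_at sr a w) =
  normal_norm eta0 (tg a) (diff_at tg a w).
Proof.
have [_ srRS] := Hind; have tgRS := target_riemannian_submersion Heta Hind.
have ls := diff_at_linear a srS; have lt := diff_at_linear a tgS.
have [n1 n2] := normal_part_spec (sr a) (diff_at sr a w).
rewrite {1}/normal_norm; set n := normal_part _ _ _ in n1 n2 *.
have [wn hwn wnE] := horizontal_lift srRS a n.
have [k tk sk] := (orbit_tangent_source a _).1 n2.
have tgh : horizontal eta1 tg a wn.
  move=> u tu; rewrite (inner_horizontal srRS _ hwn) wnE; apply: n1.
  by apply/orbit_tangent_source; exists u.
have nE : tnorm eta0 (tg a) (diff_at tg a wn) = tnorm eta0 (sr a) n.
  rewrite /tnorm -(inner_horizontal tgRS _ tgh) -wnE.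
  by rewrite -(inner_horizontal srRS _ hwn).
rewrite -nE; congr tnorm; apply/esym/normal_part_unique.
  move=> u /orbit_tangent_target[l sl <-].
  by rewrite -(inner_horizontal tgRS _ tgh) hwn.
apply/orbit_tangent_target; exists (w - wn - k).
  by rewrite (linearB_eq _ _ ls) (linearB_eq _ _ ls) wnE sk subrr.
by rewrite (linearB_eq _ _ lt) (linearB_eq _ _ lt) tk subr0.
Qed.

(** With the next lemma, the normal norm is the least cost of splitting a
    vector into a part moved along an arrow direction and a remainder. In
    charts, the cost of a constant arrow direction is a continuous function
    along a curve, so this writes the normal speed as an infimum of continuous
    functions of time. *)
Lemma normal_norm_le_split x v w :
  normal_norm eta0 x v <=
  tnorm eta0 x (v - diff_at sr (unit G x) w) +
  tnorm eta0 x (diff_at tg (unit G x) w).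
Proof.
rewrite -[in leLHS](subrK (diff_at sr (unit G x) w) v).
rewrite (le_trans (ler_normal_normD _ _ _))// lerD ?normal_norm_le//.
have := normal_norm_arrow (unit G x) w; rewrite [sr _]src_unit [tg _]tgt_unit => ->.
exact: normal_norm_le.
Qed.

(** The arrow direction is the differential of the unit, corrected by the
    source-vertical vector whose target is the part of v tangent to the orbit.
    *)
Lemma normal_norm_split_attained x v : exists w,
  diff_at sr (unit G x) w = v /\
  tnorm eta0 x (diff_at tg (unit G x) w) = normal_norm eta0 x v.
Proof.
have [_ [k k0 kE]] := normal_part_spec x v.
have uS : smooth_map (unit G : Ob G -> Ar G) by exact: unit_smooth.
have su : sr \o (unit G : Ob G -> Ar G) = id by apply/funext => y; exact: src_unit.
have tu : tg \o (unit G : Ob G -> Ar G) = id by apply/funext => y; exact: tgt_unit.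
exists (diff_at (unit G : Ob G -> Ar G) x v - k); split.
  rewrite (linearB_eq _ _ (diff_at_linear _ srS)) k0 subr0.
  by rewrite -(diff_at_comp x v uS srS) su diff_at_id.
rewrite (linearB_eq _ _ (diff_at_linear _ tgS)) kE.
rewrite -(diff_at_comp x v uS tgS) tu diff_at_id /normal_norm; congr tnorm.
by rewrite opprB addrC subrK.
Qed.

End NormalNorm.

(** * Quasi-metrics bounded by integrals *)

Section Integration.
Variable R : realType.
Notation mu := (@lebesgue_measure R).
Notation lmeasurable D f :=
  (@measurable_fun _ _ (measurableTypeR R) _ D (f : _ -> \bar R)).
Local Open Scope ereal_scope.

(** The integral of a nonnegative function is a supremum over the simple
    functions below it, so it is monotone without measurability. *)
Lemma ge0_integral_monotone (A B : set R) (f g : R -> \bar R) :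
  (forall x, A x -> 0 <= f x) -> (forall x, B x -> 0 <= g x) ->
  (forall x, A x -> B x /\ f x <= g x) ->
  \int[mu]_(x in A) f x <= \int[mu]_(x in B) g x.
Proof.
move=> f0 g0 fg; rewrite !ge0_integralE//; apply: ge_ereal_sup => _ [h hf <-].
apply: ereal_sup_ubound; exists h => // x; apply: le_trans (hf x) _.
rewrite /patch; case: ifPn => xA; case: ifPn => xB //.
- by rewrite inE in xA; have [] := fg x xA.
- by rewrite inE in xA; have [Bx _] := fg x xA; rewrite mem_set in xB.
- by apply: g0; rewrite inE in xB.
Qed.

Lemma integral_oc_cst (c s t : R) : (s <= t)%R ->
  \int[mu]_(x in `]s, t]) c%:E = (c * (t - s))%:E.
Proof.
move=> st; rewrite integral_cst//= lebesgue_measure_itv/= lte_fin EFinM.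
case: ltP => // ts; congr (_ * _)%E.
by have -> : s = t by [apply/le_anti; rewrite st ts]; rewrite subrr.
Qed.

Lemma integral_oc_split (f : R -> \bar R) (s t u : R) : (s <= t)%R -> (t <= u)%R ->
  lmeasurable `]s, t] f -> lmeasurable `]t, u] f ->
  (forall x, x \in `]s, u] -> 0 <= f x) ->
  lmeasurable `]s, u] f /\
  \int[mu]_(x in `]s, u]) f x =
  \int[mu]_(x in `]s, t]) f x + \int[mu]_(x in `]t, u]) f x.
Proof.
move=> st tu m1 m2 f0.
have E : [set` `]s, u]] = [set` `]s, t]] `|` [set` `]t, u]] :> set R.
  apply/seteqP; split => x /=; rewrite !in_itv/=.
    by move=> /andP[sx xu]; have [xt|tx] := leP x t; [left; rewrite sx|right].
  move=> [] /andP[a1 a2]; first by rewrite a1 (le_trans a2).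
  by rewrite a2 (le_lt_trans st a1).
have mU : lmeasurable ([set` `]s, t]] `|` [set` `]t, u]]) f by apply/measurable_funU.
rewrite E; split => //; rewrite ge0_integral_setU//.
  by move=> x Ux; apply: f0; move: Ux; rewrite -E.
apply/disj_setPS => x []/=; rewrite !in_itv/= => /andP[_ xt] /andP[tx _].
by have := lt_le_trans tx xt; rewrite ltxx.
Qed.

(** By interval induction, the triangle inequality being matched by the
    additivity of the integral. On a short interval around x the integral is at
    least (g x - eps) times the length, which is the hypothesis on D up to an
    error proportional to the length. *)
Lemma quasi_metric_le_integral (D : R -> R -> \bar R) (g : R -> R) (a b : R) :
  (a <= b)%R -> (forall s t u, D s u <= D s t + D t u) ->
  (forall x, a <= x <= b -> {for x, continuous g})%R ->
  (forall x, a <= x <= b -> 0 <= g x)%R ->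
  (forall x eps, a <= x <= b -> 0 < eps -> exists2 e, 0 < e & forall t,
     `|t - x| < e -> (D x t <= ((g x + eps) * `|t - x|)%:E)%E /\
                     (D t x <= ((g x + eps) * `|t - x|)%:E)%E)%R ->
  D a b <= \int[mu]_(x in `]a, b]) (g x)%:E.
Proof.
move=> ab Dtri cg g0 Dloc; apply/lee_addgt0Pr => e e0.
(* The accumulated error is 2 eps (b - a). *)
pose eps := (e / (2 * (b - a + 1)))%R.
have ba1 : (0 < b - a + 1)%R by rewrite ltr_pwDr// subr_ge0.
have eps0 : (0 < eps)%R by rewrite divr_gt0// mulr_gt0.
have mg (s t : R) : (a <= s)%R -> (t <= b)%R ->
    lmeasurable `]s, t] (fun x => (g x)%:E).
  move=> as_ tb; apply/measurable_EFinP.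
  apply: subspace_continuous_measurable_fun => //.
  apply: continuous_in_subspaceT => x; rewrite inE/= in_itv/= => /andP[sx xt].
  by apply: cg; rewrite (le_trans as_ (ltW sx)) (le_trans xt tb).
have int0 (s t : R) : (a <= s)%R -> (t <= b)%R ->
    forall x, x \in `]s, t] -> 0 <= (g x)%:E.
  move=> as_ tb x; rewrite in_itv/= => /andP[sx xt]; rewrite lee_fin; apply: g0.
  by rewrite (le_trans as_ (ltW sx)) (le_trans xt tb).
pose P s t := D s t <= \int[mu]_(x in `]s, t]) (g x)%:E + (2 * eps * (t - s))%:E.
have PP s t u : (a <= s)%R -> (s <= t)%R -> (t <= u)%R -> (u <= b)%R ->
    P s t -> P t u -> P s u.
  move=> as_ st tu ub Pst Ptu; rewrite /P.
  have at_ := le_trans as_ st; have tb := le_trans tu ub.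
  have [_ ->] := integral_oc_split st tu (mg _ _ as_ tb) (mg _ _ at_ ub) (int0 _ _ as_ ub).
  apply: le_trans (Dtri s t u) _; apply: le_trans (leeD Pst Ptu) _.
  rewrite addeACA -EFinD leeD2l// lee_fin; lra.
have : P a b.
  apply: (interval_induction ab PP) => x xab.
  have [d1 d10 H1] := Dloc x eps xab eps0.
  have /cvgrPdist_le/(_ eps eps0)/nbhs_ballP[d2 /= d20 H2] := cg x xab.
  (* A nonnegative constant below g near x, as required by the monotonicity of
     the integral. *)
  pose c := Num.max 0%R (g x - eps)%R.
  have cg' y : (`|x - y| < d2)%R -> (a <= y <= b)%R -> (c <= g y)%R.
    move=> xy yab; rewrite ge_max g0//=.
    have := H2 y; rewrite -ball_normE/= => /(_ xy); rewrite ler_norml; lra.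
  have gc : (g x + eps <= c + 2 * eps)%R.
    have : (g x - eps <= c)%R by rewrite le_max lexx orbT.
    lra.
  exists (Num.min d1 d2); first by rewrite lt_min d10.
  have small s t : (a <= s)%R -> (s <= t)%R -> (t <= b)%R ->
      (forall y, y \in `]s, t] -> `|x - y| < d2)%R ->
      D s t <= ((g x + eps) * (t - s))%:E -> P s t.
    move=> as_ st tb near Dst; apply: le_trans Dst _.
    apply: (@le_trans _ _ ((c * (t - s))%:E + (2 * eps * (t - s))%:E)).
      by rewrite -EFinD lee_fin -mulrDl ler_wpM2r// subr_ge0.
    rewrite leeD2r// -integral_oc_cst//; apply: ge0_integral_monotone.
    + by move=> y _; rewrite lee_fin le_max lexx.
    + by move=> y; exact: int0.
    + move=> y yst; split => //; rewrite lee_fin; apply: cg'; first exact: near.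
      by move: yst; rewrite /= in_itv/= => /andP[sy yt];
        rewrite (le_trans as_ (ltW sy)) (le_trans yt tb).
  have /andP[ax xb] := xab.
  move=> s t as_ tb xs sx xt tx.
  have m1 : (Num.min d1 d2 <= d1)%R by rewrite ge_min lexx.
  have m2 : (Num.min d1 d2 <= d2)%R by rewrite ge_min lexx orbT.
  apply: (PP s x t) => //; apply: small => //.
  - move=> y; rewrite in_itv/= => /andP[sy yx]; rewrite ger0_norm; lra.
  - have [|_] := H1 s; first by rewrite ler0_norm; lra.
    by rewrite ler0_norm ?subr_le0// opprB.
  - move=> y; rewrite in_itv/= => /andP[xy yt]; rewrite ler0_norm; lra.
  - have [|+ _] := H1 t; first by rewrite ger0_norm; lra.
    by rewrite ger0_norm ?subr_ge0.
move=> Pab; apply: le_trans Pab _; rewrite leeD2l// lee_fin /eps.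
rewrite (_ : _ * _ = e * ((b - a) / (b - a + 1)))%R; last by field; lra.
apply: ler_piMr; first exact: ltW.
by rewrite ler_pdivrMr// mul1r lerDl.
Qed.

End Integration.

Section InfimumOfSpeeds.
Variable R : realType.
Notation mu := (@lebesgue_measure R).

(** The running minima of a countable family of continuous functions are
    continuous and decrease to its infimum. *)
Fixpoint running_min (f : nat -> R -> R) n t : R :=
  if n is m.+1 then Num.min (running_min f m t) (f n t) else f 0%N t.

Lemma running_min_le f n k t : (k <= n)%N -> running_min f n t <= f k t.
Proof.
elim: n => [|n IH]; first by rewrite leqn0 => /eqP ->.
rewrite leq_eqVlt => /orP[/eqP->|]; first by rewrite /= ge_min lexx orbT.
by rewrite ltnS /= => /IH H; rewrite ge_min H.
Qed.

Lemma running_min_attained f n t : exists k, running_min f n t = f k t.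
Proof.
elim: n => [|n [k IH]] /=; first by exists 0%N.
by rewrite IH; case: leP => _; [exists k|exists n.+1].
Qed.

Lemma running_min_continuous f n t : (forall k, {for t, continuous (f k)}) ->
  {for t, continuous (running_min f n)}.
Proof.
move=> cf; elim: n => [|n IH]; first exact: cf.
exact: (continuous_min IH (cf _)).
Qed.

(** The speed s is only an infimum of continuous speeds, hence semicontinuous;
    the bound for each running minimum passes to the limit by dominated
    convergence. *)
Lemma quasi_metric_le_integral_inf (D : R -> R -> \bar R) (f : nat -> R -> R)
    (s : R -> R) (a b : R) : a <= b ->
  (forall x y z, (D x z <= D x y + D y z)%E) ->
  (forall k x, a <= x <= b -> {for x, continuous (f k)}) ->
  (forall x, a <= x <= b -> 0 <= s x) ->
  (forall k x, a <= x <= b -> s x <= f k x) ->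
  (forall x eta, a <= x <= b -> 0 < eta -> exists k, f k x <= s x + eta) ->
  (forall k x eps, a <= x <= b -> 0 < eps -> exists2 e, 0 < e & forall t,
     `|t - x| < e -> (D x t <= ((f k x + eps) * `|t - x|)%:E)%E /\
                     (D t x <= ((f k x + eps) * `|t - x|)%:E)%E) ->
  measurable_fun `]a, b] (EFin \o s) /\
  (D a b <= \int[mu]_(x in `]a, b]) (s x)%:E)%E.
Proof.
move=> ab Dtri cf s0 sf fs Dloc; pose h n := running_min f n.
have sub x : x \in `]a, b] -> a <= x <= b.
  by rewrite in_itv/= => /andP[/ltW -> ->].
have ch n x : a <= x <= b -> {for x, continuous (h n)}.
  by move=> xab; apply: running_min_continuous => k; exact: cf.
have sh n x : a <= x <= b -> s x <= h n x.
  by move=> xab; rewrite /h; have [k ->] := running_min_attained f n x; exact: sf.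
have cvh x : a <= x <= b -> h ^~ x @ \oo --> s x.
  move=> xab; apply/cvgrPdist_le => eta eta0; have [k fk] := fs x eta xab eta0.
  exists k => // n /= kn; rewrite ler0_norm ?subr_le0 ?sh// opprB lerBlDl.
  exact: le_trans (running_min_le f x kn) fk.
have mh n : measurable_fun `]a, b] (h n).
  apply: subspace_continuous_measurable_fun => //.
  by apply: continuous_in_subspaceT => x; rewrite inE/= => /sub; exact: ch.
have ms : measurable_fun `]a, b] s.
  by apply: (measurable_fun_cvg mh) => x /sub; exact: cvh.
split; first exact/measurable_EFinP.
have Dh n : (D a b <= \int[mu]_(x in `]a, b]) (h n x)%:E)%E.
  apply: quasi_metric_le_integral => //.
  - by move=> x xab; apply: ch.
  - by move=> x xab; rewrite (le_trans (s0 x xab))// sh.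
  move=> x eps xab eps0; rewrite /h; have [k ->] := running_min_attained f n x.
  exact: Dloc.
have ih : mu.-integrable `]a, b] (EFin \o h 0%N).
  have ic : mu.-integrable `[a, b] (EFin \o h 0%N).
    apply: continuous_compact_integrable; first exact: segment_compact.
    by apply: continuous_in_subspaceT => x; rewrite inE/= in_itv/= => /(ch 0%N).
  apply: integrableS ic => //.
have mEh n : measurable_fun `]a, b] (EFin \o h n) by exact/measurable_EFinP.
have mEs : measurable_fun `]a, b] (EFin \o s) by exact/measurable_EFinP.
have cE : {ae mu, forall x, `]a, b]%classic x -> (fun n => (EFin \o h n) x) @ \oo --> (EFin \o s) x}.
  apply: aeW => x /sub xab; apply: cvg_EFin; last exact: cvh.
  by apply: nearW => n.
have bE : {ae mu, forall x n, `]a, b]%classic x ->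
    (`|(EFin \o h n) x| <= (EFin \o h 0%N) x)%E}.
  apply: aeW => x n /sub xab; rewrite /= lee_fin ger0_norm.
    exact: (running_min_le f x (leq0n n)).
  by rewrite (le_trans (s0 _ xab))// sh.
have [_ _ cvi] := @dominated_convergence _ _ _ mu `]a, b]
  (measurable_itv _) (fun n => EFin \o h n) (EFin \o s) (EFin \o h 0%N) mEh mEs cE ih bE.
by apply: (cvge_ge _ cvi); near=> n; exact: Dh.
Unshelve. all: by end_near. Qed.

End InfimumOfSpeeds.

(** * Infinitesimal behaviour of the Riemannian distance *)

Lemma interval_limit_point (R : realType) (A : set R) (a b t : R) :
  is_interval A -> A a -> A b -> a < b -> A t -> limit_point A t.
Proof.
move=> iA Aa Ab ab At U /nbhs_ballP[e /= e0 eU].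
have e20 : 0 < e / 2 by rewrite divr_gt0.
have ee : e / 2 < e by rewrite ltr_pdivrMr// mulrDr mulr1 ltrDl.
have [tb|bt] := ltP t b.
  exists (Num.min b (t + e / 2)).
  have ty : t < Num.min b (t + e / 2) by rewrite lt_min tb ltrDl.
  split; first by rewrite gt_eqF.
    by apply: (iA t b) => //; rewrite (ltW ty) ge_min lexx.
  apply: eU; rewrite -ball_normE/= ltr0_norm ?subr_lt0// opprB ltrBlDl.
  by rewrite gt_min ltrD2l ee orbT.
have ta := lt_le_trans ab bt.
exists (Num.max a (t - e / 2)).
have ty : Num.max a (t - e / 2) < t by rewrite gt_max ta ltrBlDr ltrDl.
split; first by rewrite lt_eqF.
  by apply: (iA a t) => //; rewrite (ltW ty) le_max lexx.
apply: eU; rewrite -ball_normE/= gtr0_norm ?subr_gt0// ltrBlDr -ltrBlDl.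
by rewrite lt_max ltrD2l ltrN2 ee orbT.
Qed.

Lemma limit_point_itvcc (R : realType) (a b t : R) : a < b ->
  `[a, b]%classic t -> limit_point `[a, b]%classic t.
Proof.
move=> ab; apply: (interval_limit_point (a := a) (b := b)) => //.
- exact: interval_is_interval.
- by rewrite /= in_itv/= lexx ltW.
- by rewrite /= in_itv/= lexx ltW.
Qed.

Lemma limit_pointI_open (R : realType) (A O : set R) (t : R) : limit_point A t ->
  open O -> O t -> limit_point (A `&` O) t.
Proof.
move=> lA oO Ot U Ut; have [|y [yt Ay [Uy Oy]]] := lA (U `&` O).
  by apply: filterI => //; exact: open_nbhs_nbhs.
by exists y.
Qed.

Lemma increment_difference (V : zmodType) (a b u y z : V) :
  z - y = (b - a) + ((z - u - b) - (y - u - a)).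
Proof.
have -> : (z - u - b) - (y - u - a) = (z - y) - (b - a).
  rewrite opprB [a - _]addrC addrACA opprB subrKA.
  by rewrite opprB [- b + a]addrC.
by rewrite [RHS]addrC subrK.
Qed.

(** The arithmetic of dist_curves: E is the error in the coordinates, r the
    elapsed time, K and V the norms of the relative velocity for the metric and
    in coordinates. *)
Lemma error_bound (R : realType) (C V K eta eps r E : R) :
  0 <= r -> 0 <= C -> 0 <= eta <= 1 -> eta * (2 * C + V + 2) <= eps ->
  E <= 2 * eta * r ->
  r * K + C * E + eta * (r * V + E) <= (K + eps) * r.
Proof.
move=> r0 C0 /andP[eta0 eta1] H HE.
have h1 : C * E <= C * (2 * eta * r) by rewrite ler_wpM2l.
have h2 : eta * E <= 1 * (2 * eta * r).
  by rewrite (le_trans (y := eta * (2 * eta * r)))// ?ler_wpM2l// ler_wpM2r// !mulr_ge0.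
have h3 : eta * (2 * C + V + 2) * r <= eps * r by rewrite ler_wpM2r.
lra.
Qed.

Section RiemannianDistance.
Variables (R : realType) (n : nat) (M : manifold R n) (g : metric M).

Lemma curve_length_ge0 (c : R -> M) : (0 <= curve_length g c)%E.
Proof. by apply: integral_ge0 => t _; rewrite lee_fin tnorm_ge0. Qed.

Lemma riemannian_dist_ge0 x y : (0 <= riemannian_dist g x y)%E.
Proof. by apply: le_ereal_inf_tmp => _ [c [_ _ _ ->]]; exact: curve_length_ge0. Qed.

(** The straight segment of the chart competes in the infimum, and near u its
    speed is the norm of z - y for the metric at u up to a small relative
    error. *)
Lemma chart_dist q (u : 'rV[R]_n) (eps : R) : mrange q u -> (0 < eps)%R ->
  exists2 d, (0 < d)%R & forall y z, ball u d y -> ball u d z ->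
    connected_component [set: M] (mchartV q y) (mchartV q z) /\
    (riemannian_dist g (mchartV q y) (mchartV q z) <=
      (coord_norm g q u (z - y) + eps * `|z - y|)%:E)%E.
Proof.
move=> qu eps0; have /nbhs_ballP[d /= d0 H] := coord_norm_near g qu eps0.
exists d => // y z uy uz.
pose c (t : R) := mchartV q (t *: (z - y) + y).
have inball t : (0 <= t <= 1)%R -> ball u d (t *: (z - y) + y).
  move=> /andP[t0 t1]; move: uy uz; rewrite -ball_normE/= => uy uz.
  have -> : (u - (t *: (z - y) + y) = (1 - t) *: (u - y) + t *: (u - z))%R.
    rewrite !scalerBr scalerBl !scale1r !scalerBl.
    by apply/rowP => i; rewrite !mxE; ring.
  rewrite (le_lt_trans (ler_normD _ _))// !normrZ ger0_norm ?subr_ge0//.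
  rewrite (ger0_norm t0).
  have [->|tn0] := eqVneq t 0%R; first by rewrite subr0 mul1r mul0r addr0.
  have tp : (0 < t)%R by rewrite lt_neqAle eq_sym tn0.
  have : (t * `|u - z| < t * d)%R by rewrite ltr_pM2l.
  have : ((1 - t) * `|u - y| <= (1 - t) * d)%R by rewrite ler_wpM2l ?subr_ge0// ltW.
  lra.
pose O : set R^o := (fun t : R^o => t *: (z - y) + y)%R @^-1` (ball u d)^°.
have lc : continuous (fun s : R^o => s *: (z - y) + y)%R.
  by move=> s; have [+ _] := Ck_line 0 setT (z - y) y; apply.
have oO : open O by apply: open_comp => [s _|]; [exact: lc|exact: open_interior].
have OI t : (0 <= t <= 1)%R -> O t.
  move=> /inball bt; rewrite /O /preimage/=.
  have -> : (ball u d)^° = ball u d by apply/interior_id; exact: ball_open.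
  exact: bt.
have Oran t : O t -> mrange q (t *: (z - y) + y).
  by move=> /interior_subset/H[].
have sc : smooth_into O c by exact: smooth_into_chart_line.
have scI : smooth_curve `[0%R, 1%R] c.
  move=> t /=; rewrite in_itv/= => /OI Ot; exists O, c; split => //.
have cc t : O t -> {for t, continuous c} by have [+ _] := sc; exact.
have c0 : c 0%R = mchartV q y by rewrite /c scale0r add0r.
have c1 : c 1%R = mchartV q z by rewrite /c scale1r subrK.
split.
  exists (c @` `[0%R, 1%R]).
    split=> //; first by exists 0%R => //=; rewrite in_itv/= lexx ler01.
    apply: connected_continuous_connected; first exact: segment_connected.
    apply: continuous_in_subspaceT => t; rewrite inE/= in_itv/= => /OI.
    exact: cc.
  by exists 1%R => //=; rewrite in_itv/= lexx ler01.
apply: (@le_trans _ _ (curve_length g c)).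
  apply: ereal_inf_lbound; exists c; split => //.
  exists 1%N, (fun i => i%:R); split => //.
  - by move=> i _; rewrite ltr_nat.
  - by move=> [|//] _; exact: scI.
set K := (coord_norm g q u _ + _)%R.
apply: (@le_trans _ _ (\int[lebesgue_measure]_(t in `[0%R, 1%R]) (cst K%:E) t)%E).
  apply: ge0_integral_monotone.
  - by move=> t _; rewrite lee_fin tnorm_ge0.
  - move=> t _; rewrite lee_fin addr_ge0 ?coord_norm_ge0// mulr_ge0//; exact: ltW.
  move=> t /= t01; split => //; rewrite in_itv/= in t01.
  have Ot := OI t t01; have [rt /(_ (z - y)%R) nt] := H _ (inball t t01).
  have t01' : (`[0, 1]%classic : set R) t by rewrite /= in_itv.
  have lt := limit_point_itvcc (@ltr01 R) t01'.
  rewrite (velocity_vel oO Ot sc (fun s _ _ => erefl (c s)) t01' lt).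
  rewrite (vel_chart_line rt) lee_fin; exact: nt.
rewrite integral_cst//= lebesgue_measure_itv/= lte_fin ltr01 oppr0 adde0 mule1.
by [].
Qed.

Lemma coord_norm_center q v : coord_norm g q (mchart q q) v = tnorm g q v.
Proof.
rewrite /coord_norm mchartK; last exact: mdom_center.
rewrite coord_vectorE; last exact: mdom_center.
by rewrite derive_local_map_id//; exact: mdom_center.
Qed.

(** To first order the coordinates of the two curves differ by the elapsed time
    multiplied by the difference of velocities, and the distance of nearby
    points is comparable to the norm of the difference of their coordinates. *)
Lemma dist_curves (al be : R -> M) (O : set R) (t0 eps : R) : open O -> O t0 ->
  smooth_into (V := R^o) O al -> smooth_into (V := R^o) O be ->
  al t0 = be t0 -> (0 < eps)%R ->
  exists2 e, (0 < e)%R & forall t, (`|t - t0| < e)%R ->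
    connected_component [set: M] (al t) (be t) /\
    (riemannian_dist g (al t) (be t) <=
     ((tnorm g (al t0) (vel be t0 - vel al t0) + eps) * `|t - t0|)%:E)%E.
Proof.
move=> oO Ot sa sb ab eps0; set q := al t0; pose u := mchart q q.
have qa : mdom q (al t0) by exact: mdom_center.
have qb : mdom q (be t0) by rewrite -ab.
have qu : mrange q u by exact/mrange_chart/mdom_center.
have [C C0 HC] := coord_norm_bounded g qu.
set v := (vel be t0 - vel al t0)%R.
pose eta := Num.min 1%R (eps / (2 * C + `|v| + 2))%R.
have D0 : (0 < 2 * C + `|v| + 2)%R by rewrite ltr_pwDr// addr_ge0// mulr_ge0// ltW.
have eta0 : (0 < eta)%R by rewrite lt_min ltr01 divr_gt0.
have eta1 : (eta <= 1)%R by rewrite ge_min lexx.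
have etae : (eta * (2 * C + `|v| + 2) <= eps)%R.
  by rewrite -ler_pdivlMr// ge_min lexx orbT.
have [d d0 Hd] := chart_dist qu eta0.
have [e1 e10 H1] := derivable_approx (curve_derivable sa Ot qa) eta0.
have [e2 e20 H2] := derivable_approx (curve_derivable sb Ot qb) eta0.
have vb : vel be t0 = 'D_1 (mchart q \o be : R^o -> 'rV[R]_n) t0 by rewrite /vel -ab.
have va : vel al t0 = 'D_1 (mchart q \o al : R^o -> 'rV[R]_n) t0 by [].
have near (c : R -> M) : smooth_into (V := R^o) O c -> c t0 = q ->
    \forall t \near t0, mdom q (c t) /\ ball u d (mchart q (c t)).
  move=> sc ct0; have qc : mdom q (c t0) by rewrite ct0; exact: mdom_center.
  apply: filterI.
    by apply: filterS (curve_near_dom oO sc Ot qc) => t [].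
  apply: (chart_curve_continuous sc Ot qc); rewrite /= ct0.
  exact: nbhsx_ballx.
have /nbhs_ballP[e3 /= e30 H3] := near _ sa erefl.
have /nbhs_ballP[e4 /= e40 H4] := near _ sb (esym ab).
exists (Num.min (Num.min e1 e2) (Num.min e3 e4)).
  by rewrite !lt_min e10 e20 e30.
move=> t; rewrite !lt_min => /andP[/andP[te1 te2] /andP[te3 te4]].
have [da ba] : mdom q (al t) /\ ball u d (mchart q (al t)).
  by apply: H3; rewrite -ball_normE/= distrC.
have [db bb] : mdom q (be t) /\ ball u d (mchart q (be t)).
  by apply: H4; rewrite -ball_normE/= distrC.
have := Hd _ _ ba bb; rewrite (mchartK da) (mchartK db) => -[cc dd].
split; first exact: cc.
apply: le_trans dd _; rewrite lee_fin -coord_norm_center -/u.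
have := H1 _ te1; have := H2 _ te2.
rewrite [(t - t0) *: 1%R]mulr1 subrK/= -vb -va -ab -/q -/u => {}H2 {}H1.
set z := mchart q (be t) in H2 *; set y := mchart q (al t) in H1 *.
pose er := ((z - u - (t - t0) *: vel be t0) - (y - u - (t - t0) *: vel al t0))%R.
have zy : (z - y = (t - t0) *: v + er)%R.
  by rewrite /er /v scalerBr; exact: increment_difference.
have er1 : (`|er| <= 2 * eta * `|t - t0|)%R.
  apply: le_trans (ler_normB _ _) _; apply: le_trans (lerD H2 H1) _.
  by rewrite -mulrDl -mulr2n mulr_natl.
rewrite zy; set r := `|t - t0| in er1 *.
have n1 : (coord_norm g q u ((t - t0) *: v + er) <= r * coord_norm g q u v + C * `|er|)%R.
  apply: le_trans (ler_coord_normD g _ _ qu) _.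
  by rewrite (coord_normZ g _ _ qu) lerD2l.
have n2 : (`|(t - t0) *: v + er| <= r * `|v| + `|er|)%R.
  by apply: le_trans (ler_normD _ _) _; rewrite normrZ.
have r0 : (0 <= r)%R by exact: normr_ge0.
apply: le_trans (error_bound _ r0 (ltW C0) _ etae er1); last first.
  by rewrite (ltW eta0).
by apply: lerD => //; rewrite ler_wpM2l// ltW.
Qed.

End RiemannianDistance.

(** * The normal pseudo-distance along a curve *)

Section NormalDistance.
Variables (R : realType) (G : lie_groupoid R) (eta0 : metric (Ob G)).
Local Open Scope ereal_scope.

Lemma same_orbit_refl (x : Ob G) : same_orbit x x.
Proof. by exists (unit G x); split; [exact: src_unit|exact: tgt_unit]. Qed.

Lemma same_orbit_sym (x y : Ob G) : same_orbit x y -> same_orbit y x.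
Proof.
by move=> [g [gx gy]]; exists (inv G g); split; [rewrite -gy; exact: src_inv|
  rewrite -gx; exact: tgt_inv].
Qed.

Lemma same_orbit_trans (x y z : Ob G) : same_orbit x y -> same_orbit y z ->
  same_orbit x z.
Proof.
move=> /asboolP xy /asboolP yz; apply/asboolP; exact: (orbit_rel_trans xy yz).
Qed.

Lemma le_ereal_infD (S T : set (\bar R)) (d : \bar R) :
  (forall l, S l -> 0 <= l) -> (forall l, T l -> 0 <= l) ->
  (forall l l', S l -> T l' -> d <= l + l') -> d <= ereal_inf S + ereal_inf T.
Proof.
move=> S0 T0 H.
have s0 : 0 <= ereal_inf S by exact: le_ereal_inf_tmp.
have t0 : 0 <= ereal_inf T by exact: le_ereal_inf_tmp.
have [->|sfin] := eqVneq (ereal_inf S) +oo.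
  by rewrite addye ?leey// gt_eqF// (lt_le_trans _ t0)// ltNyr.
have [->|tfin] := eqVneq (ereal_inf T) +oo.
  by rewrite addey ?leey// gt_eqF// (lt_le_trans _ s0)// ltNyr.
have fs : ereal_inf S \is a fin_num by rewrite ge0_fin_numE// ltey.
have ft : ereal_inf T \is a fin_num by rewrite ge0_fin_numE// ltey.
apply/lee_addgt0Pr => e e0; have e2 : (0 < e / 2)%R by rewrite divr_gt0.
have [l Sl ls] := lb_ereal_inf_adherent e2 fs.
have [l' Tl' lt'] := lb_ereal_inf_adherent e2 ft.
apply: le_trans (H _ _ Sl Tl') _; apply: le_trans (leeD (ltW ls) (ltW lt')) _.
by rewrite addeACA -EFinD -splitr.
Qed.

(** Chains are concatenated: the last jump of the first chain and the first
    jump of the second one stay in the same orbit and form a single jump. *)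
Lemma normal_dist_triangle x y z :
  normal_dist eta0 x z <= normal_dist eta0 x y + normal_dist eta0 y z.
Proof.
apply: le_ereal_infD.
- move=> _ [n [c [_ ->]]]; apply: sume_ge0 => i _; exact: riemannian_dist_ge0.
- move=> _ [n [c [_ ->]]]; apply: sume_ge0 => i _; exact: riemannian_dist_ge0.
move=> _ _ [n [c [[c0 cn corb ccon] ->]]] [m [c' [[c'0 c'm c'orb c'con] ->]]].
(* The index 2 n carries the last point of c before its final jump; the first
   point of c' is dropped. *)
pose e j := if (j <= 2 * n)%N then c j else c' (j - 2 * n)%N.
have e1 j : (j <= 2 * n)%N -> e j = c j by rewrite /e => ->.
have e2 j : (0 < j)%N -> e (2 * n + j)%N = c' j.
  by move=> j0; rewrite /e leqNgt -{1}[(2 * n)%N]addn0 ltn_add2l j0 /= addKn.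
apply: ereal_inf_lbound; exists (n + m)%N, e; split; last first.
  rewrite [RHS](big_cat_nat (n := n.+1))//=; last by lia.
  congr (_ + _).
    apply: eq_big_nat => i /andP[i1 i2]; rewrite !e1//; lia.
  rewrite -[n.+1]add1n big_addn.
  have -> : ((n + m).+1 - n = m.+1)%N by lia.
  apply: eq_big_nat => i /andP[i1 i2].
  have -> : (2 * (i + n) - 1 = 2 * n + (2 * i - 1))%N by lia.
  have -> : (2 * (i + n) = 2 * n + 2 * i)%N by lia.
  by rewrite !e2//; lia.
split.
- by rewrite e1.
- have -> : (2 * (n + m) + 1 = 2 * n + (2 * m + 1))%N by lia.
  by rewrite e2// addn1.
- move=> i inm; have [ilt|ige] := ltnP i n.
    by rewrite !e1; [apply: corb; lia|lia|lia].
  have [->|ine] := eqVneq i n.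
    rewrite e1// e2//; apply: (@same_orbit_trans _ y).
      by rewrite -cn; exact: corb.
    by rewrite -c'0; exact: (c'orb 0%N (leq0n m)).
  have -> : (2 * i + 1 = 2 * n + (2 * (i - n) + 1))%N by lia.
  have -> : (2 * i = 2 * n + 2 * (i - n))%N by lia.
  by rewrite !e2; [apply: c'orb; lia|lia|lia].
- move=> i /andP[i1 inm]; have [ilt|ige] := leqP i n.
    by rewrite !e1; [apply: ccon; rewrite i1|lia|lia].
  have -> : (2 * i - 1 = 2 * n + (2 * (i - n) - 1))%N by lia.
  have -> : (2 * i = 2 * n + 2 * (i - n))%N by lia.
  by rewrite !e2; [apply: c'con; lia|lia|lia].
Qed.

Lemma normal_dist_orbit x y : same_orbit x y -> normal_dist eta0 x y <= 0.
Proof.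
move=> xy; apply: ereal_inf_lbound; exists 0%N, (fun j => if j is 0%N then x else y).
split; last by rewrite big_geq.
split=> // i; first by rewrite leqn0 => /eqP ->.
by case: i.
Qed.

Lemma normal_dist_riemannian x y : connected_component [set: Ob G] x y ->
  normal_dist eta0 x y <= riemannian_dist eta0 x y.
Proof.
move=> xy; apply: ereal_inf_lbound.
exists 1%N, (fun j => if (j <= 1)%N then x else y); split; last by rewrite big_nat1.
split=> // i.
- by case: i => [|[|//]] _; exact: same_orbit_refl.
- by case: i => [|[|//]].
Qed.

(** To compare nearby points of c, move along the target of an arrow of
    direction w, jump to its source within an orbit, and return to c. *)
Lemma normal_dist_infinitesimal (c : R -> Ob G) (O : set R) (t0 eps : R)
    (w : 'rV[R]_(dim1 G)) : open O -> O t0 -> smooth_into (V := R^o) O c ->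
  (0 < eps)%R ->
  let sp := (tnorm eta0 (c t0) (vel c t0 - diff_at (@source R G) (unit G (c t0)) w) +
             tnorm eta0 (c t0) (diff_at (@target R G) (unit G (c t0)) w))%R in
  exists2 e, (0 < e)%R & forall t, (`|t - t0| < e)%R ->
    (normal_dist eta0 (c t0) (c t) <= ((sp + eps) * `|t - t0|)%:E) /\
    (normal_dist eta0 (c t) (c t0) <= ((sp + eps) * `|t - t0|)%:E).
Proof.
move=> oO Ot sc eps0 sp; pose p : Ar G := unit G (c t0).
pose u := (mchart p p - t0 *: w)%R.
have up : (t0 *: w + u = mchart p p)%R by rewrite addrC subrK.
have mp : mrange p (t0 *: w + u)%R by rewrite up; exact/mrange_chart/mdom_center.
pose h (t : R) : Ar G := mchartV p (t *: w + u)%R.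
have ht0 : h t0 = p by rewrite /h up mchartK//; exact: mdom_center.
pose O' : set R^o := O `&` (fun s : R^o => s *: w + u)%R @^-1` mrange p.
have lc (s : R^o) : {for s, continuous (fun s : R^o => s *: w + u)%R}.
  by have [+ _] := Ck_line 0 setT w u; apply.
have oO' : open O' by apply: open_setI_preimage => [//||s _]; [exact: mrange_open|exact: lc].
have Ot' : O' t0 by split.
have sh : smooth_into O' h by apply: smooth_into_chart_line => // s [].
have sc' : smooth_into (V := R^o) O' c by apply: smooth_into_subset sc => s [].
have sS : smooth_into O' (@source R G \o h) by exact: (smooth_map_into (@source_smooth R G)).
have sT : smooth_into O' (@target R G \o h) by exact: (smooth_map_into (@target_smooth R G)).
have vh : vel h t0 = w.
  rewrite (vel_chart_line mp) up coord_vectorE; last exact: mdom_center.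
  by rewrite derive_local_map_id//; exact: mdom_center.
have S0 : (@source R G \o h) t0 = c t0 by rewrite /= ht0; exact: src_unit.
have T0 : (@target R G \o h) t0 = c t0 by rewrite /= ht0; exact: tgt_unit.
have vS : vel (@source R G \o h) t0 = diff_at (@source R G) p w.
  by rewrite (vel_comp oO' sh Ot' (@source_smooth R G)) vh ht0.
have vT : vel (@target R G \o h) t0 = diff_at (@target R G) p w.
  by rewrite (vel_comp oO' sh Ot' (@target_smooth R G)) vh ht0.
have sk : smooth_into (V := R^o) O' (fun=> c t0) by exact: smooth_into_cst.
have e2 : (0 < eps / 2)%R by rewrite divr_gt0.
have [d1 d10 H1] := dist_curves eta0 oO' Ot' sk sT (esym T0) e2.
have [d2 d20 H2] := dist_curves eta0 oO' Ot' sS sc' S0 e2.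
have [d3 d30 H3] := dist_curves eta0 oO' Ot' sT sk T0 e2.
have [d4 d40 H4] := dist_curves eta0 oO' Ot' sc' sS (esym S0) e2.
exists (Num.min (Num.min d1 d2) (Num.min d3 d4)).
  by rewrite !lt_min d10 d20 d30.
move=> t; rewrite !lt_min => /andP[/andP[t1 t2] /andP[t3 t4]].
have orb : same_orbit (@source R G (h t)) (@target R G (h t)) by exists (h t).
have E : ((sp + eps) * `|t - t0|)%:E =
   ((tnorm eta0 (c t0) (vel c t0 - diff_at (@source R G) p w) + eps / 2) * `|t - t0|)%:E +
   ((tnorm eta0 (c t0) (diff_at (@target R G) p w) + eps / 2) * `|t - t0|)%:E.
  by rewrite -EFinD -mulrDl [in RHS]addrACA -splitr.
have [C1 D1] := H1 _ t1; have [C2 D2] := H2 _ t2.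
have [C3 D3] := H3 _ t3; have [C4 D4] := H4 _ t4.
rewrite vT vel_cst subr0 in D1; rewrite vS S0 in D2.
rewrite vT vel_cst sub0r T0 tnormN in D3.
rewrite vS -opprB tnormN in D4.
split; rewrite E.
  apply: le_trans (normal_dist_triangle _ (@target R G (h t)) _) _; rewrite addeC.
  apply: leeD; last exact: le_trans (normal_dist_riemannian C1) D1.
  apply: le_trans (normal_dist_triangle _ (@source R G (h t)) _) _.
  rewrite -[leRHS]add0e; apply: leeD.
    exact/normal_dist_orbit/same_orbit_sym.
  exact: le_trans (normal_dist_riemannian C2) D2.
apply: le_trans (normal_dist_triangle _ (@source R G (h t)) _) _.
apply: leeD; first exact: le_trans (normal_dist_riemannian C4) D4.
apply: le_trans (normal_dist_triangle _ (@target R G (h t)) _) _.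
rewrite -[leRHS]add0e; apply: leeD; first exact: normal_dist_orbit.
exact: le_trans (normal_dist_riemannian C3) D3.
Qed.

End NormalDistance.

Lemma dense_rational_rV (R : realType) n : exists q : nat -> 'rV[R]_n,
  forall w e, 0 < e -> exists k, ball w e (q k).
Proof.
exists (fun k => if unpickle k is Some v then map_mx ratr (v : 'rV[rat]_n) else 0).
move=> w e e0.
have H i : exists r : rat, ratr r \in `]w 0 i, w 0 i + e[.
  by apply: rat_in_itvoo; rewrite ltrDl.
exists (pickle (\row_i sval (cid (H i)))); rewrite pickleK.
split=> // i j; rewrite !mxE ord1; case: cid => r /=; rewrite in_itv/= => /andP[r1 r2].
by rewrite /ball/= ltr0_norm ?subr_lt0// opprB ltrBlDl.
Qed.

Section LocalLength.
Variables (R : realType) (G : lie_groupoid R).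
Variables (eta2 : metric (Pairs G)) (eta1 : metric (Ar G)) (eta0 : metric (Ob G)).
Hypothesis (Heta : groupoid_metric eta2) (Hind : induced_metrics eta2 eta1 eta0).

Notation mu := (@lebesgue_measure R).
Notation sr := (@source R G).
Notation tg := (@target R G).

Let srS : smooth_map sr. Proof. exact: source_smooth. Qed.
Let tgS : smooth_map tg. Proof. exact: target_smooth. Qed.
Let un : Ob G -> Ar G := unit G.
Let unS : smooth_map un. Proof. exact: unit_smooth. Qed.
Let sr_un x : sr (un x) = x. Proof. exact: src_unit. Qed.
Let tg_un x : tg (un x) = x. Proof. exact: tgt_unit. Qed.

Variables (c : R -> Ob G) (O : set R) (t0 : R).
Hypotheses (oO : open O) (Ot0 : O t0) (sc : smooth_into (V := R^o) O c).

Let q := c t0.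
Let p := un (c t0).

Definition normal_speed (t : R) := normal_norm eta0 (c t) (vel c t).

(** In fixed charts of objects and arrows, the cost of splitting the velocity
    by the arrow direction of constant coordinates w is continuous in time. *)
Let psi (w : 'rV[R]_(dim1 G)) (t : R) : R :=
  coord_norm eta0 q (mchart q (c t))
    ('D_1 (mchart q \o c : R^o -> 'rV[R]_(dim0 G)) t -
     'D_w (local_map sr p q) (mchart p (un (c t)))) +
  coord_norm eta0 q (mchart q (c t))
    ('D_w (local_map tg p q) (mchart p (un (c t)))).

Let J t := [/\ O t, mdom q (c t) & mdom p (un (c t))].

Let near_J : \forall t \near t0, J t.
Proof.
have q0 : mdom q (c t0) by exact: mdom_center.
have p0 : mdom p ((un \o c) t0) by exact: mdom_center.
have sun : smooth_into (V := R^o) O (un \o c) by exact: (smooth_map_into unS).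
have H1 := curve_near_dom oO sc Ot0 q0; have H2 := curve_near_dom oO sun Ot0 p0.
by apply: filterS2 H1 H2 => t [Ot qt] [_ pt]; split.
Qed.

Let psiE w t : J t ->
  psi w t = tnorm eta0 (c t) (vel c t -
                diff_at sr (un (c t)) (coord_vector p w (mchart p (un (c t))))) +
            tnorm eta0 (c t)
                (diff_at tg (un (c t)) (coord_vector p w (mchart p (un (c t))))).
Proof.
move=> [Ot qt pt]; have qs : mdom q (sr (un (c t))) by rewrite sr_un.
have qtg : mdom q (tg (un (c t))) by rewrite tg_un.
rewrite (diff_at_coord_vector w srS pt qs) (diff_at_coord_vector w tgS pt qtg).
rewrite sr_un tg_un (vel_coord oO sc Ot qt).
have lin := coord_vector_linear (mrange_chart qt).
by rewrite -(linearB_eq _ _ lin) /psi /coord_norm mchartK.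
Qed.

Let psi_continuous w t : J t -> {for t, continuous (psi w)}.
Proof.
move=> [Ot qt pt]; have sun : smooth_into (V := R^o) O (un \o c).
  exact: (smooth_map_into unS).
have cV := chart_curve_continuous sc Ot qt.
have cV' := curve_derive_continuous sc Ot qt.
have cU := chart_curve_continuous (p := p) sun Ot pt.
have mr := mrange_chart qt.
have cD (f : Ar G -> Ob G) : smooth_map f -> mdom q (f (un (c t))) ->
    {for t, continuous (fun s => 'D_w (local_map f p q) (mchart p (un (c s))))}.
  move=> sf qf; apply: (@continuous_comp _ _ _ (mchart p \o (un \o c))
    (fun u => 'D_w (local_map f p q) u)); first exact: cU.
  have [_ /(_ w)[_ [+ _]]] := local_map_smooth p q sf 1%N; apply.
  exact: local_map_dom_chart.
have cS : {for t, continuous (fun s => 'D_w (local_map sr p q) (mchart p (un (c s))))}.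
  by apply: cD => //; rewrite sr_un.
have cT : {for t, continuous (fun s => 'D_w (local_map tg p q) (mchart p (un (c s))))}.
  by apply: cD => //; rewrite tg_un.
apply: cvgD.
  apply: (@coord_norm_cvg R _ _ eta0 R (nbhs t) _ (mchart q \o c) (fun s =>
    'D_1 (mchart q \o c : R^o -> 'rV[R]_(dim0 G)) s -
     'D_w (local_map sr p q) (mchart p (un (c s)))) _ _ _ mr cV).
  exact: (cvgB cV' cS).
exact: (@coord_norm_cvg R _ _ eta0 R (nbhs t) _ (mchart q \o c) (fun s =>
  'D_w (local_map tg p q) (mchart p (un (c s)))) _ _ _ mr cV cT).
Qed.

Let psi_continuous_dir t w : J t -> {for w, continuous (psi ^~ t)}.
Proof.
move=> [Ot qt pt]; have mr := mrange_chart qt.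
have cD (f : Ar G -> Ob G) : smooth_map f -> mdom q (f (un (c t))) ->
    {for w, continuous (fun w => 'D_w (local_map f p q) (mchart p (un (c t))))}.
  move=> sf qf; have df : differentiable (local_map f p q) (mchart p (un (c t))).
    by apply: (local_map_differentiable sf); exact: local_map_dom_chart.
  have -> : (fun w => 'D_w (local_map f p q) (mchart p (un (c t)))) =
      'd (local_map f p q) (mchart p (un (c t))) :> (_ -> _).
    by apply/funext => z; exact: deriveE.
  exact: (diff_continuous df).
have cS := cD _ srS; have cT := cD _ tgS.
rewrite sr_un in cS; rewrite tg_un in cT.
have fw := nbhs_filter w.
apply: (@cvgD _ _ _ (nbhs w) fw).
- apply: (@coord_norm_cvg R _ _ eta0 _ (nbhs w) fw (fun=> mchart q (c t)) (fun z =>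
    'D_1 (mchart q \o c : R^o -> 'rV[R]_(dim0 G)) t -
     'D_z (local_map sr p q) (mchart p (un (c t)))) _ _ _ mr (@cvg_cst _ _ _ _ fw)).
  exact: (@cvgB _ _ _ (nbhs w) fw _ _ _ _ (@cvg_cst _ _ _ _ fw) (cS qt)).
- exact: (@coord_norm_cvg R _ _ eta0 _ (nbhs w) fw (fun=> mchart q (c t)) (fun z =>
    'D_z (local_map tg p q) (mchart p (un (c t)))) _ _ _ mr (@cvg_cst _ _ _ _ fw) (cT qt)).
Qed.

(** The costs of a dense sequence of constant arrow directions have the normal
    speed as their infimum, because the cost is continuous in the direction and
    its minimum is attained. Each of them bounds the pseudo-distance
    infinitesimally. *)
Lemma normal_dist_le_normal_speed : exists2 e, 0 < e &
  (forall t, `|t - t0| < e -> O t) /\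
  forall a b, t0 - e < a -> a <= b -> b < t0 + e ->
    measurable_fun `]a, b] (EFin \o normal_speed) /\
    (normal_dist eta0 (c a) (c b) <= \int[mu]_(x in `]a, b]) (normal_speed x)%:E)%E /\
    (normal_dist eta0 (c b) (c a) <= \int[mu]_(x in `]a, b]) (normal_speed x)%:E)%E.
Proof.
have [d dense] := dense_rational_rV R (dim1 G).
have /nbhs_ballP[e /= e0 He] := near_J.
have eJ t : `|t - t0| < e -> J t by move=> te; apply: He; rewrite -ball_normE/= distrC.
exists e => //; split; first by move=> t /eJ[].
move=> a b ea ab be.
have inJ t : a <= t <= b -> J t.
  move=> /andP[at_ tb]; apply: eJ; rewrite ltr_norml; apply/andP; split; lra.
have key (D : R -> R -> \bar R) : (forall x y z, (D x z <= D x y + D y z)%E) ->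
    (forall k x eps, a <= x <= b -> 0 < eps -> exists2 r, 0 < r & forall t,
      `|t - x| < r -> (D x t <= ((psi (d k) x + eps) * `|t - x|)%:E)%E /\
                      (D t x <= ((psi (d k) x + eps) * `|t - x|)%:E)%E) ->
    measurable_fun `]a, b] (EFin \o normal_speed) /\
    (D a b <= \int[mu]_(x in `]a, b]) (normal_speed x)%:E)%E.
  move=> Dtri Dloc.
  apply: (@quasi_metric_le_integral_inf R D (fun k => psi (d k))) => //.
  - by move=> k x /inJ; exact: psi_continuous.
  - by move=> x _; exact: normal_norm_ge0.
  - move=> k x /inJ Jx; rewrite (psiE _ Jx).
    exact: (normal_norm_le_split Heta Hind).
  - move=> x eta /inJ Jx eta_gt0.
    have [w' [w1 w2]] := normal_norm_split_attained eta0 (c x) (vel c x).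
    have [Ox qx px] := Jx.
    have [w wE] := coord_vector_onto w' px.
    have psiw : psi w x = normal_speed x.
      by rewrite (psiE _ Jx) wE w1 w2 subrr tnorm0 add0r.
    have /cvgrPdist_le/(_ _ eta_gt0)/nbhs_ballP[r /= r0 Hr] := @psi_continuous_dir x w Jx.
    have [k wk] := dense w r r0; exists k.
    have {Hr wk}H : `|psi w x - psi (d k) x| <= eta := Hr _ wk.
    rewrite psiw in H; move: H; rewrite ler_norml => /andP[H _].
    by rewrite lerBrDr addrC lerBlDr in H.
have inf k x eps : a <= x <= b -> 0 < eps -> exists2 r, 0 < r & forall t,
    `|t - x| < r ->
    (normal_dist eta0 (c x) (c t) <= ((psi (d k) x + eps) * `|t - x|)%:E)%E /\
    (normal_dist eta0 (c t) (c x) <= ((psi (d k) x + eps) * `|t - x|)%:E)%E.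
  move=> /inJ Jx eps0; rewrite (psiE _ Jx); have [Ox _ _] := Jx.
  exact: normal_dist_infinitesimal oO Ox sc eps0.
have [|//|m d1] := key (fun s t => normal_dist eta0 (c s) (c t)).
  by move=> x y z; exact: normal_dist_triangle.
have [||_ d2] := key (fun s t => normal_dist eta0 (c t) (c s)).
- by move=> x y z; rewrite addeC; exact: normal_dist_triangle.
- move=> k x eps xab eps0; have [r r0 H] := inf k x eps xab eps0.
  by exists r => // t /H[].
by split.
Qed.

End LocalLength.

(** * Speed and length of a cocycle *)

Section CocycleSpeed.
Variables (R : realType) (G : lie_groupoid R).
Variables (eta2 : metric (Pairs G)) (eta1 : metric (Ar G)) (eta0 : metric (Ob G)).
Hypothesis (Heta : groupoid_metric eta2) (Hind : induced_metrics eta2 eta1 eta0).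

Notation sr := (@source R G).
Notation tg := (@target R G).

Lemma velocity_subset n (M : manifold R n) (A B : set R) (c : R -> M) t :
  smooth_curve A c -> B `<=` A -> B t -> limit_point B t ->
  velocity A c t = velocity B c t.
Proof.
move=> sc BA Bt lB; have [U [c' [oU Ut sc' cc']]] := sc t (BA t Bt).
have lA : limit_point A t by move=> V /lB[y [yt /BA Ay Vy]]; exists y.
rewrite (velocity_vel oU Ut sc' cc' (BA t Bt) lA).
by rewrite (velocity_vel oU Ut sc' (fun s Us Bs => cc' s Us (BA s Bs)) Bt lB).
Qed.

(** Along a smooth family of arrows the velocities of source and target are
    related by the action of arrows on normal vectors. *)
Lemma normal_norm_along_arrows (B : set R) (h : R -> Ar G) (P Q : R -> Ob G) t :
  B t -> limit_point B t -> smooth_curve B h ->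
  (forall s, B s -> sr (h s) = P s) -> (forall s, B s -> tg (h s) = Q s) ->
  normal_norm eta0 (P t) (velocity B P t) = normal_norm eta0 (Q t) (velocity B Q t).
Proof.
move=> Bt lB sh hP hQ; have [U [h' [oU Ut sh' hh']]] := sh t Bt.
have sS : smooth_into (V := R^o) U (sr \o h') by exact: (smooth_map_into (@source_smooth R G)).
have sT : smooth_into (V := R^o) U (tg \o h') by exact: (smooth_map_into (@target_smooth R G)).
have eP s : U s -> B s -> (sr \o h') s = P s by move=> Us Bs; rewrite /= hh'// hP.
have eQ s : U s -> B s -> (tg \o h') s = Q s by move=> Us Bs; rewrite /= hh'// hQ.
rewrite (velocity_vel oU Ut sS eP Bt lB) (velocity_vel oU Ut sT eQ Bt lB).
rewrite -(eP t Ut Bt) -(eQ t Ut Bt).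
rewrite (vel_comp oU sh' Ut (@source_smooth R G)) (vel_comp oU sh' Ut (@target_smooth R G)).
exact: (normal_norm_arrow Heta Hind).
Qed.

Variables (I : set R).
Hypothesis I_itv : real_interval I.

Lemma interval_limit t : I t -> limit_point I t.
Proof. by have [iI [a [b [Ia Ib ab]]]] := I_itv => It; apply: (@interval_limit_point _ I a b). Qed.

Lemma piece_sub (W : open_cover I) (i : index W) : piece i `<=` I.
Proof. by have [U _ ->] := piece_open i => t []. Qed.

(** Velocities relative to a set make sense at its limit points; a relatively
    open part of an interval with more than one point consists of limit points.
    *)
Lemma pieceI_limit (W W' : open_cover I) (i : index W) (j : index W') t :
  piece i t -> piece j t -> limit_point (piece i `&` piece j) t.
Proof.
move=> it jt; have It := piece_sub it; move: it jt.
have [U oU ->] := piece_open i; have [V oV ->] := piece_open j => -[_ Ut] [_ Vt].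
rewrite setIACA setIid; apply: limit_pointI_open; [exact: interval_limit| |by []].
exact: openI.
Qed.

Definition index_speed (a : cocycle G I) (i : index a) (t : R) : R :=
  normal_norm eta0 (point_of i t) (velocity (piece i) (point_of i) t).

Lemma index_speed_arrows (a b : cocycle G I) (i : index a) (j : index b)
    (B : set R) (h : R -> Ar G) t :
  B t -> limit_point B t -> B `<=` piece i `&` piece j -> smooth_curve B h ->
  (forall s, B s -> sr (h s) = point_of i s) ->
  (forall s, B s -> tg (h s) = point_of j s) ->
  index_speed i t = index_speed j t.
Proof.
move=> Bt lB BB sh hi hj; rewrite /index_speed.
have Bi : B `<=` piece i by move=> s /BB[].
have Bj : B `<=` piece j by move=> s /BB[].
rewrite (velocity_subset (@point_smooth _ _ _ _ i) Bi Bt lB).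
rewrite (velocity_subset (@point_smooth _ _ _ _ j) Bj Bt lB).
exact: (normal_norm_along_arrows Bt lB sh hi hj).
Qed.

(** The arrows of the cocycle relate the points of two indices, so the speed
    does not depend on the index. *)
Lemma cocycle_speedE (a : cocycle G I) (i : index a) t : piece i t ->
  cocycle_speed eta0 a t = index_speed i t.
Proof.
move=> it; rewrite /cocycle_speed; case: pselect => [e|[]]; last by exists i.
case: (cid e) => j jt /=.
apply: (@index_speed_arrows _ _ _ _ (piece j `&` piece i) (arrow_of i j)) => //.
- exact: pieceI_limit.
- exact: arrow_smooth.
- by move=> s [js is_]; exact: arrow_source.
- by move=> s [js is_]; exact: arrow_target.
Qed.

Lemma cocycle_equiv_refl (a : cocycle G I) : cocycle_equiv a a.
Proof.
exists a, id, id, (fun i => arrow_of i i); split=> //.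
- by move=> i; rewrite -{1}[piece i]setIid; exact: arrow_smooth.
- by move=> i t it; exact: arrow_source.
- by move=> i t it; exact: arrow_target.
- by move=> j i t it jt; rewrite !arrow_mul.
Qed.

Lemma cover_piece (W : open_cover I) t : I t -> exists i : index W, piece i t.
Proof.
move=> It; have [i _ it] : (\bigcup_i piece (o := W) i) t by rewrite piece_cover.
by exists i.
Qed.

Lemma equiv_speed (a b : cocycle G I) t : cocycle_equiv a b -> I t ->
  cocycle_speed eta0 a t = cocycle_speed eta0 b t.
Proof.
move=> [W [ra [rb [h [Wab sh hs ht _]]]]] It; have [i it] := cover_piece W It.
have [at_ bt] := Wab i t it.
rewrite (cocycle_speedE at_) (cocycle_speedE bt).
apply: (@index_speed_arrows _ _ _ _ (piece i) (h i)) => //; last first.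
- by move=> s; exact: ht.
- by move=> s; exact: hs.
by rewrite -[piece i]setIid; exact: pieceI_limit.
Qed.

Lemma point_same_orbit (a : cocycle G I) (i j : index a) t : piece i t -> piece j t ->
  same_orbit (point_of i t) (point_of j t).
Proof.
by move=> it jt; exists (arrow_of j i t); split; [exact: arrow_source|exact: arrow_target].
Qed.

Lemma orbit_classP (x y : Ob G) : orbit_class x = orbit_class y <-> same_orbit x y.
Proof.
split=> [xy|xy].
  by have /asboolP : orbit_equiv G x y by apply/eqmodP.
by apply/eqmodP/asboolP.
Qed.

Section OfCocycle.
Variable a : cocycle G I.

Definition stacky_of : stacky_curve G I :=
  {| cocycles := [set b | cocycle_equiv a b]; cocyclesP := ex_intro _ a erefl |}.

Lemma representative_equiv : cocycle_equiv (representative stacky_of) a.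
Proof.
rewrite /representative; case: cid => b /= ab.
suff : [set b' | cocycle_equiv b b'] a by [].
by rewrite -ab; exact: cocycle_equiv_refl.
Qed.

Lemma stacky_length_of :
  stacky_length eta0 stacky_of =
  (\int[lebesgue_measure]_(t in I) (cocycle_speed eta0 a t)%:E)%E.
Proof.
apply: eq_integral => t; rewrite inE => It; congr (_%:E).
exact: (equiv_speed representative_equiv).
Qed.

Lemma stacky_image_of (i : index a) t : piece i t ->
  stacky_image stacky_of (orbit_class (point_of i t)).
Proof.
move=> it; have [W [ra [rb [h [Wab _ hs ht _]]]]] := representative_equiv.
have [k kt] := cover_piece W (piece_sub it); have [at_ bt] := Wab k t kt.
exists (ra k), t; split => //; apply/orbit_classP.
apply: same_orbit_trans (point_same_orbit bt it).
by exists (h k t); split; [exact: hs|exact: ht].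
Qed.

End OfCocycle.

End CocycleSpeed.

(** * The pseudo-distance is at most the length of a stacky curve *)

Section LowerBound.
Variables (R : realType) (G : lie_groupoid R).
Variables (eta2 : metric (Pairs G)) (eta1 : metric (Ar G)) (eta0 : metric (Ob G)).
Hypothesis (Heta : groupoid_metric eta2) (Hind : induced_metrics eta2 eta1 eta0).
Variables (I : set R) (a : cocycle G I).
Hypothesis I_itv : real_interval I.

Notation mu := (@lebesgue_measure R).
Let sp : R -> R := cocycle_speed eta0 a.

Let sp_ge0 t : 0 <= sp t.
Proof.
rewrite /sp /cocycle_speed; case: pselect => // e; exact: normal_norm_ge0.
Qed.

Lemma normal_dist_same_orbit x x' y y' : same_orbit x x' -> same_orbit y y' ->
  (normal_dist eta0 x y <= normal_dist eta0 x' y')%E.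
Proof.
move=> xx yy; apply: le_trans (normal_dist_triangle eta0 x x' y) _.
rewrite -[leRHS]add0e; apply: leeD; first exact: normal_dist_orbit.
apply: le_trans (normal_dist_triangle eta0 x' y' y) _.
rewrite -[leRHS]adde0; apply: leeD => //.
exact/normal_dist_orbit/same_orbit_sym.
Qed.

(** Both orders of the arguments are recorded, as either point may come first
    on the curve. Measurability is carried along to add the integrals. *)
Let bound (s t : R) := measurable_fun `]s, t] (EFin \o sp) /\
  forall (i j : index a), piece i s -> piece j t ->
    (normal_dist eta0 (point_of i s) (point_of j t) <=
       \int[mu]_(x in `]s, t]) (sp x)%:E)%E /\
    (normal_dist eta0 (point_of j t) (point_of i s) <=
       \int[mu]_(x in `]s, t]) (sp x)%:E)%E.

Let bound_trans (s t u : R) : I t -> s <= t -> t <= u -> bound s t -> bound t u -> bound s u.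
Proof.
move=> It st tu [m1 H1] [m2 H2].
have [m12 E] := @integral_oc_split _ (fun x => (sp x)%:E) _ _ _ st tu m1 m2
  (fun x _ => sp_ge0 x).
split=> // i j is_ ju; have [k kt] := cover_piece a It.
have [h1 h1'] := H1 i k is_ kt; have [h2 h2'] := H2 k j kt ju; rewrite E.
split; first exact: le_trans (normal_dist_triangle eta0 _ (point_of k t) _) (leeD h1 h2).
rewrite addeC; exact: le_trans (normal_dist_triangle eta0 _ (point_of k t) _) (leeD h2' h1').
Qed.

(** Around a parameter of a piece the cocycle is a smooth curve of objects. *)
Let bound_local (t0 : R) : I t0 -> exists2 e, 0 < e & forall s t : R, I s -> I t ->
  t0 - e < s -> s <= t0 -> t0 <= t -> t < t0 + e -> bound s t.
Proof.
move=> It0; have [i it0] := cover_piece a It0.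
have [U [c [oU Ut0 sc cE]]] := point_smooth it0.
have [V oV VE] := piece_open i.
have UVI s : (U `&` V) s -> I s -> piece i s by move=> [_ Vs] Is; rewrite VE.
have oUV : open (U `&` V) by exact: openI.
have UVt0 : (U `&` V) t0 by split => //; move: it0; rewrite VE => -[].
have sc' : smooth_into (V := R^o) (U `&` V) c by apply: smooth_into_subset sc => s [].
have [e e0 [eU H]] := normal_dist_le_normal_speed Heta Hind oUV UVt0 sc'.
exists e => // s t Is It es st0 t0t te; have st := le_trans st0 t0t.
have near x : s <= x <= t -> (U `&` V) x.
  move=> /andP[sx xt]; apply: eU; rewrite ltr_norml; apply/andP; split.
    by rewrite ltrBrDl (lt_le_trans es).
  by rewrite ltrBlDl (le_lt_trans xt).
have [iI _] := I_itv.
have spE x : s <= x <= t -> sp x = normal_speed eta0 c x.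
  move=> xst; have ix : piece i x by apply: UVI; [exact: near|exact: iI Is It x xst].
  rewrite /sp (cocycle_speedE Heta Hind I_itv ix) /index_speed /normal_speed.
  have li : limit_point (piece i) x by rewrite -[piece i]setIid; exact: pieceI_limit.
  have [Ux _] := near x xst.
  by rewrite (velocity_vel oU Ux sc cE ix li) cE.
have sub x : x \in `]s, t] -> s <= x <= t.
  by rewrite in_itv/= => /andP[/ltW -> ->].
have [m [d1 d2]] := H s t es st te.
have int_eq : (\int[mu]_(x in `]s, t]) (sp x)%:E =
               \int[mu]_(x in `]s, t]) (normal_speed eta0 c x)%:E)%E.
  by apply: eq_integral => x; rewrite inE/= => /sub/spE ->.
split.
  apply: eq_measurable_fun m => x; rewrite inE/= => /sub/spE /= ->.
  by [].
have [Us _] : (U `&` V) s by apply: near; rewrite lexx.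
have [Ut _] : (U `&` V) t by apply: near; rewrite lexx andbT.
have is_ : piece i s by apply: UVI => //; apply: near; rewrite lexx.
have it : piece i t by apply: UVI => //; apply: near; rewrite lexx andbT.
move=> j k js kt; rewrite int_eq.
have os := point_same_orbit js is_; have ot := point_same_orbit kt it.
rewrite -(cE s Us is_) in os; rewrite -(cE t Ut it) in ot.
by split; [exact: le_trans (normal_dist_same_orbit os ot) d1|
  exact: le_trans (normal_dist_same_orbit ot os) d2].
Qed.

Let bound_all (s t : R) : I s -> I t -> s <= t -> bound s t.
Proof.
move=> Is It st; have [iI _] := I_itv.
apply: (interval_induction st) => [u v w su uv vw wt|x xst].
  by apply: bound_trans => //; apply: (iI s t) => //; rewrite (le_trans su uv) (le_trans vw wt).
have Ix : I x by exact: (iI s t).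
have [e e0 H] := bound_local Ix; exists e => // u v su vt xu ux xv vx.
have uv := le_trans ux xv.
apply: H => //; apply: (iI s t) => //.
  by rewrite su (le_trans uv vt).
by rewrite vt (le_trans su uv).
Qed.

Lemma normal_dist_le_cocycle_length (i j : index a) (s t : R) x y :
  piece i s -> piece j t -> same_orbit (point_of i s) x ->
  same_orbit (point_of j t) y ->
  (normal_dist eta0 x y <= \int[mu]_(r in I) (sp r)%:E)%E.
Proof.
move=> is_ jt sx ty; have Is := piece_sub is_; have It := piece_sub jt.
have [iI _] := I_itv.
apply: le_trans (normal_dist_same_orbit (same_orbit_sym sx) (same_orbit_sym ty)) _.
have mono u v : I u -> I v -> (\int[mu]_(r in `]u, v]) (sp r)%:E <= \int[mu]_(r in I) (sp r)%:E)%E.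
  move=> Iu Iv; apply: ge0_integral_monotone => [r _|r _|r]; rewrite ?lee_fin//.
  rewrite /= in_itv/= => /andP[ur rv]; split => //.
  by apply: (iI u v) => //; rewrite (ltW ur) rv.
have [st|/ltW ts] := leP s t.
  by have [_ H] := bound_all Is It st; exact: le_trans (H i j is_ jt).1 (mono _ _ Is It).
by have [_ H] := bound_all It Is ts; exact: le_trans (H j i jt is_).2 (mono _ _ It Is).
Qed.

End LowerBound.

Lemma normal_dist_le_stacky_length (R : realType) (G : lie_groupoid R)
    (eta2 : metric (Pairs G)) (eta1 : metric (Ar G)) (eta0 : metric (Ob G))
    (I : set R) (alpha : stacky_curve G I) x y :
  groupoid_metric eta2 -> induced_metrics eta2 eta1 eta0 -> real_interval I ->
  stacky_image alpha (orbit_class x) -> stacky_image alpha (orbit_class y) ->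
  (normal_dist eta0 x y <= stacky_length eta0 alpha)%E.
Proof.
move=> Heta Hind I_itv [i [s [is_ /orbit_classP sx]]] [j [t [jt /orbit_classP ty]]].
exact: (normal_dist_le_cocycle_length Heta Hind I_itv is_ jt sx ty).
Qed.

(** * A smooth step function *)

Section FlatFunctions.
Variable R : realType.
Implicit Types (P : {poly R}) (x y : R).

(** Functions of this form are closed under derivation, with the derivative at
    zero equal to zero for all P. This makes the smoothness of exp(-1/x) at
    zero an induction. *)
Definition flat P x : R := if 0 < x then P.[x^-1] * expR (- x^-1) else 0.

Lemma pow_le_expR n y : 0 <= y -> y ^+ n <= n`!%:R * expR y.
Proof.
move=> y0; case: n => [|n]; first by rewrite expr0 mul1r -expR0 ler_expR.
have f0 : 0 < (n.+1)`!%:R :> R by rewrite ltr0n fact_gt0.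
rewrite mulrC -ler_pdivrMr//; apply: le_trans (expR_ge1Dxn n y0).
by rewrite lerDr.
Qed.

(** The quadratic bound gives both the continuity and the vanishing of the
    derivative at zero. *)
Lemma flat_bound P : exists2 C, 0 < C & forall x, `|flat P x| <= C * x ^+ 2.
Proof.
(* Each monomial y^i exp(-y) is at most (i + 2)! / y^2. *)
pose C := 1 + \sum_(i < size P) `|P`_i| * (i + 2)`!%:R.
have C0 : 0 < C.
  by rewrite ltr_pwDl// sumr_ge0// => i _; rewrite mulr_ge0.
exists C => // x; rewrite /flat; case: ifPn => [x0|_]; last first.
  by rewrite normr0 mulr_ge0 ?sqr_ge0// ltW.
set y := x^-1; have y0 : 0 < y by rewrite invr_gt0.
have -> : x ^+ 2 = (y ^+ 2)^-1 by rewrite /y exprVn invrK.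
rewrite ler_pdivlMr ?exprn_gt0// normrM (ger0_norm (expR_ge0 _)) horner_coef.
have e0 : 0 <= expR (- y) * y ^+ 2 by rewrite mulr_ge0 ?expR_ge0// sqr_ge0.
rewrite -mulrA (le_trans (ler_wpM2r e0 (ler_norm_sum _ _ _)))//.
rewrite mulr_suml /C -[leLHS]add0r lerD//; apply: ler_sum => i _.
rewrite normrM normrX (ger0_norm (ltW y0)) -mulrA ler_wpM2l//.
rewrite mulrCA -exprD mulrC expRN ler_pdivrMr ?expR_gt0//.
exact: pow_le_expR (ltW y0).
Qed.

(** With y = 1/x the derivative of P(y) exp(-y) is -y^2 (P'(y) - P(y)) exp(-y).
    *)
Lemma is_derive_flat P x :
  is_derive x 1 (flat P : R^o -> R^o) (flat ('X^2 * (P - P^`())) x).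
Proof.
have [x0|x0|->] := ltgtP x 0.
- apply: (@near_eq_is_derive _ _ _ (cst 0)).
    near=> y; rewrite /flat /cst ltNge ltW//; near: y; exact: lt_nbhsl.
  by rewrite /flat ltNge (ltW x0)/=; exact: is_derive_cst.
- apply: (@near_eq_is_derive _ _ _ (fun y => P.[y^-1] * expR (- y^-1))).
    near=> y; rewrite /flat ifT//; near: y; exact: lt_nbhsr.
  have xn0 : x != 0 by rewrite gt_eqF.
  have dv : is_derive x 1 (fun y : R => y^-1) (- x ^- 2).
    apply: is_derive_eq; first exact: is_deriveV.
    exact: mulr1.
  have dP : is_derive x 1 (fun y => P.[y^-1]) (P^`().[x^-1] * - x ^- 2).
    exact: (@is_derive1_comp _ (horner P) (fun y : R => y^-1)).
  have dN : is_derive x 1 (fun y : R => - y^-1) (x ^- 2).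
    by have := is_deriveN dv; rewrite opprK.
  have dE : is_derive x 1 (fun y => expR (- y^-1)) (expR (- x^-1) * x ^- 2).
    exact: (@is_derive1_comp _ expR (fun y : R => - y^-1)).
  have [H1 H2] := is_deriveM dP dE; split; first exact: H1.
  rewrite [LHS]H2 /flat x0 !hornerE exprVn /GRing.scale/=; ring.
- have [C C0 HC] := flat_bound P.
  apply: approx_derive => eta eta0; exists (eta / C); first by rewrite divr_gt0.
  move=> h he; rewrite {2 3}/flat ltxx [h *: 1](mulr1 h) addr0 subr0.
  rewrite scaler0 subr0 (le_trans (HC h))// -real_normK ?num_real// expr2 mulrA.
  by rewrite ler_wpM2r// mulrC -ler_pdivlMr// ltW.
Unshelve. all: by end_near. Qed.
End FlatFunctions.

Section SmoothStep.
Variable R : realType.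
Implicit Types (P : {poly R}) (x y : R).

Lemma flat_Ck k P : Ck (V := R^o) (W := R^o) k setT (flat P).
Proof.
have dflat (v : R) P' x : is_derive (x : R^o) v (flat P' : R^o -> R^o)
    (v *: (flat ('X^2 * (P' - P'^`())) x : R^o)).
  have [H1 H2] := is_derive_flat P' x.
  have := is_derive_scale_dir v H1; rewrite [_ *: 1](mulr1 v) => -[H3 H4].
  by split; [exact: H3|rewrite H4 H2].
have cf P' x : {for (x : R^o), continuous (flat P' : R^o -> R^o)}.
  apply: differentiable_continuous; apply/derivable1_diffP.
  by have [] := is_derive_flat P' x.
elim: k P => [|k IH] P; first by split=> // x _; exact: cf.
split=> [x _|v]; first exact: cf.
split=> [x _|]; first by have [] := dflat v P x.
apply: (@Ck_eq _ _ _ _ _ (fun x : R^o => v *: (flat ('X^2 * (P - P^`())) x : R^o))).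
- exact: openT.
- by move=> x _; have [_ ->] := dflat v P x.
- by apply: Ck_scale; [exact: openT|exact: Ck_cst|exact: IH].
Qed.

Let f x : R := flat 1 x.

Let f_gt0 x : 0 < x -> 0 < f x.
Proof. by move=> x0; rewrite /f /flat x0 hornerE mul1r expR_gt0. Qed.

Let f_le0 x : x <= 0 -> f x = 0.
Proof. by move=> x0; rewrite /f /flat ltNge x0. Qed.

Let f_ge0 x : 0 <= f x.
Proof. by have [/f_le0 ->//|/f_gt0/ltW] := leP x 0. Qed.

Let f_homo x y : x <= y -> f x <= f y.
Proof.
have [/f_le0 -> _|x0 xy] := leP x 0; first exact: f_ge0.
have y0 := lt_le_trans x0 xy.
by rewrite /f /flat x0 y0 !hornerE ler_expR lerN2 lef_pV2.
Qed.

(** The usual smooth transition from 0 on the negative half-line to 1 after 1,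
    all of whose derivatives vanish at both ends. *)
Definition smooth_step x : R := f x / (f x + f (1 - x)).

Let den_gt0 x : 0 < f x + f (1 - x).
Proof.
have [x0|x0] := leP x 0; last by rewrite ltr_pwDl// f_gt0.
by rewrite ltr_pwDr// f_gt0// subr_gt0 (le_lt_trans x0).
Qed.

Lemma smooth_step_Ck k : Ck (V := R^o) (W := R^o) k setT smooth_step.
Proof.
have C1 : Ck (V := R^o) (W := R^o) k setT f by exact: flat_Ck.
have C2 : Ck (V := R^o) (W := R^o) k setT (fun x => f (1 - x)).
  have -> : (fun x => f (1 - x)) = f \o (fun x : R^o => x *: (-1 : R^o) + 1).
    by apply/funext => x /=; congr f; rewrite [_ *: _]mulrN1 addrC.
  apply: (Ck_comp (@coordinates_line R) (U := setT)) => //; try exact: openT.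
  exact: Ck_line.
have C3 : Ck (V := R^o) (W := R^o) k setT (fun x => (f x + f (1 - x))^-1).
  apply: Ck_inv; [exact: openT|by move=> x _; rewrite gt_eqF|].
  exact: (Ck_add openT C1 C2).
exact: (Ck_scale openT C1 C3).
Qed.

Lemma smooth_step_le0 x : x <= 0 -> smooth_step x = 0.
Proof. by move=> x0; rewrite /smooth_step f_le0// mul0r. Qed.

Lemma smooth_step_ge1 x : 1 <= x -> smooth_step x = 1.
Proof.
move=> x1; rewrite /smooth_step [f (1 - x)]f_le0 ?subr_le0// addr0.
by rewrite divff// gt_eqF// f_gt0// (lt_le_trans ltr01).
Qed.

Lemma smooth_step_homo x y : x <= y -> smooth_step x <= smooth_step y.
Proof.
move=> xy; rewrite /smooth_step ler_pdivrMr// mulrAC ler_pdivlMr//.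
rewrite !mulrDr [f y * f x]mulrC lerD2l ler_pM//; apply: f_homo => //.
by rewrite lerD2l lerN2.
Qed.

Lemma smooth_step_itv x : 0 <= smooth_step x <= 1.
Proof.
rewrite /smooth_step divr_ge0 ?(ltW (den_gt0 x))//=.
by rewrite ler_pdivrMr// mul1r lerDl.
Qed.

End SmoothStep.

Lemma homo_derive_ge0 (R : realType) (f : R^o -> R^o) (x : R) :
  {homo f : x y / x <= y} -> derivable f x 1 -> 0 <= 'D_1 f x.
Proof.
move=> f_homo ds.
rewrite leNgt; apply/negP; set d := 'D_1 _ x => d0.
have eta0 : 0 < - d / 2 by rewrite divr_gt0// oppr_gt0.
have [e e0 H] := derivable_approx ds eta0.
have e2 : 0 < e / 2 by rewrite divr_gt0.
have := H (e / 2); rewrite (gtr0_norm e2) ltr_pdivrMr// mulr2n mulrDr mulr1 ltrDl e0.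
move=> /(_ isT); rewrite [_ *: 1](mulr1 (e / 2)) -/d ler_norml => /andP[_].
have : f x <= f (e / 2 + x) by apply: f_homo; rewrite lerDr ltW.
have : e / 2 * d < 0 by rewrite pmulr_rlt0.
rewrite -[1 + 1]/(2 : R); set h := e / 2; set y := f _; set z := f _.
have arith (a b D p : R) : p < 0 -> a <= b -> b - a - p <= - (p / 2) -> False by lra.
move=> p0 yz H'; apply: (arith y z d (h * d) p0 yz); apply: le_trans H' _.
by rewrite mulNr mulNr lerN2 [d / 2 * h]mulrAC [d * h]mulrC.
Qed.

(** * Smooth segments traversed with stops at both ends *)

Section Reparametrization.
Variables (R : realType).
Notation mu := (@lebesgue_measure R).

(** The change of variables formula, without injectivity of phi. A primitive of
    f composed with phi is a primitive of the first integrand, and both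
    integrals are differences of its values. *)
Lemma integral_reparam (f phi : R -> R) A B : A < B -> phi A < phi B ->
  (forall t, phi A <= phi t) -> continuous f ->
  (forall t, derivable (phi : R^o -> R^o) t 1) ->
  continuous (fun t => 'D_1 (phi : R^o -> R^o) t : R) ->
  (\int[mu]_(t in `[A, B]) ('D_1 (phi : R^o -> R^o) t * f (phi t))%:E =
   \int[mu]_(t in `[phi A, phi B]) (f t)%:E)%E.
Proof.
move=> AB pAB pA cf dphi cdphi.
have cphi : continuous phi.
  by move=> t; apply: differentiable_continuous; exact/derivable1_diffP/dphi.
(* The primitive starts strictly before phi A, so that it is two-sidedly
   derivable there. *)
pose L := phi A - 1.
pose F s := (\int[mu]_(t in `[L, s]) f t)%R.
have dF s : L < s -> derivable F s 1 /\ derive1 F s = f s.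
  move=> Ls; apply: (@continuous_FTC1_closed _ f L s (s + 1)) => //.
  - by rewrite ltrDl.
  - apply: continuous_compact_integrable; first exact: segment_compact.
    exact: continuous_subspaceT.
  - exact: cf.
have LA t : L < phi t by rewrite (lt_le_trans _ (pA t))// /L ltrBlDr ltrDl.
have cF s : L < s -> {for s, continuous F}.
  move=> Ls; apply: differentiable_continuous; apply/derivable1_diffP.
  by have [] := dF s Ls.
have LR (h : R -> R) t : {for t, continuous h} -> h s @[s --> t^'+] --> h t /\ h s @[s --> t^'-] --> h t.
  by move=> ct; split; [apply: cvg_at_right_filter|apply: cvg_at_left_filter].
have dFphi t : is_derive (t : R^o) 1 (F \o phi : R^o -> R^o) ('D_1 (phi : R^o -> R^o) t * f (phi t)).
  have [d1 d2] := dF (phi t) (LA t).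
  have H1 : is_derive (phi t : R^o) 1 (F : R^o -> R^o) (f (phi t)).
    by split; [exact: d1|rewrite -derive1E; exact: d2].
  have H2 : is_derive (t : R^o) 1 (phi : R^o -> R^o) ('D_1 (phi : R^o -> R^o) t).
    by split; [exact: dphi|].
  by have := is_derive1_comp H1 H2; rewrite mulrC.
rewrite (@continuous_FTC2 _ _ (F \o phi) A B)//.
- rewrite (@continuous_FTC2 _ f F (phi A) (phi B))//.
  + exact: continuous_subspaceT.
  + split.
    * move=> s; rewrite in_itv/= => /andP[ps _]; apply: (proj1 (dF s _)).
      exact: lt_trans (LA A) ps.
    * by have [] := LR F (phi A) (cF _ (LA A)).
    * by have [] := LR F (phi B) (cF _ (LA B)).
  + move=> s; rewrite in_itv/= => /andP[ps _]; apply: (proj2 (dF s _)).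
    exact: lt_trans (LA A) ps.
- apply: continuous_subspaceT => t; apply: cvgM; first exact: cdphi.
  by apply: continuous_comp; [exact: cphi|exact: cf].
- have cFp t : {for t, continuous (F \o phi)}.
    by apply: continuous_comp; [exact: cphi|exact: cF].
  split.
  + by move=> t _; have [] := dFphi t.
  + by have [] := LR (F \o phi) A (cFp A).
  + by have [] := LR (F \o phi) B (cFp B).
- by move=> t _; rewrite derive1E; have [] := dFphi t.
Qed.

End Reparametrization.

Record segment (R : realType) n (M : manifold R n) := {
  seg_start : R ;
  seg_end : R ;
  seg_lt : seg_start < seg_end ;
  seg_curve : R -> M ;
  seg_smooth : smooth_curve `[seg_start, seg_end] seg_curve
}.

Section Segments.
Variables (R : realType) (n : nat) (M : manifold R n).
Notation mu := (@lebesgue_measure R).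

Definition seg_source (s : segment M) : M := seg_curve s (seg_start s).
Definition seg_target (s : segment M) : M := seg_curve s (seg_end s).

Definition seg_length (g : metric M) (s : segment M) : \bar R :=
  (\int[mu]_(t in `[seg_start s, seg_end s])
    (tnorm g (seg_curve s t)
      (velocity `[seg_start s, seg_end s] (seg_curve s) t))%:E)%E.

Lemma constant_segment (x : M) : exists s : segment M,
  [/\ seg_source s = x, seg_target s = x & forall g, seg_length g s = 0%E].
Proof.
have sc : smooth_curve `[0, 1] (fun _ : R => x).
  move=> t _; exists setT, (fun=> x); split => //; first exact: openT.
  exact: smooth_into_cst.
exists (Build_segment (@ltr01 R) sc); split => // g.
apply: integral0_eq => t /= t01; congr (_%:E).
have lt := limit_point_itvcc (@ltr01 R) t01.
rewrite (@velocity_vel _ _ _ _ _ (fun=> x) setT)//.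
- by rewrite vel_cst tnorm0.
- exact: openT.
- exact: smooth_into_cst.
Qed.

(** The one-sided speed, extended to the line by its values at the endpoints,
    is continuous. This allows the fundamental theorem of calculus up to the
    ends of the segment. *)
Lemma segment_speed_continuous (g : metric M) (s : segment M) :
  exists f : R -> R, continuous f /\
    forall t c' (O : set R), open O -> O t -> smooth_into (V := R^o) O c' ->
      `[seg_start s, seg_end s]%classic t ->
      (forall r, O r -> `[seg_start s, seg_end s]%classic r -> c' r = seg_curve s r) ->
      f t = tnorm g (c' t) (vel c' t) /\
      f t = tnorm g (seg_curve s t)
              (velocity `[seg_start s, seg_end s] (seg_curve s) t).
Proof.
case: s => a b ab c sc /=; pose J := `[a, b]%classic.
pose clamp (t : R) := Num.min b (Num.max a t).
have cJ t : J (clamp t).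
  by rewrite /J /= in_itv/= /clamp le_min ge_min lexx le_max lexx (ltW ab).
have clampK t : J t -> clamp t = t.
  by rewrite /J/= in_itv/= => /andP[ta tb]; rewrite /clamp (max_idPr ta) (min_idPr tb).
have cclamp : continuous clamp.
  move=> t; apply: (@continuous_min _ _ (cst b) (fun t => Num.max a t)); first exact: cvg_cst.
  by apply: (@continuous_max _ _ (cst a) id) => //; exact: cvg_cst.
have lJ t : J t -> limit_point J t.
  exact: limit_point_itvcc.
pose sp t := tnorm g (c t) (velocity J c t).
have spE t c' O : open O -> O t -> smooth_into (V := R^o) O c' -> J t ->
    (forall r, O r -> J r -> c' r = c r) -> sp t = tnorm g (c' t) (vel c' t).
  move=> oO Ot sc' Jt cc'; rewrite /sp (velocity_vel oO Ot sc' cc' Jt (lJ _ Jt)).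
  by rewrite -(cc' _ Ot Jt).
exists (sp \o clamp); split; last first.
  move=> t c' O oO Ot sc' Jt cc'; rewrite /= (clampK _ Jt).
  by split; [exact: spE oO Ot sc' Jt cc'|reflexivity].
move=> t; have [ O [c' [oO Ot sc' cc']]] := sc _ (cJ t).
have nO : \forall r \near t, O (clamp r).
  by apply: cclamp; exact: open_nbhs_nbhs.
pose k r := tnorm g (c' r) (vel c' r).
have ck : {for t, continuous (k \o clamp)}.
  apply: continuous_comp; first exact: cclamp.
  exact: (@speed_continuous _ _ _ g c' O (clamp t) oO sc' Ot).
rewrite /continuous_at; have -> : (sp \o clamp) t = (k \o clamp) t.
  exact: spE oO Ot sc' (cJ t) cc'.
apply: cvg_trans ck; apply: near_eq_cvg; apply: filterS nO => r Or; apply/esym.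
exact: spE oO Or sc' (cJ r) cc'.
Qed.

(** Running through a segment with the parameter slowed down to a stop, to all
    orders, at both ends. Such a curve is smooth on the whole line and constant
    outside an interval of length one, so it can be glued to others by constant
    arrows; its length is unchanged. *)
Lemma segment_reparam (s : segment M) (m : R) : exists al : R -> M,
  [/\ smooth_into (V := R^o) setT al,
      forall t, t <= m -> al t = seg_source s,
      forall t, m + 1 <= t -> al t = seg_target s &
      forall (g : metric M) A B, A <= m -> m + 1 <= B ->
        (\int[mu]_(t in `[A, B]) (tnorm g (al t) (vel al t))%:E)%E =
        seg_length g s].
Proof.
case: (s) => a b ab c sc; rewrite /seg_source /seg_target /seg_length /=.
pose J := `[a, b]%classic.
(* The parameter goes from a to b while t goes from m to m + 1. *)
pose phi (t : R^o) : R^o := (b - a) * smooth_step (t - m) + a.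
have oT : open [set: R^o] by exact: openT.
have phiC k : Ck k setT phi.
  have C1 : Ck k setT (fun t : R^o => smooth_step (t - m) : R^o).
    have -> : (fun t : R^o => smooth_step (t - m) : R^o) =
        (@smooth_step R : R^o -> R^o) \o (fun t : R^o => t *: (1 : R^o) + (- m : R^o)).
      by apply/funext => t /=; rewrite [t *: _]mulr1.
    apply: (Ck_comp (@coordinates_line R) oT oT) => //; last exact: Ck_line.
    exact: smooth_step_Ck.
  have -> : phi = (fun r : R^o => r *: (b - a : R^o) + (a : R^o)) \o
      (fun t : R^o => smooth_step (t - m) : R^o).
    by apply/funext => t /=; rewrite /phi mulrC.
  by apply: (Ck_comp (@coordinates_line R) oT oT) => //; exact: Ck_line.
have phiJ t : J (phi t).
  have /andP[s0 s1] := smooth_step_itv (t - m).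
  have ba : 0 <= b - a by rewrite subr_ge0 ltW.
  rewrite /J/= in_itv/= /phi lerDr mulr_ge0//= -lerBrDr.
  by rewrite -[leRHS]mulr1 ler_wpM2l.
have phi_a t : t <= m -> phi t = a.
  by move=> tm; rewrite /phi smooth_step_le0 ?mulr0 ?add0r// subr_le0.
have phi_b t : m + 1 <= t -> phi t = b.
  by move=> tm; rewrite /phi smooth_step_ge1 ?mulr1 ?subrK// lerBrDl.
have dphi t : derivable phi t 1.
  by have [_ H] := phiC 1%N; have [d _] := H 1; exact: d.
have cdphi : continuous (fun t : R => 'D_1 phi t : R).
  by move=> t; have [_ /(_ 1)[_ [+ _]]] := phiC 1%N; exact.
have dphi_ge0 t : 0 <= 'D_1 phi t.
  apply: homo_derive_ge0 => // r r' rr; rewrite /phi lerD2r.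
  apply: ler_wpM2l; first by rewrite subr_ge0 ltW.
  by apply: smooth_step_homo; rewrite lerD2r.
have cphi : continuous phi.
  by move=> t; have [+ _] := phiC 0%N; exact.
have local t : exists (O O' : set R^o) c', [/\ open O, O (phi t), smooth_into O c',
     open O' /\ O' t & (forall r, O' r -> O (phi r)) /\ (forall r, O r -> J r -> c' r = c r)].
  have [ O [c' [oO Ot sc' cc']]] := sc _ (phiJ t).
  exists O, (phi @^-1` O), c'; split => //.
  by split => //; apply: open_comp => // r _; exact: cphi.
exists (c \o phi); split.
- apply: smooth_into_local => t _.
  have [ O [ O' [c' [oO Ot sc' [oO' O't] [ OO cc']]]]] := local t.
  exists O', (c' \o phi); split => //.
    apply: (smooth_into_comp (@coordinates_line R) oO oO' sc') => // k.
    exact: Ck_subset (phiC k).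
  by move=> r /OO Or /=; apply: cc' => //.
- by move=> t /phi_a /= ->.
- by move=> t /phi_b /= ->.
move=> g A B Am mB; have AB : A < B.
  by apply: le_lt_trans Am _; apply: lt_le_trans mB; rewrite ltrDl.
have [f [cf fE]] := segment_speed_continuous g (Build_segment ab sc).
rewrite /= in fE.
transitivity (\int[mu]_(t in `[phi A, phi B]) (f t)%:E)%E; last first.
  rewrite (phi_a _ Am) (phi_b _ mB); apply: eq_integral => t; rewrite inE => Jt.
  have [ O [c' [oO Ot sc' cc']]] := sc t Jt.
  by have [_ ->] := fE t c' O oO Ot sc' Jt cc'.
have pA r : phi A <= phi r.
  by rewrite (phi_a _ Am); have := phiJ r; rewrite /J/= in_itv/= => /andP[].
have pAB : phi A < phi B by rewrite (phi_a _ Am) (phi_b _ mB).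
rewrite -(integral_reparam AB pAB pA cf dphi cdphi).
apply: eq_integral => t _; congr (_%:E).
have [ O [ O' [c' [oO Ot sc' [oO' O't] [ OO cc']]]]] := local t.
have -> : vel (c \o phi) t = vel (c' \o phi) t.
  apply: vel_near_eq; apply: filterS (open_nbhs_nbhs (conj oO' O't)) => r /OO Or /=.
  by apply/esym; exact: cc'.
rewrite (vel_reparam oO sc' Ot (dphi t)).
have [-> _] := fE _ c' O oO Ot sc' (phiJ t) cc'.
rewrite /= -(cc' _ Ot (phiJ t)) tnormZ; congr (_ * _).
by rewrite ger0_norm.
Qed.

End Segments.

(** * From chains to sequences of segments *)

Section PiecewiseSmooth.
Variables (R : realType) (n : nat) (M : manifold R n) (g : metric M).
Notation mu := (@lebesgue_measure R).
Notation lmeasurable D f :=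
  (@measurable_fun _ _ (measurableTypeR R) _ D (f : _ -> \bar R)).

Notation speed c := (fun t => (tnorm g (c t) (velocity `[0, 1] c t))%:E).

(** Inside a smooth piece the velocity relative to the whole interval is the
    velocity relative to the piece; the endpoints form a null set. *)
Lemma segment_length_oc (c : R -> M) (a b : R) (ab : a < b)
    (sc : smooth_curve `[a, b] c) : 0 <= a -> b <= 1 ->
  lmeasurable `]a, b] (speed c) /\
  (\int[mu]_(t in `]a, b]) speed c t)%E = seg_length g (Build_segment ab sc).
Proof.
move=> a0 b1.
have [f [cf fE]] := segment_speed_continuous g (Build_segment ab sc).
rewrite /= in fE.
pose sp t := tnorm g (c t) (velocity `[0, 1] c t).
have spf t : t \in `]a, b[ -> sp t = f t.
  rewrite in_itv/= => /andP[ta tb].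
  have tJ : `[a, b]%classic t by rewrite /= in_itv/= !ltW.
  have [ O [c' [oO Ot sc' cc']]] := sc t tJ.
  have [-> _] := fE t c' O oO Ot sc' tJ cc'.
  pose O' : set R := O `&` `]a, b[%classic.
  have oO' : open O' by apply: openI => //; exact: itv_open.
  have O't : O' t by split => //; rewrite /= in_itv/= ta.
  have sc'' : smooth_into (V := R^o) O' c' by apply: smooth_into_subset sc' => r [].
  have t01 : `[0, 1]%classic t.
    by rewrite /= in_itv/= (le_trans a0 (ltW ta)) (le_trans (ltW tb) b1).
  have lt := limit_point_itvcc (@ltr01 R) t01.
  have cc'' r : O' r -> `[0, 1]%classic r -> c' r = c r.
    move=> [Or]; rewrite /= in_itv/= => /andP[ar rb] _; apply: cc' => //.
    by rewrite /= in_itv/= !ltW.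
  by rewrite /sp (velocity_vel oO' O't sc'' cc'' t01 lt) (cc' _ Ot tJ).
have mf (D : set R) : measurable D -> measurable_fun D f.
  by move=> mD; apply: measurable_funTS; exact: continuous_measurable_fun.
have msp : measurable_fun `]a, b[ sp.
  apply: (eq_measurable_fun f); last exact: mf.
  by move=> t; rewrite inE => /spf.
have msp' : lmeasurable `]a, b[ (EFin \o sp) by exact/measurable_EFinP.
split.
  by apply/measurable_EFinP; exact: (measurable_fun_itv_oc (b0 := false) (b1 := true) msp).
rewrite (integral_itv_bndoo false false msp').
transitivity (\int[mu]_(t in `]a, b[) (f t)%:E)%E.
  by apply: eq_integral => t; rewrite inE => /spf /= ->.
rewrite -(integral_itv_bndoo true false); last by apply/measurable_EFinP; exact: mf.
apply: eq_integral => t; rewrite inE => tJ.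
have [ O [c' [oO Ot sc' cc']]] := sc t tJ.
by have [_ ->] := fE t c' O oO Ot sc' tJ cc'.
Qed.

End PiecewiseSmooth.

Section Reach.
Variables (R : realType) (G : lie_groupoid R) (eta0 : metric (Ob G)).
Notation mu := (@lebesgue_measure R).
Implicit Types (x y z : Ob G) (l : \bar R).

(** Finitely many smooth segments joined by jumps along orbits, with only a
    bound on the total length: the notion is then stable under composition,
    lengths being added. *)
Definition reach x y l : Prop := exists (K : nat) (S : nat -> segment (Ob G)),
  [/\ same_orbit x (seg_source (S 0%N)),
      forall i, (i < K)%N -> same_orbit (seg_target (S i)) (seg_source (S i.+1)),
      same_orbit (seg_target (S K)) y &
      (\sum_(0 <= i < K.+1) seg_length eta0 (S i) <= l)%E].

Lemma reach_le x y l l' : (l <= l')%E -> reach x y l -> reach x y l'.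
Proof. by move=> ll [K [S [? ? ? H]]]; exists K, S; split => //; exact: le_trans ll. Qed.

Lemma reach_trans x y z l l' : reach x y l -> reach y z l' -> reach x z (l + l').
Proof.
move=> [K [S [xS SS Sy Sl]]] [K' [S' [yS' SS' S'z Sl']]].
exists (K + K'.+1)%N, (fun i => if (i <= K)%N then S i else S' (i - K.+1)%N); split => //.
- move=> i iK; case: (ltngtP i K) => [iK'|Ki|->].
  + exact: SS.
  + have -> : (i.+1 - K.+1 = (i - K.+1).+1)%N by lia.
    by apply: SS'; lia.
  + by rewrite subnn; exact: same_orbit_trans yS'.
- have -> : (K + K'.+1 <= K)%N = false by lia.
  by have -> : (K + K'.+1 - K.+1 = K')%N by lia.
- rewrite (@big_cat_nat _ _ _ K.+1)//=; last by lia.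
  apply: leeD.
    apply: le_trans Sl; rewrite le_eqVlt; apply/orP; left; apply/eqP.
    by apply: eq_big_nat => i /andP[_]; rewrite ltnS => ->.
  apply: le_trans Sl'; rewrite le_eqVlt; apply/orP; left; apply/eqP.
  rewrite -{1}[K.+1]add0n big_addn.
  have -> : ((K + K'.+1).+1 - K.+1 = K'.+1)%N by lia.
  apply: eq_big_nat => i _; have -> : (i + K.+1 <= K)%N = false by lia.
  by rewrite addnK.
Qed.

Lemma reach_segment (s : segment (Ob G)) :
  reach (seg_source s) (seg_target s) (seg_length eta0 s).
Proof.
exists 0%N, (fun=> s); split => //; try exact: same_orbit_refl.
by rewrite big_nat1.
Qed.

Lemma reach_orbit x y : same_orbit x y -> reach x y 0%E.
Proof.
have [s [sx sy s0]] := constant_segment x.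
move=> xy; exists 0%N, (fun=> s); rewrite sx sy; split => //; first exact: same_orbit_refl.
by rewrite big_nat1 s0.
Qed.

(** By induction on the number of smooth pieces; consecutive pieces are joined
    by a trivial jump. *)
Lemma reach_curve (c : R -> Ob G) : piecewise_smooth c ->
  reach (c 0) (c 1) (curve_length eta0 c).
Proof.
move=> [k [r [r0 rk rS sc]]].
have mono i j : (i <= j)%N -> (j <= k)%N -> r i <= r j.
  move=> + jk; elim: j jk => [|j IH] jk; first by rewrite leqn0 => /eqP ->.
  rewrite leq_eqVlt => /orP[/eqP -> //|]; rewrite ltnS => ij.
  by rewrite (le_trans (IH (ltnW jk) ij))// ltW// rS.
pose sp t := (tnorm eta0 (c t) (velocity `[0, 1] c t))%:E.
have sp0 t : (0 <= sp t)%E by rewrite lee_fin tnorm_ge0.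
have H j : (j <= k)%N -> @measurable_fun _ _ (measurableTypeR R) _ `]0, r j] sp /\
    reach (c 0) (c (r j)) (\int[mu]_(t in `]0%R, r j]) sp t)%E.
  elim: j => [_|j IH jk].
    rewrite r0 set_itvoc0; split; first exact: measurable_fun_set0.
    by rewrite integral_set0; exact/reach_orbit/same_orbit_refl.
  have [m1 R1] := IH (ltnW jk); have rj := rS j jk.
  have j0 : 0 <= r j by rewrite -r0 mono// ltnW.
  have j1 : r j.+1 <= 1 by rewrite -rk mono.
  have [m2 E2] := segment_length_oc eta0 rj (sc j jk) j0 j1.
  have [m3 E3] := integral_oc_split j0 (ltW rj) m1 m2 (fun t _ => sp0 t).
  split; [exact: m3|]; rewrite [X in reach _ _ X]E3; apply: reach_trans R1 _.
  by rewrite [X in reach _ _ X]E2; exact: (reach_segment (Build_segment rj (sc j jk))).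
have [_] := H k (leqnn k); rewrite rk; apply: reach_le.
apply: ge0_integral_monotone => [t _|t _|t /=]; [exact: sp0|exact: sp0|].
by rewrite !in_itv/= => /andP[t0 t1]; rewrite (ltW t0) t1.
Qed.

Lemma reach_riemannian_dist x y l : (riemannian_dist eta0 x y < l)%E -> reach x y l.
Proof.
move=> /ereal_inf_lt[_ [c [pc <- <- ->]] /ltW cl]; apply: reach_le cl _.
exact: reach_curve.
Qed.

(** Each distance is an infimum of lengths of curves, which is approached up to
    eps. *)
Lemma reach_chain x y n (c : nat -> Ob G) (d : nat -> R) (eps : R) : 0 < eps ->
  chain x y n c ->
  (forall i, (1 <= i <= n)%N ->
    riemannian_dist eta0 (c (2 * i - 1)%N) (c (2 * i)%N) = (d i)%:E) ->
  reach x y (\sum_(1 <= i < n.+1) d i + n%:R * eps)%:E.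
Proof.
move=> e0 [<- <- orb _] dE.
have H k : (k <= n)%N ->
    reach (c 0%N) (c (2 * k + 1)%N) (\sum_(1 <= i < k.+1) d i + k%:R * eps)%:E.
  elim: k => [_|k IH kn].
    by rewrite big_geq// mul0r addr0; apply: reach_orbit; exact: (orb 0%N).
  have -> : (\sum_(1 <= i < k.+2) d i + k.+1%:R * eps)%:E =
      ((\sum_(1 <= i < k.+1) d i + k%:R * eps)%:E + ((d k.+1 + eps)%:E + 0))%E.
    rewrite addr0 -EFinD big_nat_recr//= -natr1 mulrDl mul1r; congr (_%:E).
    by rewrite addrACA.
  apply: reach_trans (IH (ltnW kn)) _.
  apply: (@reach_trans _ (c (2 * k.+1)%N)); last by apply: reach_orbit; exact: orb.
  apply: reach_riemannian_dist; have := dE k.+1 kn.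
  have -> : (2 * k.+1 - 1 = 2 * k + 1)%N by lia.
  by move=> ->; rewrite lte_fin ltrDl.
exact: H.
Qed.

End Reach.

(** * From sequences of segments to stacky curves *)

Section StackyPath.
Variables (R : realType) (G : lie_groupoid R).
Notation sr := (@source R G).
Notation tg := (@target R G).
Variables (K : nat) (al : nat -> R -> Ob G) (p q : nat -> Ob G) (gl : nat -> Ar G).
Hypothesis al_smooth : forall k, smooth_into (V := R^o) setT (al k).
Hypothesis al_start : forall k t, t <= (2 * k)%:R -> al k t = p k.
Hypothesis al_end : forall k t, (2 * k)%:R + 1 <= t -> al k t = q k.
Hypothesis gl_source : forall k, (k < K)%N -> sr (gl k) = q k.
Hypothesis gl_target : forall k, (k < K)%N -> tg (gl k) = p k.+1.

Definition path_itv : set R := `[0, (2 * K + 1)%:R]%classic.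

(** The k-th segment is traversed during [2k, 2k + 1]. The open intervals
    overlap exactly on ]2k + 1, 2k + 2[, where the k-th curve has stopped and
    the next one has not started. *)
Definition path_piece (k : nat) : set R :=
  path_itv `&` `](2 * k)%:R - 1, (2 * k)%:R + 2[%classic.

Lemma path_itv_real : real_interval path_itv.
Proof.
split; first exact: interval_is_interval.
exists 0, (2 * K + 1)%:R; rewrite /path_itv /= !in_itv/= !lexx ler0n ltr0n addn1.
by split.
Qed.

Lemma path_piece_open k : exists2 O, open O & path_piece k = path_itv `&` O.
Proof. by eexists; last reflexivity; exact: itv_open. Qed.

Lemma path_piece_le k t : path_piece k t -> (k <= K)%N.
Proof.
move=> []; rewrite /path_itv /= !in_itv/= => /andP[_ tK] /andP[kt _].
have : (2 * k)%:R < (2 * K + 2)%:R :> R.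
  move: tK kt; rewrite !natrD; lra.
by rewrite ltr_nat; lia.
Qed.

Lemma path_piece_adj i j t : path_piece i t -> path_piece j t -> (j <= i.+1)%N.
Proof.
move=> [_ +] [_]; rewrite /= !in_itv/= => /andP[_ ti] /andP[jt _].
have : (2 * j)%:R < (2 * i + 3)%:R :> R by rewrite natrD; lra.
by rewrite ltr_nat; lia.
Qed.

Lemma path_piece_cover : \bigcup_k path_piece k = path_itv.
Proof.
apply/seteqP; split => [t [k _] []//|t It]; pose k := Num.truncn (t / 2).
move: (It); rewrite /path_itv /= in_itv/= => /andP[t0 _].
have /Num.Theory.truncn_itv : 0 <= t / 2 by rewrite divr_ge0.
rewrite -/k => /andP[kt tk]; exists k => //; split => //.
rewrite /= in_itv/= mul2n -addnn natrD.
by move: kt tk; rewrite -[k.+1%:R]natr1; lra.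
Qed.

Definition path_cover : open_cover path_itv :=
  {| index := nat; piece := path_piece; piece_open := path_piece_open;
     piece_cover := path_piece_cover |}.

(** The points on the overlap of consecutive pieces are at rest, so constant
    arrows glue them. *)
Lemma path_overlap i t : path_piece i t -> path_piece i.+1 t ->
  [/\ (i < K)%N, al i t = q i & al i.+1 t = p i.+1].
Proof.
move=> it jt; split; first exact: path_piece_le jt.
- apply: al_end; move: jt => -[_]; rewrite /= in_itv/= => /andP[+ _].
  rewrite mulnS natrD; lra.
- apply: al_start; move: it => -[_]; rewrite /= in_itv/= => /andP[_ +].
  rewrite mulnS natrD; lra.
Qed.

(** The last branch also covers pairs of indices whose pieces do not meet,
    where any smooth value will do. *)
Definition path_arrow (j i : nat) (t : R) : Ar G :=
  if j == i.+1 then gl i else if i == j.+1 then inv G (gl j)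
  else unit G (al i t).

Lemma path_arrow_diag i t : path_arrow i i t = unit G (al i t).
Proof. by rewrite /path_arrow; have -> : (i == i.+1) = false by lia. Qed.

Lemma path_arrow_succ i t : path_arrow i.+1 i t = gl i.
Proof. by rewrite /path_arrow eqxx. Qed.

Lemma path_arrow_pred i t : path_arrow i i.+1 t = inv G (gl i).
Proof. by rewrite /path_arrow eqxx; have -> : (i == i.+2) = false by lia. Qed.

Lemma path_adj i j t : path_piece i t -> path_piece j t ->
  [\/ j = i, j = i.+1 | i = j.+1].
Proof.
move=> it jt; have := path_piece_adj it jt; have := path_piece_adj jt it => H1 H2.
have [ij|ij|ij] := ltngtP i j; [constructor 2|constructor 3|constructor 1]; lia.
Qed.

Lemma path_arrow_ends j i t : path_piece i t -> path_piece j t ->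
  sr (path_arrow j i t) = al i t /\ tg (path_arrow j i t) = al j t.
Proof.
move=> it jt; case: (path_adj it jt) => E; move: it jt; rewrite E => it jt.
- by rewrite path_arrow_diag; split; [exact: src_unit|exact: tgt_unit].
- have [iK -> ->] := path_overlap it jt; rewrite path_arrow_succ.
  by rewrite gl_source// gl_target.
- have [iK -> ->] := path_overlap jt it; rewrite path_arrow_pred; split.
    by rewrite -(gl_target iK); exact: src_inv.
  by rewrite -(gl_source iK); exact: tgt_inv.
Qed.

Lemma smooth_into_curve n (M : manifold R n) (A : set R) (c : R -> M) :
  smooth_into (V := R^o) setT c -> smooth_curve A c.
Proof. by move=> sc t _; exists setT, c; split => //; exact: openT. Qed.

Lemma path_arrow_smooth j i : smooth_curve (path_piece i `&` path_piece j) (path_arrow j i).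
Proof.
apply: smooth_into_curve; rewrite /path_arrow.
case: (j == i.+1); first exact: smooth_into_cst.
case: (i == j.+1); first exact: smooth_into_cst.
by apply: (smooth_map_into (@unit_smooth _ G)); [exact: openT|exact: al_smooth].
Qed.

(** Three pieces with a common point have two equal indices, so the relation is
    a unit law or an inverse law. *)
Lemma path_arrow_mul k j i t : path_piece i t -> path_piece j t -> path_piece k t ->
  mul G (path_arrow k j t) (path_arrow j i t) = path_arrow k i t.
Proof.
move=> it jt kt.
have [E|ij] := eqVneq j i.
  have [s _] := path_arrow_ends it kt.
  by rewrite E path_arrow_diag -s; exact: mul_unitr.
have [E|kj] := eqVneq k j.
  have [_ s] := path_arrow_ends it jt.
  by rewrite E path_arrow_diag -s; exact: mul_unitl.
have [aij akj] := (path_adj it jt, path_adj jt kt).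
have E : k = i.
  have aik := path_adj it kt.
  by move: ij kj => /eqP ij /eqP kj; case: aij => ?; case: akj => ?; case: aik => ?; lia.
have [s _] := path_arrow_ends it jt; have [_ s'] := path_arrow_ends jt kt.
subst k; rewrite path_arrow_diag; case: aij => F; first by rewrite F eqxx in ij.
- subst j; rewrite -s path_arrow_succ path_arrow_pred; exact: mul_invl.
- subst i; rewrite -s' path_arrow_succ path_arrow_pred; exact: mul_invr.
Qed.

Definition path_cocycle : cocycle G path_itv :=
  @Build_cocycle R G path_itv path_cover path_arrow al
    path_arrow_smooth (fun i => smooth_into_curve (al_smooth i))
    (fun i t _ => path_arrow_diag i t)
    (fun j i t it jt => proj1 (path_arrow_ends it jt))
    (fun j i t it jt => proj2 (path_arrow_ends it jt))
    path_arrow_mul.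

End StackyPath.

Section StackyCurveOfReach.
Variables (R : realType) (G : lie_groupoid R).
Variables (eta2 : metric (Pairs G)) (eta1 : metric (Ar G)) (eta0 : metric (Ob G)).
Hypothesis (Heta : groupoid_metric eta2) (Hind : induced_metrics eta2 eta1 eta0).
Notation mu := (@lebesgue_measure R).

(** The smooth curves with stops are glued along the jumps by constant arrows.
    The normal speed is at most the speed, so the length of the result is at
    most the sum of the lengths of the segments. *)
Lemma stacky_curve_of_reach x y l : reach eta0 x y l ->
  exists (I : set R) (alpha : stacky_curve G I),
    [/\ real_interval I, stacky_image alpha (orbit_class x),
        stacky_image alpha (orbit_class y) &
        (stacky_length eta0 alpha <= l)%E].
Proof.
move=> [K [S [xS SS Sy Sl]]].
have /choice[al alP] k := segment_reparam (S k) (2 * k)%:R.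
have /choice[gl glP] k : exists g : Ar G, (k < K)%N ->
    source g = seg_target (S k) /\ target g = seg_source (S k.+1).
  case: (ltnP k K) => [kK|_]; first by have [g gP] := SS k kK; exists g.
  by exists (unit G x).
have alS k : smooth_into (V := R^o) setT (al k) by have [] := alP k.
have al_start k t : t <= (2 * k)%:R -> al k t = seg_source (S k).
  by have [_ + _ _] := alP k; exact.
have al_end k t : (2 * k)%:R + 1 <= t -> al k t = seg_target (S k).
  by have [_ _ + _] := alP k; exact.
have gl_source k : (k < K)%N -> source (gl k) = seg_target (S k) by move=> /glP[].
have gl_target k : (k < K)%N -> target (gl k) = seg_source (S k.+1) by move=> /glP[].
pose a := path_cocycle alS al_start al_end gl_source gl_target.
pose I := @path_itv R K; have Iitv : real_interval I by exact: path_itv_real.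
have K0 : 0 <= (2 * K)%:R :> R by exact: ler0n.
have I0 : @path_piece R K 0 0.
  by split; rewrite /path_itv /= in_itv/= ?lexx ?ler0n// muln0 sub0r add0r ltrN10 ltr0n.
have IK : @path_piece R K K (2 * K + 1)%:R.
  split; rewrite /path_itv /= in_itv/= natrD; lra.
exists I, (stacky_of a); split => //.
- have -> : orbit_class x = orbit_class (al 0%N 0).
    by apply/orbit_classP; rewrite al_start// muln0.
  exact: (@stacky_image_of _ _ _ a 0%N 0 I0).
- have -> : orbit_class y = orbit_class (al K (2 * K + 1)%:R).
    by apply/orbit_classP/same_orbit_sym; rewrite al_end// natrD.
  exact: (@stacky_image_of _ _ _ a K _ IK).
rewrite (stacky_length_of Heta Hind Iitv); apply: le_trans Sl.
pose sp k t := (tnorm eta0 (al k t) (vel (al k) t))%:E.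
have sp0 k t : (0 <= sp k t)%E by rewrite lee_fin tnorm_ge0.
have spE k : (k <= K)%N -> (\int[mu]_(t in I) sp k t = seg_length eta0 (S k))%E.
  move=> kK.
  have [_ _ _ H] := alP k; apply: H; first exact: ler0n.
  by rewrite natrD lerD2r ler_nat leq_mul2l.
apply: (@le_trans _ _ (\int[mu]_(t in I) (\sum_(i < K.+1) sp i t))%E).
  apply: ge0_integral_monotone => [t _|t _|t It].
  - rewrite lee_fin /cocycle_speed; case: pselect => [e|_] //; exact: tnorm_ge0.
  - by apply: sume_ge0 => i _.
  split=> //; have [i it] := cover_piece a It.
  rewrite (cocycle_speedE Heta Hind Iitv it).
  have iK := path_piece_le it.
  apply: (@le_trans _ _ (sp i t)); last first.
    rewrite (bigD1 (Ordinal (iK : (i < K.+1)%N)))//=.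
    by rewrite leeDl// sume_ge0.
  have lt : limit_point (path_piece (R := R) K i) t.
    by have := pieceI_limit Iitv it it; rewrite setIid.
  have V : velocity (path_piece (R := R) K i) (al i) t = vel (al i) t.
    exact: (@velocity_vel _ _ _ _ (al i) (al i) setT t (@openT R) Logic.I (alS i)
      (fun _ _ _ => erefl) it lt).
  rewrite lee_fin; change (normal_norm eta0 (al i t)
    (velocity (path_piece (R := R) K i) (al i) t) <= tnorm eta0 (al i t) (vel (al i) t)).
  rewrite V; exact: normal_norm_le.
rewrite ge0_integral_sum//.
- rewrite big_mkord; apply: lee_sum => i _.
  have iK : (i <= K)%N by rewrite -ltnS ltn_ord.
  by rewrite -(spE i iK) lexx.
- exact: measurable_itv.
- move=> i; apply/measurable_EFinP; apply: measurable_funTS.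
  apply: continuous_measurable_fun => t.
  exact: (@speed_continuous _ _ _ eta0 (al i) setT t openT (alS i)).
Qed.

End StackyCurveOfReach.

Theorem theorem3p9 (R : realType) (G : lie_groupoid R)
  (eta2 : metric (Pairs G)) (eta1 : metric (Ar G)) (eta0 : metric (Ob G))
  (Heta : groupoid_metric eta2) (Hind : induced_metrics eta2 eta1 eta0)
  (Hconn : connected [set: orbit_space G]) (x y : Ob G) :
  normal_dist eta0 x y =
  ereal_inf [set l : \bar R | exists (I : set R) (alpha : stacky_curve G I),
    [/\ real_interval I,
        stacky_image alpha (orbit_class x),
        stacky_image alpha (orbit_class y) &
        l = stacky_length eta0 alpha]].
Proof.
apply/le_anti/andP; split.
  apply: le_ereal_inf_tmp => _ [I [alpha [Iitv xI yI ->]]].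
  exact: (normal_dist_le_stacky_length Heta Hind Iitv xI yI).
apply: le_ereal_inf_tmp => _ [n [c [cP ->]]].
pose D i := riemannian_dist eta0 (c (2 * i - 1)%N) (c (2 * i)%N).
have D0 i : (0 <= D i)%E by exact: riemannian_dist_ge0.
have [[i iP Di]|fin] := pselect (exists2 i, (1 <= i < n.+1)%N & D i = +oo%E).
  rewrite (bigD1_seq i) ?mem_index_iota ?iota_uniq//=.
  have S0 : (0 <= \sum_(1 <= j < n.+1 | j != i) D j)%E by exact: sume_ge0.
  by rewrite -/(D i) Di addye ?leey// gt_eqF// (lt_le_trans _ S0)// ltNyr.
have dE i : (1 <= i <= n)%N -> D i = (fine (D i))%:E.
  move=> iP; rewrite fineK// ge0_fin_numE// ltey; apply/eqP => Di.
  by apply: fin; exists i.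
rewrite (eq_big_nat _ _ (F2 := fun i => (fine (D i))%:E)); last exact: dE.
rewrite sumEFin; apply/lee_addgt0Pr => e e0.
(* The excess is shared among the n distances of the chain; the denominator n +
   1 avoids the case n = 0. *)
pose eps := e / n.+1%:R; have eps0 : 0 < eps by rewrite divr_gt0.
have := reach_chain eps0 cP dE.
move=> /(stacky_curve_of_reach Heta Hind)[I [alpha [Iitv xI yI al]]].
apply: (@le_trans _ _ (stacky_length eta0 alpha)).
  by apply: ereal_inf_lbound; exists I, alpha.
apply: le_trans al _; rewrite -EFinD lee_fin lerD2l /eps mulrCA.
by rewrite ler_piMr ?(ltW e0)// ler_pdivrMr// mul1r ler_nat.
Qed.
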